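(* Let $\eta\in\mathbb{R}^3$ be a unit vector, $z\in\mathbb{R}$, and $P_{\eta,z}=\{x\in\mathbb{R}^3: x\cdot\eta=z\}$. Let $B$ be a vector field with values in $\mathbb{R}^3$ whose restriction to $P_{\eta,z}$ is smooth with compact support. Then the derivative $D\mathcal{S}_B$ is injective on the plane: any smooth compactly supported vector field $\delta B:P_{\eta,z}\to\mathbb{R}^3$ is uniquely determined by the values $D\mathcal{S}_B(\delta B)(x,\xi)$ for all $x\in P_{\eta,z}$ and all unit vectors $\xi$ with $\xi\cdot\eta=0$. Equivalently, if $D\mathcal{S}_B(\delta B)(x,\xi)=0$ for all such $x,\xi$, then $\delta B=0$ on $P_{\eta,z}$.
   Context: Here $\gamma_N\neq 0$ and $v>0$ are fixed real constants. For $b=(b_1,b_2,b_3)\in\mathbb{R}^3$, $$H(b)=\begin{pmatrix} 0 & b_3 & -b_2 \\ -b_3 & 0 & b_1 \\ b_2 & -b_1 & 0 \end{pmatrix}.$$ For $x\in P_{\eta,z}$ and a unit vector $\xi$ with $\xi\cdot\eta=0$, the $3\times 3$ matrix-valued function $\Sigma$ associated with $B$ is the solution along the line $s\mapsto x+s\xi$ of $$\frac{\partial}{\partial s}\Sigma(x+s\xi,\xi)=\frac{\gamma_N}{v}H(B(x+s\xi))\,\Sigma(x+s\xi,\xi),\qquad \lim_{s\to-\infty}\Sigma(x+s\xi,\xi)=I.$$ The forward map is $\mathcal{S}(B)(x,\xi)=\lim_{s\to\infty}\Sigma(x+s\xi,\xi)$, and its derivative at $B$ in the direction $\delta B$ is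 $$D\mathcal{S}_B(\delta B)(x,\xi)=\frac{\gamma_N}{v}\,\mathcal{S}(B)(x,\xi)\,H\left(\int_{-\infty}^{\infty}\Sigma(x+s\xi,\xi)^T\,\delta B(x+s\xi)\,ds\right).$$ *)

(* Defs.v *)
From HB Require Import structures.
From mathcomp Require Import all_boot all_order all_algebra.
From mathcomp Require Import all_classical all_reals all_analysis.

Set Implicit Arguments.
Unset Strict Implicit.
Unset Printing Implicit Defensive.

Import Order.TTheory GRing.Theory Num.Theory.
Import numFieldNormedType.Exports.

Local Open Scope classical_set_scope.
Local Open Scope ring_scope.

Section Defs.
Context {R : realType}.

Local Notation E := 'cV[R]_3.

(* The library norm on matrices is the sup norm, so unit vectors are defined
   through the dot product. *)
Definition dot (u w : E) : R := \sum_i u i 0 * w i 0.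

Definition unit_vector (u : E) : Prop := dot u u = 1.

Definition plane (eta : E) (z : R) : set E := [set x | dot x eta = z].

Definition direction (eta : E) : set E :=
  [set xi | unit_vector xi /\ dot xi eta = 0].

Fixpoint iter_derive (us : seq E) (f : E -> E) : E -> E :=
  if us is u :: us' then fun x => 'D_u (iter_derive us' f) x else f.

(* A vector field on P_{eta,z} is encoded as a total function on R^3, of which
   only the values on the plane are ever used: at points of the plane, the
   derivatives in directions orthogonal to eta depend only on these values.
   The restriction is C^oo when all iterated directional derivatives along the
   plane exist and are continuous on the plane. *)
Definition smooth_on_plane (eta : E) (z : R) (f : E -> E) : Prop :=
  forall us : seq E, (forall u, u \in us -> dot u eta = 0) ->
    {within plane eta z, continuous (iter_derive us f)} /\
    (forall x u, plane eta z x -> dot u eta = 0 ->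
       derivable (iter_derive us f) x u).

(* The plane is closed, so the closure in R^3 is the closure in the plane. *)
Definition compact_support_on_plane (eta : E) (z : R) (f : E -> E) : Prop :=
  compact (closure [set x | plane eta z x /\ f x <> 0]).

Definition H (b : E) : 'M[R]_3 :=
  let b1 := b 0 0 in let b2 := b 1 0 in let b3 := b 2%:R 0 in
  let rows := [:: [::    0;   b3; - b2];
                  [:: - b3;    0;   b1];
                  [::   b2; - b1;    0]] in
  \matrix_(i < 3, j < 3) (nth [::] rows i)`_j.

Definition is_Sigma (gammaN v : R) (eta : E) (z : R) (B : E -> E)
    (Sigma : E -> E -> 'M[R]_3) : Prop :=
  forall x xi : E, plane eta z x -> direction eta xi ->
    (forall s : R,
       is_derive s 1 (fun t : R => Sigma (x + t *: xi) xi)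
         ((gammaN / v) *: (H (B (x + s *: xi)) *m Sigma (x + s *: xi) xi))) /\
    Sigma (x + s *: xi) xi @[s --> -oo] --> (1%:M : 'M[R]_3).

(* S(B) and DS_B depend on B through the solution Sigma associated with B. *)
Definition forward_map (Sigma : E -> E -> 'M[R]_3) (x xi : E) : 'M[R]_3 :=
  lim (Sigma (x + s *: xi) xi @[s --> +oo]).

Definition line_integral (Sigma : E -> E -> 'M[R]_3) (dB : E -> E)
    (x xi : E) : E :=
  \col_i \int[lebesgue_measure]_(s in [set: R])
     (((Sigma (x + s *: xi) xi)^T *m dB (x + s *: xi)) i 0).

Definition D_forward_map (gammaN v : R) (Sigma : E -> E -> 'M[R]_3)
    (dB : E -> E) (x xi : E) : 'M[R]_3 :=
  (gammaN / v) *: (forward_map Sigma x xi *m H (line_integral Sigma dB x xi)).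

End Defs.

(* Main.v *)
Require Import Defs.
From HB Require Import structures.
From mathcomp Require Import all_boot all_order all_algebra.
From mathcomp Require Import all_classical all_reals all_analysis.
From mathcomp Require Import ring lra.

(** Let [A = (gammaN / v) H(B)], let [f] be the difference of the two fields, and
    let [e t] be the unit vector of angle [t] in the plane. Since [A] is skew,
    [Sigma] is orthogonal, so equality of the derivatives says that the
    integrals of [Sigma^T f] over all lines vanish. Hence the solution
    [U(p, t)] of [(e t . grad) U = A U + f] that vanishes far behind the support
    on each line is compactly supported in [p]; comparing difference quotients
    shows that it is C^1 in [p].

    Write [zeta = conj(z) e^(it)] and multiply [U] by the integrating factor
    [exp(- sigma h)], with [h = zeta^2 - |z|^2]. This leaves [A] unchanged but
    turns the Cauchy-Riemann operators acting on the Fourier modes in [t] into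
    [D = d + sigma conj(z)] and minus its adjoint, whose commutator is a
    positive constant proportional to [sigma]. As [exp(- sigma h)] is a
    multiple of an entire function of [e^(it)], the source contributes nothing
    to the modes [w_m] of one sign, so that [D w_(m+1) = D^* w_(m-1) + 2 A w_m]
    for [m >= 1]. For large [sigma] the resulting L^2 energies increase along
    the chain by at least the norms of the modes, whereas Bessel's inequality
    bounds their sum; hence these modes vanish. Undoing the holomorphic weight
    and using that [U] is real, all modes of [U] vanish, and therefore [f = 0]. *)

Set Implicit Arguments.
Unset Strict Implicit.
Unset Printing Implicit Defensive.

Import Order.TTheory GRing.Theory Num.Theory.
Import numFieldNormedType.Exports.

Local Open Scope classical_set_scope.
Local Open Scope ring_scope.

(** * Derivatives and integrals *)

Section Derivatives.
Context {R : realType}.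
Implicit Types f g : R -> R.

(** Without a weight each Cauchy-Riemann operator commutes with its adjoint, so the chain would only
    conserve the norms of the derivatives, and nothing could absorb [A]. A quadratic exponent makes
    the commutator constant in space, with a size that can be chosen freely. The obstacle is the
    pairing of D w_(m+2) with A w_(m+1): estimated by Cauchy-Schwarz it would cost a fraction of the
    derivative norm and destroy monotonicity. Skewness of [A] removes this loss: in the sum of two
    neighbouring pairings, an integration by parts leaves only first derivatives of [A]. This is why
    energies are compared in pairs of consecutive indices and why the derivatives of [A] must be
    bounded. [U] is known to be C^1 in the position and merely continuous in the angle; hence the
    energy identities are arranged to avoid second derivatives, and the only decay of modes that is
    used is the square summability given by Bessel's inequality at each point. Complex quantities
    are carried as pairs of real functions. *)

Definition der f (x l : R) := is_derive x (1 : R) f l.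

Lemma der_eq f x a b : der f x a -> a = b -> der f x b.
Proof. by move=> h <-. Qed.

Lemma der_cst c x : der (fun=> c) x 0.
Proof. exact: is_derive_cst. Qed.

Lemma der_id x : der (fun t => t) x 1.
Proof. exact: is_derive_id. Qed.

Lemma derD f g x a b : der f x a -> der g x b -> der (fun t => f t + g t) x (a + b).
Proof. exact: is_deriveD. Qed.

Lemma derB f g x a b : der f x a -> der g x b -> der (fun t => f t - g t) x (a - b).
Proof. exact: is_deriveB. Qed.

Lemma derN f x a : der f x a -> der (fun t => - f t) x (- a).
Proof. exact: is_deriveN. Qed.

Lemma derM f g x a b : der f x a -> der g x b ->
  der (fun t => f t * g t) x (f x * b + g x * a).
Proof. exact: is_deriveM. Qed.

Lemma derZ k f x a : der f x a -> der (fun t => k * f t) x (k * a).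
Proof. exact: is_deriveZ. Qed.

Lemma derXS n f x a : der f x a -> der (fun t => f t ^+ n.+1) x (n.+1%:R * f x ^+ n * a).
Proof.
move=> h; elim: n => [|n IH].
  by apply: der_eq h _; rewrite expr0 !mul1r.
under eq_fun do rewrite exprS.
by apply: der_eq (derM h IH) _; rewrite -[n.+2]addn1 natrD exprS; ring.
Qed.

Lemma der_sum (I : Type) (r : seq I) (F : I -> R -> R) x (dF : I -> R) :
  (forall i, der (F i) x (dF i)) ->
  der (fun t => \sum_(i <- r) F i t) x (\sum_(i <- r) dF i).
Proof.
move=> h; elim: r => [|i r IH].
  rewrite big_nil; under eq_fun do rewrite big_nil; exact: der_cst.
by rewrite big_cons; under eq_fun do rewrite big_cons; exact: derD.
Qed.

Lemma der_comp f g x a b : der g x a -> der f (g x) b ->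
  der (fun t => f (g t)) x (b * a).
Proof. by move=> dg df; apply: is_derive1_comp. Qed.

Lemma der_continuous f x a : der f x a -> {for x, continuous f}.
Proof. by move=> [/derivable1_diffP/differentiable_continuous]. Qed.

Lemma der_unique f x a b : der f x a -> der f x b -> a = b.
Proof. by move=> h1 h2; rewrite -(@derive_val _ _ _ _ _ _ _ h1) (@derive_val _ _ _ _ _ _ _ h2). Qed.

Lemma derP f x a : der f x a <-> (h^-1 * (f (x + h) - f x) @[h --> 0^'] --> a).
Proof.
have E : (fun h : R => h^-1 *: (f (h *: (1 : R) + x) - f x)) =
         (fun h => h^-1 * (f (x + h) - f x)).
  by apply/funext => h /=; rewrite scaler1 [h + x]addrC.
split=> [[df fa]|fa].
  by have := df; rewrite /derivable E => /cvg_ex[l hl];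
    move: fa; rewrite /derive E (cvg_lim _ hl)// => <-.
have df : derivable f x 1 by rewrite /derivable E; apply/cvg_ex; exists a.
by split=> //; rewrite /derive E; apply: cvg_lim.
Qed.

Lemma der_shift f x c a : der f (x + c) a -> der (fun t => f (t + c)) x a.
Proof.
move/derP => h; apply/derP.
by under eq_fun do rewrite addrAC.
Qed.

Lemma MVT_der f df a b : (forall x, der f x (df x)) ->
  exists2 c, `|c - a| <= `|b - a| & f b - f a = df c * (b - a).
Proof.
move=> h.
have cf : continuous f by move=> x; apply: der_continuous (h x).
have [ab|/ltW ba] := leP a b.
  have [c hc e] := MVT_segment ab (fun x _ => h x) (continuous_subspaceT cf).
  exists c => //; move: hc; rewrite in_itv/= => /andP[ac cb].
  by rewrite !ger0_norm ?subr_ge0// lerD2r.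
have [c hc e] := MVT_segment ba (fun x _ => h x) (continuous_subspaceT cf).
exists c; last by rewrite -opprB e; ring.
move: hc; rewrite in_itv/= => /andP[ac cb].
by rewrite !ler0_norm ?subr_le0// lerN2 lerD2r.
Qed.

Lemma der0_cst f : (forall x, der f x 0) -> forall x y, f x = f y.
Proof.
move=> h x y; have [c _] := MVT_der y x h; rewrite mul0r => /eqP.
by rewrite subr_eq0 => /eqP.
Qed.

Lemma der_le_nincr f df a b : a <= b -> (forall x, der f x (df x)) ->
  (forall x, a <= x <= b -> df x <= 0) -> f b <= f a.
Proof.
move=> ab h d0.
have cf : continuous f by move=> x; apply: der_continuous (h x).
have [c hc e] := MVT_segment ab (fun x _ => h x) (continuous_subspaceT cf).
rewrite -subr_le0 e mulr_le0_ge0 ?subr_ge0//; apply: d0.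
by move: hc; rewrite in_itv.
Qed.

End Derivatives.

(** * Continuity, and uniformity over compact sets of parameters *)

Section Continuity.
Context {R : realType} {T : topologicalType}.
Implicit Types f g : T -> R.

Lemma cts_cst (U : topologicalType) (c : U) : continuous (fun _ : T => c).
Proof. by move=> x; apply: cvg_cst. Qed.

Lemma ctsD f g : continuous f -> continuous g -> continuous (fun t => f t + g t).
Proof. by move=> cf cg x; apply: cvgD; [apply: cf|apply: cg]. Qed.

Lemma ctsB f g : continuous f -> continuous g -> continuous (fun t => f t - g t).
Proof. by move=> cf cg x; apply: cvgB; [apply: cf|apply: cg]. Qed.

Lemma ctsN f : continuous f -> continuous (fun t => - f t).
Proof. by move=> cf x; apply: cvgN; apply: cf. Qed.

Lemma ctsM f g : continuous f -> continuous g -> continuous (fun t => f t * g t).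
Proof. by move=> cf cg x; apply: cvgM; [apply: cf|apply: cg]. Qed.

Lemma ctsX f n : continuous f -> continuous (fun t => f t ^+ n).
Proof.
move=> cf; elim: n => [|n IH].
  by under eq_fun do rewrite expr0; apply: cts_cst.
by under eq_fun do rewrite exprS; apply: ctsM.
Qed.

Lemma cts_sum (I : Type) (r : seq I) (F : I -> T -> R) :
  (forall i, continuous (F i)) -> continuous (fun t => \sum_(i <- r) F i t).
Proof.
move=> h; elim: r => [|i r IH].
  by under eq_fun do rewrite big_nil; apply: cts_cst.
by under eq_fun do rewrite big_cons; apply: ctsD.
Qed.

Lemma cts_comp (U V : topologicalType) (f : U -> V) (g : T -> U) :
  continuous f -> continuous g -> continuous (fun t => f (g t)).
Proof. by move=> cf cg x; apply: (@continuous_comp _ _ _ g f); [apply: cg|apply: cf]. Qed.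

Lemma cts_cos f : continuous f -> continuous (fun t => cos (f t)).
Proof. exact/cts_comp/continuous_cos. Qed.

Lemma cts_sin f : continuous f -> continuous (fun t => sin (f t)).
Proof. exact/cts_comp/continuous_sin. Qed.

Lemma cts_expR f : continuous f -> continuous (fun t => expR (f t)).
Proof. exact/cts_comp/continuous_expR. Qed.

Lemma cts_pair (U V : topologicalType) (f : T -> U) (g : T -> V) :
  continuous f -> continuous g -> continuous (fun t => (f t, g t)).
Proof. by move=> cf cg x; apply: cvg_pair; [apply: cf|apply: cg]. Qed.

Lemma cts_fst (U V : topologicalType) (f : T -> U * V) :
  continuous f -> continuous (fun t => (f t).1).
Proof. by apply: cts_comp => x; apply: cvg_fst. Qed.

Lemma cts_snd (U V : topologicalType) (f : T -> U * V) :
  continuous f -> continuous (fun t => (f t).2).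
Proof. by apply: cts_comp => x; apply: cvg_snd. Qed.

Lemma cts_id : continuous (fun t : T => t).
Proof. by move=> x; apply: cvg_id. Qed.

Lemma cts_app2 (U V W : topologicalType) (f : U -> V -> W) (g : T -> U) (h : T -> V) :
  continuous (fun q : U * V => f q.1 q.2) -> continuous g -> continuous h ->
  continuous (fun t => f (g t) (h t)).
Proof.
move=> cf cg ch; apply: (@cts_comp _ _ (fun q : U * V => f q.1 q.2) (fun t => (g t, h t))) => //.
exact: cts_pair.
Qed.

(** Tube lemma. Continuity is asked only at the points [(t0, s)], because the difference quotients
    [slope] are known to be jointly continuous only at increment 0. *)
Lemma near_uniform_compact (X : topologicalType) (K : set X) (phi : T -> X -> R) (t0 : T) :
  compact K -> (forall s, {for (t0, s), continuous (fun q : T * X => phi q.1 q.2)}) ->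
  forall e, 0 < e -> \forall t \near t0, forall s, K s -> `|phi t s - phi t0 s| <= e.
Proof.
move=> /compact_near_coveringP cK cphi e e0.
suff h (s : X) : \forall s' \near s & t \near t0, `|phi t s' - phi t0 s'| <= e.
  have := cK T (nbhs t0) (fun t s => `|phi t s - phi t0 s| <= e) _ (fun s _ => h s).
  move=> H; near=> t => s hs.
  have : K `<=` (fun s => `|phi t s - phi t0 s| <= e) by near: t; exact: H.
  exact.
have e2 : 0 < e / 2 by rewrite divr_gt0.
have /cvgrPdist_le/(_ _ e2) h1 := cphi s.
have h2 : \forall s' \near s, `|phi t0 s - phi t0 s'| <= e / 2.
  have c2 : {for s, continuous (fun s' => phi t0 s')}.
    apply: (@continuous_comp _ _ _ (fun s' : X => (t0, s')) (fun q : T * X => phi q.1 q.2)).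
      have c0 : (fun _ : X => t0) @ s --> t0 by apply: cvg_cst.
      exact: (cvg_pair c0 cvg_id).
    exact: cphi.
  by have /cvgrPdist_le/(_ _ e2) := c2.
case: h1 => /= -[P Q] /= [hP hQ] hPQ.
exists (Q `&` [set s' | `|phi t0 s - phi t0 s'| <= e / 2], P) => /=.
  by split => //; apply: filterI.
move=> [s' t] /= [[Qs' hs'] Pt].
rewrite (splitr e) -(subrKA (phi t0 s)) (le_trans (ler_normD _ _))// lerD//.
by rewrite distrC; apply: (hPQ (t, s')).
Unshelve. all: by end_near. Qed.

Lemma near_uniform_itv (phi : T -> R -> R) (t0 : T) (a b : R) :
  (forall s, {for (t0, s), continuous (fun q : T * R => phi q.1 q.2)}) ->
  forall e, 0 < e ->
  \forall t \near t0, forall s, a <= s <= b -> `|phi t s - phi t0 s| <= e.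
Proof.
move=> cphi e e0.
have := near_uniform_compact (@segment_compact R a b) cphi e0.
by apply: filterS => t h s hs; apply: h; rewrite /= in_itv.
Qed.

End Continuity.

(** * Integrals of continuous functions over segments *)

Section Integral.
Context {R : realType}.
Implicit Types (f g : R -> R) (a b : R).

(** For [b < a] the segment is empty and the value is 0, not minus the integral over the reversed
    segment. *)
Definition itg a b f : R := \int[lebesgue_measure]_(x in `[a, b]) f x.

Lemma itg_integrable a b f : continuous f ->
  (@lebesgue_measure R).-integrable `[a, b] (EFin \o f).
Proof.
move=> cf; apply: continuous_compact_integrable; first exact: segment_compact.
exact: continuous_subspaceT.
Qed.
Local Hint Resolve itg_integrable : core.

Lemma itgD a b f g : continuous f -> continuous g ->
  itg a b (fun x => f x + g x) = itg a b f + itg a b g.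
Proof. by move=> cf cg; rewrite /itg RintegralD//; apply: itg_integrable. Qed.

Lemma itgB a b f g : continuous f -> continuous g ->
  itg a b (fun x => f x - g x) = itg a b f - itg a b g.
Proof. by move=> cf cg; rewrite /itg RintegralB//; apply: itg_integrable. Qed.

Lemma itgZ a b k f : continuous f -> itg a b (fun x => k * f x) = k * itg a b f.
Proof. by move=> cf; rewrite /itg RintegralZl//; apply: itg_integrable. Qed.

Lemma itg0 a b : itg a b (fun=> 0) = 0.
Proof. by rewrite /itg /Rintegral integral0. Qed.

Lemma itg_cst a b k : a <= b -> itg a b (fun=> k) = k * (b - a).
Proof.
move=> ab; rewrite /itg Rintegral_cst//=; congr (_ * _).
rewrite lebesgue_measure_itv/= lte_fin.
by move: ab; rewrite le_eqVlt => /predU1P[->|->]//; rewrite ltxx subrr.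
Qed.

Lemma itg_sum a b (I : Type) (r : seq I) (F : I -> R -> R) :
  (forall i, continuous (F i)) ->
  itg a b (fun x => \sum_(i <- r) F i x) = \sum_(i <- r) itg a b (F i).
Proof.
move=> cF; elim: r => [|i r IH].
  by rewrite big_nil; under eq_fun do rewrite big_nil; apply: itg0.
rewrite big_cons; under eq_fun do rewrite big_cons.
by rewrite itgD ?IH//; apply: cts_sum.
Qed.

Lemma le_itg a b f g : continuous f -> continuous g ->
  (forall x, a <= x <= b -> f x <= g x) -> itg a b f <= itg a b g.
Proof.
by move=> cf cg h; apply: le_Rintegral => //; exact: itg_integrable.
Qed.

Lemma eq_itg a b f g : (forall x, a <= x <= b -> f x = g x) -> itg a b f = itg a b g.
Proof. by move=> h; apply: eq_Rintegral => x; rewrite inE/= in_itv/=; apply: h. Qed.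

Lemma itg_ge0 a b f : (forall x, a <= x <= b -> 0 <= f x) -> 0 <= itg a b f.
Proof. by move=> h; apply: Rintegral_ge0 => x; rewrite /= in_itv/=; apply: h. Qed.

Lemma itg_norm_le a b f M : a <= b -> continuous f ->
  (forall x, a <= x <= b -> `|f x| <= M) -> `|itg a b f| <= M * (b - a).
Proof.
move=> ab cf h; rewrite -itg_cst//; apply: le_trans (le_normr_Rintegral _ _) _ => //.
  exact: itg_integrable.
have cn : continuous (fun x => `|f x|) by apply: cts_comp => // x; apply: norm_continuous.
by apply: (le_itg cn _ h); apply: cts_cst.
Qed.

Lemma itg_FTC a b f F : a < b -> continuous f -> (forall x, der F x (f x)) ->
  itg a b f = F b - F a.
Proof.
move=> ab cf dF; rewrite /itg /Rintegral (@continuous_FTC2 _ _ F)//.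
- exact: continuous_subspaceT.
- have cF : continuous F by move=> x; apply: der_continuous (dF x).
  split=> [x _|  |]; first by have [] := dF x.
    by apply: cvg_at_right_filter; apply: cF.
  by apply: cvg_at_left_filter; apply: cF.
- by move=> x _; rewrite derive1E; apply: (@derive_val _ _ _ _ _ _ _ (dF x)).
Qed.

Lemma itg_param_cvg (T : topologicalType) (phi : T -> R -> R) (t0 : T) a b : a < b ->
  (forall t, continuous (phi t)) ->
  (forall s, {for (t0, s), continuous (fun q : T * R => phi q.1 q.2)}) ->
  itg a b (phi t) @[t --> t0] --> itg a b (phi t0).
Proof.
move=> ab ct cj; apply/cvgrPdist_le => e e0.
have d0 : 0 < b - a by rewrite subr_gt0.
have := near_uniform_itv a b cj (divr_gt0 e0 d0).
apply: filterS => t h; rewrite distrC -itgB//.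
rewrite -(divfK (lt0r_neq0 d0) e); apply: itg_norm_le => //; first exact: ltW.
exact: ctsB.
Qed.

Lemma itg_param_continuous (T : topologicalType) (phi : T -> R -> R) a b : a < b ->
  continuous (fun q : T * R => phi q.1 q.2) ->
  continuous (fun t => itg a b (phi t)).
Proof.
move=> ab cp t0; apply: itg_param_cvg => // [t|s]; last exact: cp.
apply: cts_app2 => //; [exact: cts_cst|exact: cts_id].
Qed.

End Integral.

(** * The fundamental theorem and differentiation under the integral sign *)

Section Calculus.
Context {R : realType}.
Implicit Types (f g : R -> R) (a b : R).

Lemma exists_antiderivative f a b : continuous f ->
  exists F, forall x, a <= x <= b -> der F x (f x).
Proof.
(* Starting at [a - 1] makes every point of the segment, its left end included, interior to the
   range of the fundamental theorem. *)
move=> cf; exists (fun x => itg (a - 1) x f) => x /andP[ax xb].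
have := @continuous_FTC1 R f (BLeft (a - 1)) x (b + 1).
move=> /(_ _ _ _ _)[|||/=|dF eF].
- by rewrite (le_lt_trans xb)// ltrDl.
- exact: itg_integrable.
- by rewrite lte_fin (lt_le_trans _ ax)// ltrBlDr ltrDl.
- exact: cf.
- by split => //; rewrite -derive1E.
Qed.

Lemma itg_FTC_in a b f F : a < b -> continuous f ->
  (forall x, a <= x <= b -> der F x (f x)) -> itg a b f = F b - F a.
Proof.
move=> ab cf dF; rewrite /itg /Rintegral (@continuous_FTC2 _ _ F)//.
- exact: continuous_subspaceT.
- have cF x : a <= x <= b -> {for x, continuous F}.
    by move=> hx; apply: der_continuous (dF x hx).
  have la : a <= b := ltW ab.
  split=> [x|  |].
  + by rewrite in_itv/= => /andP[/ltW ax /ltW xb]; have [|] := dF x; rewrite ?ax.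
  + by apply: cvg_at_right_filter; apply: cF; rewrite lexx.
  + by apply: cvg_at_left_filter; apply: cF; rewrite lexx andbT.
- move=> x; rewrite in_itv/= => /andP[/ltW ax /ltW xb]; rewrite derive1E.
  by have d := dF x; rewrite (@derive_val _ _ _ _ _ _ _ (d _))// ax.
Qed.

Lemma itg_eq0_in a b f : a < b -> continuous f -> (forall x, 0 <= f x) ->
  itg a b f = 0 -> forall x, a <= x < b -> f x = 0.
Proof.
move=> ab cf f0 i0 x /andP[ax xb]; apply/eqP; apply/negPn/negP => fx.
have fx0 : 0 < f x by rewrite lt0r fx f0.
have [F dF] := exists_antiderivative a b cf.
have FE := itg_FTC_in ab cf dF.
have mono u v : a <= u -> u <= v -> v <= b -> F u <= F v /\
    (u < v -> exists2 c, u <= c <= v & F v - F u = f c * (v - u)).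
  move=> au uv vb.
  have [|y hy|c hc e] := @MVT_segment R F f u v uv.
  - by move=> y; rewrite in_itv/= => /andP[/ltW uy /ltW yv]; apply: dF; rewrite (le_trans au)// (le_trans yv).
  - apply: derivable_within_continuous => z; rewrite in_itv/= => /andP[uz zv].
    by have [] : der F z (f z) by apply: dF; rewrite (le_trans au)// (le_trans zv).
  - split; last by exists c => //; move: hc; rewrite in_itv.
    by rewrite -subr_ge0 e mulr_ge0// subr_ge0.
have := cf x => /cvgrPdist_lt/(_ _ fx0)[/= d d0 hd].
(* Continuity makes [f] positive on the segment from [x] to [v], which has positive length because
   [x < b]; the antiderivative increases strictly there. *)
pose v := Num.min b (x + d / 2).
have xv : x < v by rewrite lt_min xb ltrDl divr_gt0.
have vb : v <= b by rewrite ge_min lexx.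
have [_ /(_ xv)[c /andP[xc cv] e]] := mono _ _ ax (ltW xv) vb.
have fc : 0 < f c.
  have : `|f x - f c| < f x.
    apply: hd; rewrite /= distrC ger0_norm ?subr_ge0//.
    have : v <= x + d / 2 by rewrite ge_min lexx orbT.
    by move: d0; lra.
  by rewrite ltr_norml => /andP[_]; lra.
have [h1 _] := mono _ _ (lexx a) ax (ltW xb).
have [h2 _] := mono _ _ (le_trans ax (ltW xv)) vb (lexx b).
have : 0 < f c * (v - x) by rewrite mulr_gt0// subr_gt0.
move: FE; rewrite i0 -e; lra.
Qed.

(** Uniform convergence on the segment takes the place of dominated convergence. The kernel has to
    reproduce the increment of [F] only after integration; [J_jacobian] exploits this with a kernel
    that is not the pointwise quotient. *)
Lemma der_itg_slope (F : R -> R) (K : R -> R -> R) x a b : a < b ->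
  (forall h, continuous (K h)) ->
  (forall s, {for (0, s), continuous (fun q : R * R => K q.1 q.2)}) ->
  (forall h, h != 0 -> F (x + h) - F x = h * itg a b (K h)) ->
  der F x (itg a b (K 0)).
Proof.
move=> ab cK cK0 FK; apply/derP.
have h1 : itg a b (K h) @[h --> 0^'] --> itg a b (K 0).
  apply: cvg_within_filter; apply: itg_param_cvg => //.
apply: cvg_trans h1; apply: near_eq_cvg.
near=> h.
have h0 : h != 0 by near: h; exact: nbhs_dnbhs_neq.
by rewrite FK// mulKf.
Unshelve. all: by end_near. Qed.

(** Filling in the derivative at [h = 0] lets the quotient be treated as a function continuous at 0,
    without punctured neighbourhoods under the integral. *)
Definition slope (f : R -> R) (df x h : R) : R :=
  if h == 0 then df else h^-1 * (f (x + h) - f x).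

(** By the mean value theorem the quotient with increment [h] is a value of [df] within [|h|] of
    [x], so it inherits the joint continuity of [df]. *)
Lemma slope_near0 (T : topologicalType) (f df : R -> T -> R) x :
  (forall x t, der (f ^~ t) x (df x t)) ->
  continuous (fun q : R * T => df q.1 q.2) ->
  forall t, {for (0, t), continuous (fun q : R * T => slope (f ^~ q.2) (df x q.2) x q.1)}.
Proof.
move=> dd cd t; apply/cvgrPdist_lt => /= e e0; rewrite /slope/= eqxx.
have := cd (x, t) => /cvgrPdist_lt/(_ _ e0)[/= [P Q] /= [[/= d d0 hP] hQ] hPQ].
exists (ball (0 : R) d, Q) => /=; first by split => //; exists d.
move=> [h s] /= [hh Qs]; case: eqP => [_|/eqP h0].
  by apply: (hPQ (x, s)); split => //=; apply: hP; rewrite /ball/= subrr normr0.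
have [c hc ->] := MVT_der x (x + h) (fun x => dd x s).
rewrite [x + h - x]addrAC subrr add0r mulrCA mulVf// mulr1.
apply: (hPQ (c, s)); split => //=; apply: hP; rewrite /ball/= distrC.
by apply: le_lt_trans hc _; move: hh; rewrite /ball/= sub0r normrN addrAC subrr add0r.
Qed.

Lemma slope_cts (T : topologicalType) (f df : R -> T -> R) x h :
  (forall x, continuous (f x)) -> (forall x, continuous (df x)) ->
  continuous (fun t => slope (f ^~ t) (df x t) x h).
Proof.
move=> cf cdf; rewrite /slope; case: eqP => _; first exact: cdf.
by apply: ctsM; [exact: cts_cst|exact: ctsB].
Qed.

Lemma slopeE f df x h : h * slope f df x h = if h == 0 then 0 else f (x + h) - f x.
Proof. by rewrite /slope; case: eqP => [->|/eqP h0]; [rewrite mul0r|rewrite mulVKf]. Qed.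

Lemma cts2_r (T U V : topologicalType) (f : T -> U -> V) t :
  continuous (fun q : T * U => f q.1 q.2) -> continuous (f t).
Proof. by move=> cf; apply: cts_app2; [exact: cf|exact: cts_cst|exact: cts_id]. Qed.

Lemma cts2_l (T U V : topologicalType) (f : T -> U -> V) u :
  continuous (fun q : T * U => f q.1 q.2) -> continuous (f ^~ u).
Proof. by move=> cf; apply: (cts_app2 (f := f)); [exact: cf|exact: cts_id|exact: cts_cst]. Qed.

Lemma der_itg (f df : R -> R -> R) a b x : a < b ->
  (forall x s, der (f ^~ s) x (df x s)) ->
  (forall x, continuous (f x)) ->
  continuous (fun q : R * R => df q.1 q.2) ->
  der (fun x => itg a b (f x)) x (itg a b (df x)).
Proof.
move=> ab dd cf cdf.
have cdfx y : continuous (df y) by apply: cts2_r.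
have -> : itg a b (df x) = itg a b (fun s => slope (f ^~ s) (df x s) x 0).
  by congr itg; apply/funext => s; rewrite /slope eqxx.
apply: (der_itg_slope (K := fun h s => slope (f ^~ s) (df x s) x h)) => //.
- by move=> h; apply: slope_cts.
- by apply: slope_near0.
- move=> h h0; rewrite -itgB// -itgZ; last exact: slope_cts.
  by congr itg; apply/funext => s; rewrite slopeE (negbTE h0).
Qed.

End Calculus.

(** * Compactly supported functions of two variables *)

Section DoubleIntegral.
Context {R : realType}.
Implicit Types (f g p q : R -> R -> R).

Definition cts2 f := continuous (fun z : R * R => f z.1 z.2).

Lemma cts2D f g : cts2 f -> cts2 g -> cts2 (fun x y => f x y + g x y).
Proof. exact: ctsD. Qed.
Lemma cts2B f g : cts2 f -> cts2 g -> cts2 (fun x y => f x y - g x y).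
Proof. exact: ctsB. Qed.
Lemma cts2N f : cts2 f -> cts2 (fun x y => - f x y).
Proof. exact: ctsN. Qed.
Lemma cts2M f g : cts2 f -> cts2 g -> cts2 (fun x y => f x y * g x y).
Proof. exact: ctsM. Qed.
Lemma cts2X f n : cts2 f -> cts2 (fun x y => f x y ^+ n).
Proof. exact: ctsX. Qed.
Lemma cts2_cst k : cts2 (fun _ _ => k).
Proof. exact: cts_cst. Qed.
Lemma cts2_x : cts2 (fun x _ => x).
Proof. by move=> ?; exact: cvg_fst. Qed.
Lemma cts2_y : cts2 (fun _ y => y).
Proof. by move=> ?; exact: cvg_snd. Qed.
Lemma cts2_sum (I : Type) (r : seq I) (F : I -> R -> R -> R) :
  (forall i, cts2 (F i)) -> cts2 (fun x y => \sum_(i <- r) F i x y).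
Proof. by move=> h; apply: (@cts_sum _ _ _ r (fun i z => F i z.1 z.2)). Qed.

Variable L : R.
Hypothesis L0 : 0 < L.

Let LL : - L < L. Proof. by rewrite gtrN. Qed.

Definition J f : R := itg (- L) L (fun x => itg (- L) L (f x)).

Lemma cts_itg f : cts2 f -> continuous (fun x => itg (- L) L (f x)).
Proof. exact: itg_param_continuous. Qed.

Lemma JD f g : cts2 f -> cts2 g -> J (fun x y => f x y + g x y) = J f + J g.
Proof.
move=> cf cg; rewrite /J -itgD; [|exact: cts_itg|exact: cts_itg].
by congr itg; apply/funext => x; rewrite itgD//; exact: cts2_r.
Qed.

Lemma JZ k f : cts2 f -> J (fun x y => k * f x y) = k * J f.
Proof.
move=> cf; rewrite /J -itgZ; last exact: cts_itg.
by congr itg; apply/funext => x; rewrite itgZ//; exact: cts2_r.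
Qed.

Lemma JN f : cts2 f -> J (fun x y => - f x y) = - J f.
Proof.
move=> cf; rewrite -[RHS]mulN1r -JZ//; congr J.
by apply/funext => x; apply/funext => y; rewrite mulN1r.
Qed.

Lemma JB f g : cts2 f -> cts2 g -> J (fun x y => f x y - g x y) = J f - J g.
Proof. by move=> cf cg; rewrite JD ?JN//; exact: cts2N. Qed.

Lemma J0 : J (fun _ _ => 0) = 0.
Proof. by rewrite /J; under eq_fun do rewrite itg0; exact: itg0. Qed.

Lemma Jsum (I : Type) (r : seq I) (F : I -> R -> R -> R) : (forall i, cts2 (F i)) ->
  J (fun x y => \sum_(i <- r) F i x y) = \sum_(i <- r) J (F i).
Proof.
move=> h; elim: r => [|i r IH].
  rewrite big_nil -[RHS]J0; congr J; apply/funext => x; apply/funext => y.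
  by rewrite big_nil.
rewrite big_cons -IH -JD//; last exact: cts2_sum.
by congr J; apply/funext => x; apply/funext => y; rewrite big_cons.
Qed.

Lemma leJ f g : cts2 f -> cts2 g -> (forall x y, f x y <= g x y) -> J f <= J g.
Proof.
move=> cf cg h; apply: le_itg; [exact: cts_itg|exact: cts_itg|].
by move=> x _; apply: le_itg => //; exact: cts2_r.
Qed.

Lemma J_ge0 f : (forall x y, 0 <= f x y) -> 0 <= J f.
Proof. by move=> h; apply: itg_ge0 => x _; exact: itg_ge0. Qed.

Lemma eqJ f g : (forall x y, f x y = g x y) -> J f = J g.
Proof. by move=> h; congr J; apply/funext => x; apply/funext => y. Qed.

Lemma J_sqr_eq0 f : cts2 f -> J (fun x y => f x y ^+ 2) = 0 ->
  forall x y, - L <= x < L -> - L <= y < L -> f x y = 0.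
Proof.
move=> cf j0 x y hx hy; apply/eqP; rewrite -sqrf_eq0; apply/eqP.
have c2 := cts2X (n := 2) cf.
apply: (itg_eq0_in (f := fun y => f x y ^+ 2) LL) hy => [|z|].
- by apply: ctsX; exact: cts2_r.
- exact: sqr_ge0.
- apply: (itg_eq0_in (f := fun x => itg (- L) L (fun y => f x y ^+ 2)) LL) hx => //.
  + exact: cts_itg c2.
  + by move=> z; apply: itg_ge0 => *; exact: sqr_ge0.
Qed.

Definition C1 f f1 f2 := [/\ cts2 f, cts2 f1, cts2 f2,
  forall x y, der (f ^~ y) x (f1 x y) & forall x y, der (f x) y (f2 x y)].

(** The boundary of the square is included, so the end terms of every integration by parts over it
    are 0. *)
Definition vanish f := forall x y, L <= `|x| \/ L <= `|y| -> f x y = 0.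

Lemma vanishL f x : vanish f -> (f x L = 0) * (f x (- L) = 0) * (f L x = 0) * (f (- L) x = 0).
Proof.
have nL : L <= `|L| by exact: ler_norm.
move=> h; split; [split; [split|]|]; apply: h; rewrite ?normrN; [right|right|left|left] => //.
Qed.

Lemma vanishMr f g : vanish g -> vanish (fun x y => f x y * g x y).
Proof. by move=> h x y /h ->; rewrite mulr0. Qed.

Lemma C1_cst k : C1 (fun _ _ => k) (fun _ _ => 0) (fun _ _ => 0).
Proof. by split; try exact: cts2_cst; move=> *; exact: der_cst. Qed.

Lemma C1_x : C1 (fun x _ => x) (fun _ _ => 1) (fun _ _ => 0).
Proof. by split; [exact: cts2_x|exact: cts2_cst|exact: cts2_cst| |] => *; [exact: der_id|exact: der_cst]. Qed.

Lemma C1_y : C1 (fun _ y => y) (fun _ _ => 0) (fun _ _ => 1).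
Proof. by split; [exact: cts2_y|exact: cts2_cst|exact: cts2_cst| |] => *; [exact: der_cst|exact: der_id]. Qed.

Lemma C1D f f1 f2 g g1 g2 : C1 f f1 f2 -> C1 g g1 g2 ->
  C1 (fun x y => f x y + g x y) (fun x y => f1 x y + g1 x y) (fun x y => f2 x y + g2 x y).
Proof.
move=> [cf cf1 cf2 d1 d2] [cg cg1 cg2 e1 e2]; split; try exact: cts2D.
- by move=> x y; exact: derD.
- by move=> x y; exact: derD.
Qed.

Lemma C1M f f1 f2 g g1 g2 : C1 f f1 f2 -> C1 g g1 g2 ->
  C1 (fun x y => f x y * g x y) (fun x y => f x y * g1 x y + g x y * f1 x y)
     (fun x y => f x y * g2 x y + g x y * f2 x y).
Proof.
move=> [cf cf1 cf2 d1 d2] [cg cg1 cg2 e1 e2].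
split; try by repeat (apply: cts2D || apply: cts2M).
- by move=> x y; exact: derM.
- by move=> x y; exact: derM.
Qed.

Lemma C1_sum (I : Type) (r : seq I) (F F1 F2 : I -> R -> R -> R) :
  (forall i, C1 (F i) (F1 i) (F2 i)) ->
  C1 (fun x y => \sum_(i <- r) F i x y) (fun x y => \sum_(i <- r) F1 i x y)
     (fun x y => \sum_(i <- r) F2 i x y).
Proof.
move=> h; split; try by apply: cts2_sum => i; have [] := h i.
- by move=> x y; apply: der_sum => i; have [] := h i.
- by move=> x y; apply: der_sum => i; have [] := h i.
Qed.

Lemma J_dx f f1 f2 : C1 f f1 f2 -> vanish f -> J f1 = 0.
Proof.
move=> [cf cf1 cf2 d1 d2] vf.
rewrite /J (@itg_FTC _ _ _ _ (fun x => itg (- L) L (f x)))//.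
- rewrite (@eq_itg _ _ _ (f L) (fun=> 0)); last by move=> y _; rewrite vanishL.
  rewrite (@eq_itg _ _ _ (f (- L)) (fun=> 0)); last by move=> y _; rewrite vanishL.
  by rewrite subrr.
- exact: cts_itg.
- by move=> x; apply: der_itg => // z; exact: cts2_r.
Qed.

Lemma J_dy f f1 f2 : C1 f f1 f2 -> vanish f -> J f2 = 0.
Proof.
move=> [cf cf1 cf2 d1 d2] vf.
rewrite /J -[RHS](itg0 (- L) L); congr itg; apply/funext => x.
rewrite (@itg_FTC _ _ _ _ (f x))//; last exact: cts2_r.
by rewrite !vanishL// subrr.
Qed.

(* No second derivatives are available, so one derivative in the first variable
   is taken by hand through difference quotients. *)
Lemma J_jacobian p p1 p2 q q1 q2 : C1 p p1 p2 -> C1 q q1 q2 -> vanish p ->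
  J (fun x y => p1 x y * q2 x y - p2 x y * q1 x y) = 0.
Proof.
move=> [cp cp1 cp2 d1 d2] [cq cq1 cq2 e1 e2] vp.
pose F x := itg (- L) L (fun y => p x y * q2 x y).
have cp_ x : continuous (p x) by exact: cts2_r.
have cp1_ x : continuous (p1 x) by exact: cts2_r.
have cp2_ x : continuous (p2 x) by exact: cts2_r.
have cq_ x : continuous (q x) by exact: cts2_r.
have cq1_ x : continuous (q1 x) by exact: cts2_r.
have cq2_ x : continuous (q2 x) by exact: cts2_r.
have dF x : der F x (itg (- L) L (fun y => p1 x y * q2 x y - p2 x y * q1 x y)).
  (* Quotient of the increment of [F] after an integration by parts in [y]: only [p] and [q] are
     differenced, while [p2] and [q2] are merely evaluated. *)
  pose K h y := slope (p ^~ y) (p1 x y) x h * q2 (x + h) y -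
                p2 x y * slope (q ^~ y) (q1 x y) x h.
  have -> : itg (- L) L (fun y => p1 x y * q2 x y - p2 x y * q1 x y) = itg (- L) L (K 0).
    by congr itg; apply/funext => y; rewrite /K /slope eqxx addr0.
  apply: (der_itg_slope (K := K)) => //.
  - move=> h; apply: ctsB; apply: ctsM => //; exact: slope_cts.
  - move=> s; rewrite /K /=.
    apply: cvgB; apply: cvgM.
    + exact: slope_near0.
    + have c : continuous (fun z : R * R => q2 (x + z.1) z.2).
        apply: (cts_app2 (f := q2)) => //; last by move=> ?; exact: cvg_snd.
        by apply: ctsD; [exact: cts_cst|move=> ?; exact: cvg_fst].
      exact: c.
    + have c : continuous (fun z : R * R => p2 x z.2).
        by apply: cts_comp => //; move=> ?; exact: cvg_snd.
      exact: c.
    + exact: slope_near0.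
  - move=> h h0; rewrite -itgB; [|exact: ctsM|exact: ctsM].
    rewrite -itgZ; last by apply: ctsB; apply: ctsM => //; exact: slope_cts.
    (* The integrand is the [y]-derivative of [p] times the increment of [q]. Subtracting it trades
       the increment of [q2], which has no derivative, for the increment of [q]. *)
    have i0 : itg (- L) L (fun y => p x y * (q2 (x + h) y - q2 x y) +
         (q (x + h) y - q x y) * p2 x y) = 0.
      rewrite (@itg_FTC _ _ _ _ (fun y => p x y * (q (x + h) y - q x y)))//.
      - by rewrite !(vanishL _ vp) !mul0r subrr.
      - by apply: ctsD; apply: ctsM => //; apply: ctsB.
      - by move=> y; apply: derM => //; apply: derB.
    rewrite -[LHS]subr0 -i0 -itgB; last 2 first.
      - by apply: ctsB; apply: ctsM.
      - by apply: ctsD; apply: ctsM => //; apply: ctsB.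
    congr itg; apply/funext => y; rewrite /K [RHS]mulrBr [h * (_ * q2 _ _)]mulrA slopeE.
    by rewrite [h * (p2 x y * _)]mulrCA slopeE (negbTE h0); ring.
rewrite /J (@itg_FTC _ _ _ _ F)//.
- rewrite /F (@eq_itg _ _ _ _ (fun=> 0)); last by move=> y _; rewrite (vanishL _ vp) mul0r.
  rewrite [X in _ - X](@eq_itg _ _ _ _ (fun=> 0)); last by move=> y _; rewrite (vanishL _ vp) mul0r.
  by rewrite subrr.
- apply: cts_itg; apply: cts2B; exact: cts2M.
Qed.

End DoubleIntegral.

(** * Energy growth along the chain of Fourier modes *)

Ltac cts2_tac :=
  lazymatch goal with
  | |- @cts2 ?R (fun x y => @?f x y + @?g x y) => refine (@cts2D R f g _ _); cts2_tac
  | |- @cts2 ?R (fun x y => @?f x y * @?g x y) => refine (@cts2M R f g _ _); cts2_tac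
  | |- @cts2 ?R (fun x y => - @?f x y) => refine (@cts2N R f _); cts2_tac
  | |- @cts2 ?R (fun x y => @?f x y ^+ ?n) => refine (@cts2X R f n _); cts2_tac
  | |- @cts2 ?R (fun x y => \sum_(i <- ?r) @?F x y i) =>
      refine (@cts2_sum R _ r (fun i x y => F x y i) _); let i := fresh in intro i; cbv beta; cts2_tac
  | |- @cts2 ?R (fun x y => x) => exact (@cts2_x R)
  | |- @cts2 ?R (fun x y => y) => exact (@cts2_y R)
  | |- @cts2 ?R (fun _ _ => ?k) => exact (@cts2_cst R k)
  | _ => solve [eauto 2 with nocore]
  | _ => match goal with
    | H : forall m i, cts2 _ |- _ => exact (H _ _)
    | H : cts2 _ |- _ => exact H end
  end.

Section ChainArithmetic.
Context {R : realType}.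

Lemma chain_arith1 (d0 d1 d2 d3 c0 c1 A1 A2 je t0 t1 x k1 k2 : R) :
  d0 + t0 = d2 - 2 * c0 + A1 -> d1 + t1 = d3 - 2 * c1 + A2 -> c0 + c1 = A2 - je ->
  je <= x -> A1 <= k1 -> 0 <= k2 -> 0 <= A2 ->
  d0 + d1 + (t0 + t1) <= d2 + d3 + (2 * x + k1 + k2).
Proof. lra. Qed.

Lemma chain_arith2 (C d0 d1 d2 d3 e0 e1 e2 e3 : R) :
  d0 + d1 + (2 * C + 1) * (e0 + e1) <= d2 + d3 + C * (e1 + e2) ->
  0 <= C * e0 -> 0 <= C * e3 ->
  d0 + d1 + C * (e0 + e1) + (e0 + e1) <= d2 + d3 + C * (e2 + e3).
Proof. rewrite !(mulrDl, mulrDr); lra. Qed.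

Lemma chain_arith3 (C d0 d1 e0 e1 s t : R) : s <= t ->
  s + (d0 + d1 + C * (e0 + e1)) <= t + (d0 + C * e0) + (d1 + C * e1).
Proof. rewrite mulrDr; lra. Qed.

(** The sequence [ga] is nondecreasing, so a positive value would be repeated, at least, in every
    later term and the partial sums would be unbounded. Once [ga] is 0, so is each increment. *)
Lemma bounded_sum_growth (ga be : nat -> R) (M : R) :
  (forall k, 0 <= ga k) -> (forall k, 0 <= be k) ->
  (forall k, ga k + be k <= ga k.+1) -> (forall N, \sum_(k < N) ga k <= M) ->
  forall k, be k = 0.
Proof.
move=> ga0 be0 step sumga.
have gamono k l : ga k <= ga (l + k)%N.
  by elim: l => // l IH; apply: le_trans IH _; apply: le_trans (step _); rewrite lerDl.
have gale0 k : ga k <= 0.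
  rewrite leNgt; apply/negP => gk.
  have h N : ga k *+ N <= M.
    apply: le_trans (sumga (k + N)%N).
    rewrite big_split_ord/= -[leLHS]add0r lerD//; first by rewrite sumr_ge0.
    rewrite -[N in leLHS]card_ord -sumr_const; apply: ler_sum => i _.
    by rewrite addnC; exact: gamono.
  have [N hN] : exists N, M < ga k *+ N.
    exists (Num.bound `|M / ga k|).
    rewrite -mulr_natr mulrC -ltr_pdivrMr//.
    by apply: le_lt_trans (ler_norm _) _; apply: archi_boundP.
  by have := h N; rewrite leNgt hN.
move=> k; apply/eqP; rewrite eq_le be0 andbT.
by apply: le_trans (gale0 k.+1); apply: le_trans (step k); rewrite lerDr.
Qed.

End ChainArithmetic.

(** * The commutator identity and the growth of energies *)

Section ModeChain.
Context {R : realType} (L tau K : R) (n : nat).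
Hypothesis L0 : 0 < L.
Implicit Types (i j : 'I_n) (m : nat).

Variables (A A1 A2 : 'I_n -> 'I_n -> R -> R -> R).
Hypothesis A_C1 : forall i j, C1 (A i j) (A1 i j) (A2 i j).
Hypothesis A_skew : forall i j x y, A i j x y = - A j i x y.
Hypothesis A_le : forall i j x y, `|A i j x y| <= K.
Hypothesis A1_le : forall i j x y, `|A1 i j x y| <= K.
Hypothesis A2_le : forall i j x y, `|A2 i j x y| <= K.

Variables (P P1 P2 Q Q1 Q2 : nat -> 'I_n -> R -> R -> R).
Hypothesis P_C1 : forall m i, C1 (P m i) (P1 m i) (P2 m i).
Hypothesis Q_C1 : forall m i, C1 (Q m i) (Q1 m i) (Q2 m i).
Hypothesis P_vanish : forall m i, vanish L (P m i).
Hypothesis Q_vanish : forall m i, vanish L (Q m i).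

(* Twice the real and imaginary parts of (d + sigma zbar) w for w = P + i Q, with tau = 2 sigma,
   and of its formal adjoint. *)
Definition Dre m i x y := P1 m i x y + tau * x * P m i x y + (Q2 m i x y + tau * y * Q m i x y).
Definition Dim m i x y := Q1 m i x y + tau * x * Q m i x y - (P2 m i x y + tau * y * P m i x y).
Definition Dsre m i x y := tau * x * P m i x y - P1 m i x y + (Q2 m i x y - tau * y * Q m i x y).
Definition Dsim m i x y := tau * x * Q m i x y - Q1 m i x y - (P2 m i x y - tau * y * P m i x y).

Definition mulA (u : 'I_n -> R -> R -> R) i x y := \sum_j A i j x y * u j x y.

Hypothesis chain_re : forall m i x y, Dre m.+2 i x y = Dsre m i x y + mulA (P m.+1) i x y.
Hypothesis chain_im : forall m i x y, Dim m.+2 i x y = Dsim m i x y + mulA (Q m.+1) i x y.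

Definition energyD m := J L (fun x y => \sum_i (Dre m i x y ^+ 2 + Dim m i x y ^+ 2)).
Definition energy m := J L (fun x y => \sum_i (P m i x y ^+ 2 + Q m i x y ^+ 2)).

Let cP m i : cts2 (P m i). Proof. by have [] := P_C1 m i. Qed.
Let cP1 m i : cts2 (P1 m i). Proof. by have [] := P_C1 m i. Qed.
Let cP2 m i : cts2 (P2 m i). Proof. by have [] := P_C1 m i. Qed.
Let cQ m i : cts2 (Q m i). Proof. by have [] := Q_C1 m i. Qed.
Let cQ1 m i : cts2 (Q1 m i). Proof. by have [] := Q_C1 m i. Qed.
Let cQ2 m i : cts2 (Q2 m i). Proof. by have [] := Q_C1 m i. Qed.
Let cA i j : cts2 (A i j). Proof. by have [] := A_C1 i j. Qed.
Let cA1 i j : cts2 (A1 i j). Proof. by have [] := A_C1 i j. Qed.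
Let cA2 i j : cts2 (A2 i j). Proof. by have [] := A_C1 i j. Qed.

Let cDre m i : cts2 (Dre m i). Proof. by rewrite /Dre; cts2_tac. Qed.
Let cDim m i : cts2 (Dim m i). Proof. by rewrite /Dim; cts2_tac. Qed.
Let cDsre m i : cts2 (Dsre m i). Proof. by rewrite /Dsre; cts2_tac. Qed.
Let cDsim m i : cts2 (Dsim m i). Proof. by rewrite /Dsim; cts2_tac. Qed.
Let cAP m i : cts2 (mulA (P m) i). Proof. by rewrite /mulA; cts2_tac. Qed.
Let cAQ m i : cts2 (mulA (Q m) i). Proof. by rewrite /mulA; cts2_tac. Qed.

Lemma energy_ge0 m : 0 <= energy m.
Proof. by apply: J_ge0 => x y; apply: sumr_ge0 => i _; rewrite addr_ge0 ?sqr_ge0. Qed.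

Lemma energyD_ge0 m : 0 <= energyD m.
Proof. by apply: J_ge0 => x y; apply: sumr_ge0 => i _; rewrite addr_ge0 ?sqr_ge0. Qed.

(* The commutator of the operator with its adjoint is the positive constant 4 tau. *)
Lemma energyDs m :
  J L (fun x y => \sum_i (Dsre m i x y ^+ 2 + Dsim m i x y ^+ 2)) =
  energyD m + 4 * tau * energy m.
Proof.
pose g i x y := P m i x y * P m i x y + Q m i x y * Q m i x y.
have gC1 i := C1D (C1M (P_C1 m i) (P_C1 m i)) (C1M (Q_C1 m i) (Q_C1 m i)).
have xg i := C1M (@C1_x R) (gC1 i).
have yg i := C1M (@C1_y R) (gC1 i).
have vg i : vanish L (g i).
  by move=> x y h; rewrite /g !P_vanish ?Q_vanish// mulr0 addr0.
rewrite /energyD /energy !Jsum//; try by move=> i; cts2_tac.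
rewrite mulr_sumr -big_split; apply: eq_bigr => i _ /=.
have jx := J_dx L0 (xg i) (vanishMr _ (vg i)).
have jy := J_dy L0 (yg i) (vanishMr _ (vg i)).
have jj := J_jacobian L0 (P_C1 m i) (Q_C1 m i) (P_vanish m i).
have [_ cx _ _ _] := xg i.
have [_ _ cy _ _] := yg i.
have cj : cts2 (fun x y => P1 m i x y * Q2 m i x y - P2 m i x y * Q1 m i x y) by cts2_tac.
(* The pointwise difference of the two squares is, up to factors, the Jacobian of [(P, Q)] and the
   radial derivative of |w|^2. The two zeros stand for the integrals of the [x]-derivative of x
   |w|^2 and the [y]-derivative of y |w|^2; their sum yields the constant times |w|^2. *)
transitivity (J L (fun x y => Dre m i x y ^+ 2 + Dim m i x y ^+ 2) +
   4 * tau * J L (fun x y => P m i x y ^+ 2 + Q m i x y ^+ 2)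
   - 4 * J L (fun x y => P1 m i x y * Q2 m i x y - P2 m i x y * Q1 m i x y) -
   2 * tau * (0 + 0)); last by rewrite jj; ring.
rewrite -{1}jx -{1}jy -!JZ -?JD -?JZ -?JB; try by cts2_tac.
apply: eqJ => x y; rewrite /Dsre /Dsim /Dre /Dim; ring.
Qed.

Definition cross_energy m := J L (fun x y => \sum_i (Dre m.+2 i x y * mulA (P m.+1) i x y +
                                              Dim m.+2 i x y * mulA (Q m.+1) i x y)).
Definition energyA m := J L (fun x y => \sum_i (mulA (P m) i x y ^+ 2 + mulA (Q m) i x y ^+ 2)).

(** The chain relation expresses the adjoint applied to w_m as D w_(m+2) - A w_(m+1); expand its
    squared norm and use [energyDs] on the other side. *)
Lemma energy_step m :
  energyD m + 4 * tau * energy m = energyD m.+2 - 2 * cross_energy m + energyA m.+1.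
Proof.
rewrite -energyDs /energyD /cross_energy /energyA -JZ -?JB -?JD; try by cts2_tac.
apply: eqJ => x y; rewrite mulr_sumr -sumrB -big_split/=; apply: eq_bigr => i _.
by rewrite chain_re chain_im; ring.
Qed.

(** [bil1] and [bil2] are the real and imaginary parts of the [i]-th entry of w_(m+1) times the
    conjugate of the [j]-th entry of w_m. *)
Definition bil1 i j m x y := P m.+1 i x y * P m j x y + Q m.+1 i x y * Q m j x y.
Definition bil2 i j m x y := Q m.+1 i x y * P m j x y + (- 1) * (P m.+1 i x y * Q m j x y).
(** What remains when D is moved across [A]: derivatives fall on [A] alone. *)
Definition err m x y := \sum_i \sum_j (A1 i j x y * bil1 i j m x y + A2 i j x y * bil2 i j m x y).

Let cb1 i j m : cts2 (bil1 i j m). Proof. by rewrite /bil1; cts2_tac. Qed.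
Let cb2 i j m : cts2 (bil2 i j m). Proof. by rewrite /bil2; cts2_tac. Qed.
Let cerr m : cts2 (err m). Proof. by rewrite /err; cts2_tac. Qed.

(* Integration by parts moves the derivative off w_{m+2}; skewness of A makes the
   zeroth order terms cancel. *)
Lemma cross_sum m : cross_energy m + cross_energy m.+1 = energyA m.+2 - J L (err m.+1).
Proof.
(* Entries of [A] times the real and imaginary parts of w_(m+2) conj(w_(m+1)). The [x]-derivative of
   the first sum and the [y]-derivative of the second integrate to 0, and are added to the
   right-hand side. *)
have C1b1 i j := C1M (A_C1 i j)
  (C1D (C1M (P_C1 m.+2 i) (P_C1 m.+1 j)) (C1M (Q_C1 m.+2 i) (Q_C1 m.+1 j))).
have C1b2 i j := C1M (A_C1 i j)
  (C1D (C1M (Q_C1 m.+2 i) (P_C1 m.+1 j)) (C1M (C1_cst (- 1)) (C1M (P_C1 m.+2 i) (Q_C1 m.+1 j)))).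
have C1B1 := C1_sum (index_enum _) (fun i => C1_sum (index_enum _) (C1b1 i)).
have C1B2 := C1_sum (index_enum _) (fun i => C1_sum (index_enum _) (C1b2 i)).
have j1 := J_dx L0 C1B1 _.
have j2 := J_dy L0 C1B2 _.
have {}j1 := j1 _.
have {}j2 := j2 _.
have [_ c1 _ _ _] := C1B1.
have [_ _ c2 _ _] := C1B2.
rewrite -[RHS]addr0 -[X in _ = _ + X]j1; last first.
  by move=> x y h; rewrite big1// => i _; rewrite big1// => j _; rewrite !P_vanish// !Q_vanish// !mulr0 addr0 mulr0.
rewrite -[RHS]addr0 -[X in _ = _ + X]j2; last first.
  by move=> x y h; rewrite big1// => i _; rewrite big1// => j _; rewrite !P_vanish// !Q_vanish// !mulr0 addr0 mulr0.
rewrite /cross_energy /energyA -JB -?JD; try by cts2_tac.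
apply: eqJ => x y.
have S2D F G : (\sum_i \sum_j F i j : R) + \sum_i \sum_j G i j = \sum_(i < n) \sum_(j < n) (F i j + G i j).
  by rewrite -big_split; apply: eq_bigr => i _; rewrite -big_split.
have S2N F : - (\sum_i \sum_j F i j : R) = \sum_(i < n) \sum_(j < n) - F i j.
  by rewrite -sumrN; apply: eq_bigr => i _; rewrite -sumrN.
have -> : \sum_i (Dre m.+2 i x y * mulA (P m.+1) i x y + Dim m.+2 i x y * mulA (Q m.+1) i x y) =
  \sum_i \sum_j A i j x y * (Dre m.+2 i x y * P m.+1 j x y + Dim m.+2 i x y * Q m.+1 j x y).
  apply: eq_bigr => i _; rewrite /mulA !mulr_sumr -big_split; apply: eq_bigr => j _ /=; ring.
(* The chain relation turns D w_(m+3) into the adjoint of D at w_(m+1) plus A w_(m+2). Skewness then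
   moves [A] over, which gives the term that pairs with the other cross energy. *)
have -> : \sum_i (Dre m.+3 i x y * mulA (P m.+2) i x y + Dim m.+3 i x y * mulA (Q m.+2) i x y) =
  \sum_i (mulA (P m.+2) i x y ^+ 2 + mulA (Q m.+2) i x y ^+ 2) -
  \sum_i \sum_j A i j x y * (P m.+2 i x y * Dsre m.+1 j x y + Q m.+2 i x y * Dsim m.+1 j x y).
  rewrite exchange_big -sumrB; apply: eq_bigr => i _; rewrite chain_re chain_im.
  rewrite -[X in _ = _ + X]sumrN.
  rewrite (_ : \sum_j _ = Dsre m.+1 i x y * mulA (P m.+2) i x y + Dsim m.+1 i x y * mulA (Q m.+2) i x y); first by ring.
  rewrite /mulA !mulr_sumr -big_split; apply: eq_bigr => j _ /=; rewrite A_skew; ring.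
rewrite addrCA; rewrite -!addrA; congr (_ + _).
rewrite /err !S2N !S2D; apply: eq_bigr => i _; apply: eq_bigr => j _.
rewrite /bil1 /bil2 /Dre /Dim /Dsre /Dsim; ring.
Qed.

Lemma sqr_norm_mul (a b : R) : `|a * b| <= (a ^+ 2 + b ^+ 2) / 2.
Proof.
rewrite ler_norml; apply/andP; split.
  by have := sqr_ge0 (a + b); rewrite sqrrD; lra.
by have := sqr_ge0 (a - b); rewrite sqrrB; lra.
Qed.

Let normw m x y := \sum_i (P m i x y ^+ 2 + Q m i x y ^+ 2).

(** An index is required because for [n = 0] the bounds on [A] say nothing about the sign of [K]. *)
Let K0 : 'I_n -> 0 <= K.
Proof. by move=> i; apply: le_trans (A_le i i 0 0). Qed.

Lemma err_le m x y : `|err m x y| <= K * n%:R * (normw m.+1 x y + normw m x y).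
Proof.
have -> : K * n%:R * (normw m.+1 x y + normw m x y) =
   \sum_i \sum_j K * (P m.+1 i x y ^+ 2 + Q m.+1 i x y ^+ 2 + (P m j x y ^+ 2 + Q m j x y ^+ 2)).
  transitivity (\sum_i (K * n%:R * (P m.+1 i x y ^+ 2 + Q m.+1 i x y ^+ 2) + K * normw m x y)).
    rewrite big_split/= -mulr_sumr sumr_const card_ord -/(normw m.+1 x y).
    by rewrite -[_ *+ n]mulr_natr; ring.
  apply: eq_bigr => i _; under [RHS]eq_bigr do rewrite mulrDr.
  rewrite [RHS]big_split/= sumr_const card_ord -mulr_sumr -/(normw m x y).
  by rewrite -[_ *+ n]mulr_natr; ring.
apply: le_trans (ler_norm_sum _ _ _) _; apply: ler_sum => i _.
apply: le_trans (ler_norm_sum _ _ _) _; apply: ler_sum => j _.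
have h1 := A1_le i j x y; have h2 := A2_le i j x y; have k0 := K0 i.
have := sqr_norm_mul (P m.+1 i x y) (P m j x y).
have := sqr_norm_mul (Q m.+1 i x y) (Q m j x y).
have := sqr_norm_mul (Q m.+1 i x y) (P m j x y).
have := sqr_norm_mul (P m.+1 i x y) (Q m j x y).
set s1 := _ / 2; set s2 := _ / 2; set s3 := _ / 2; set s4 := _ / 2 => b1 b2 b3 b4.
apply: le_trans (ler_normD _ _) _; rewrite !normrM.
have c1 : `|bil1 i j m x y| <= s4 + s3 by apply: le_trans (ler_normD _ _) (lerD b4 b3).
have c2 : `|bil2 i j m x y| <= s2 + s1.
  by apply: le_trans (ler_normD _ _) (lerD b2 _); rewrite mulN1r normrN.
have -> : P m.+1 i x y ^+ 2 + Q m.+1 i x y ^+ 2 + (P m j x y ^+ 2 + Q m j x y ^+ 2) =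
  (s4 + s3) + (s2 + s1) by rewrite /s1 /s2 /s3 /s4; field.
by rewrite mulrDr lerD// ler_pM.
Qed.

Lemma mulA_sqr_le (u : 'I_n -> R -> R -> R) i x y :
  mulA u i x y ^+ 2 <= K ^+ 2 * n%:R * \sum_j u j x y ^+ 2.
Proof.
have -> : K ^+ 2 * n%:R * \sum_j u j x y ^+ 2 =
    \sum_j \sum_k K ^+ 2 * ((u j x y ^+ 2 + u k x y ^+ 2) / 2).
  transitivity (\sum_j (K ^+ 2 * n%:R / 2 * u j x y ^+ 2 + K ^+ 2 / 2 * \sum_k u k x y ^+ 2)).
    rewrite big_split/= -mulr_sumr sumr_const card_ord.
    by rewrite -[_ *+ n]mulr_natr; field.
  apply: eq_bigr => j _; under [RHS]eq_bigr do rewrite mulrDl mulrDr.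
  rewrite [RHS]big_split/= sumr_const card_ord -!mulr_sumr -mulr_suml.
  by rewrite -[_ *+ n]mulr_natr; field.
rewrite /mulA expr2 mulr_suml; apply: ler_sum => j _; rewrite mulr_sumr.
apply: ler_sum => k _; apply: le_trans (ler_norm _) _.
rewrite (_ : _ * _ = (A i j x y * A i k x y) * (u j x y * u k x y)); last by ring.
rewrite normrM ler_pM//; last exact: sqr_norm_mul.
by rewrite normrM expr2 ler_pM.
Qed.

(** The first term bounds [err], which enters twice; the second bounds the square of the operator
    norm of [A]. *)
Definition chainC : R := 2 * K * n%:R + K ^+ 2 * n%:R ^+ 2.

Lemma energyA_le m : energyA m <= K ^+ 2 * n%:R ^+ 2 * energy m.
Proof.
rewrite -JZ//; last by cts2_tac.
apply: leJ => //; try by cts2_tac.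
move=> x y; apply: (@le_trans _ _ (\sum_(i < n) K ^+ 2 * n%:R * normw m x y)).
  apply: ler_sum => i _; rewrite /normw big_split mulrDr.
  by apply: lerD; exact: mulA_sqr_le.
by rewrite sumr_const card_ord -mulr_natr -/(normw m x y) le_eqVlt; apply/orP; left; apply/eqP; ring.
Qed.

Lemma Jerr_le m : J L (err m) <= K * n%:R * (energy m.+1 + energy m).
Proof.
rewrite /energy -JD ?L0//; try by cts2_tac.
rewrite -JZ//; try by cts2_tac.
apply: leJ => //; try by cts2_tac.
by move=> x y; apply: le_trans (err_le m x y); exact: ler_norm.
Qed.

(** Two consecutive instances of [energy_step] are added, since [cross_sum] controls only the sum of
    neighbouring cross energies. In the total [energyA m.+2] has a negative sign and is discarded;
    its upper bound is nevertheless added on the right to make the constant uniform. *)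
Lemma energy_chain_le m :
  energyD m + energyD m.+1 + 4 * tau * (energy m + energy m.+1) <=
  energyD m.+2 + energyD m.+3 + chainC * (energy m.+1 + energy m.+2).
Proof.
have h1 := energy_step m; have h2 := energy_step m.+1.
have h3 := cross_sum m; have h4 := Jerr_le m.+1; have h5 := energyA_le m.+1.
have k2 : 0 <= K ^+ 2 * n%:R ^+ 2 by rewrite mulr_ge0 ?sqr_ge0.
have h6 := mulr_ge0 k2 (energy_ge0 m.+2).
have h7 : 0 <= energyA m.+2.
  by apply: J_ge0 => x y; apply: sumr_ge0 => i _; rewrite addr_ge0 ?sqr_ge0.
have -> : chainC * (energy m.+1 + energy m.+2) = 2 * (K * n%:R * (energy m.+2 + energy m.+1)) +
   K ^+ 2 * n%:R ^+ 2 * energy m.+1 + K ^+ 2 * n%:R ^+ 2 * energy m.+2.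
  rewrite /chainC; move: (energy m.+1) (energy m.+2) => u v; ring.
rewrite [4 * tau * (_ + _)]mulrDr.
exact: chain_arith1 h1 h2 h3 h4 h5 h6 h7.
Qed.

Hypothesis tau_eq : 4 * tau = 2 * chainC + 1.
Variable M : R.
Hypothesis bound : forall N, \sum_(m < N) (energyD m + chainC * energy m) <= M.
Hypothesis C0 : 0 <= chainC.

(** The budget [4 * tau = 2 * chainC + 1] is spent as follows: one [chainC] absorbs the norm at
    index [m + 1] on the right, one is kept inside the growing quantity, and the 1 is the net
    growth. *)
Lemma energy_eq0 m : energy m = 0.
Proof.
(* Grouping the indices [2k] and [2k + 1] turns the two-step inequality into a one-step one. *)
pose be k := energy k.*2 + energy k.*2.+1.
pose ga k := energyD k.*2 + energyD k.*2.+1 + chainC * be k.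
have be0 k : 0 <= be k by rewrite addr_ge0 ?energy_ge0.
have ga0 k : 0 <= ga k by rewrite !addr_ge0 ?energyD_ge0 ?mulr_ge0.
have step k : ga k + be k <= ga k.+1.
  have h := energy_chain_le k.*2; rewrite tau_eq in h.
  rewrite /ga /be doubleS.
  exact: chain_arith2 h (mulr_ge0 C0 (energy_ge0 k.*2)) (mulr_ge0 C0 (energy_ge0 k.*2.+3)).
have sumga N : \sum_(k < N) ga k <= M.
  apply: le_trans (bound N.*2); elim: N => [|N IH]; first by rewrite !big_ord0.
  rewrite doubleS !big_ord_recr/= /ga /be.
  exact: chain_arith3.
have be_eq0 := bounded_sum_growth ga0 be0 step sumga.
have := be_eq0 m./2; rewrite /be => /eqP.
rewrite paddr_eq0 ?energy_ge0// => /andP[/eqP h0 /eqP h1].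
by rewrite -(odd_double_half m); case: (odd m).
Qed.

End ModeChain.

(** * Bessel's inequality for trigonometric modes *)

Section FamilyODE.
Context {R : realType} (I : Type) (F dF : I -> R -> R) (K M : R).
Hypothesis K0 : 0 <= K.
Hypothesis M0 : 0 <= M.
Hypothesis dFP : forall i s, der (F i) s (dF i s).
Hypothesis F0 : forall i, F i 0 = 0.
Hypothesis F_le : forall i s, 0 <= s <= 1 -> `|F i s| <= M.
Hypothesis dF_le : forall s c, (forall i, `|F i s| <= c) -> forall i, `|dF i s| <= K * c.

(** Each stage holds for the whole family at once, so it bounds every derivative; comparison with
    the explicit antiderivative [H] of that bound gives the next power. *)
Let bnd n i s : 0 <= s <= 1 -> `|F i s| <= M * (K ^+ n * (s ^+ n / n`!%:R)).
Proof.
elim: n i s => [|n IH] i s s01.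
  by rewrite !expr0 fact0 divr1 !mulr1; exact: F_le.
pose H (t : R) := M * (K ^+ n.+1 * (t ^+ n.+1 / n.+1`!%:R)).
have nf : n`!%:R != 0 :> R by rewrite pnatr_eq0 -lt0n fact_gt0.
have nf1 : n.+1%:R != 0 :> R by rewrite pnatr_eq0.
have dH t : der H t (K * (M * (K ^+ n * (t ^+ n / n`!%:R)))).
  have dX : der (fun t : R => t ^+ n.+1) t (n.+1%:R * t ^+ n).
    by apply: der_eq (derXS n (der_id t)) _; rewrite mulr1.
  have := derZ M (derZ (K ^+ n.+1) (derZ (n.+1`!%:R^-1) dX)).
  under eq_fun do rewrite [_^-1 * _]mulrC.
  move=> h; apply: der_eq h _.
  rewrite factS natrM exprS; move: (n`!%:R) (n.+1%:R) nf nf1 => u v u0 v0.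
  by field; rewrite u0 v0.
have H0 : H 0 = 0 by rewrite /H expr0n/= mul0r !mulr0.
have s0 : 0 <= s by case/andP: s01.
have bd t : 0 <= t <= s -> `|dF i t| <= K * (M * (K ^+ n * (t ^+ n / n`!%:R))).
  move=> /andP[t0 ts]; apply: dF_le => j; apply: IH.
  by rewrite t0 (le_trans ts)//; case/andP: s01.
rewrite -/(H s) ler_norml; apply/andP; split.
  have := @der_le_nincr _ (fun t => - F i t - H t) _ 0 s s0
    (fun t => derB (derN (dFP i t)) (dH t)).
  rewrite F0 H0 oppr0 addr0 => h; rewrite lerNl -subr_le0; apply: h => t /bd.
  by rewrite ler_norml subr_le0 lerNl => /andP[].
have := @der_le_nincr _ (fun t => F i t - H t) _ 0 s s0 (fun t => derB (dFP i t) (dH t)).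
rewrite F0 H0 subr0 => h; rewrite -subr_le0; apply: h => t /bd.
by rewrite ler_norml subr_le0 => /andP[].
Qed.

(* Iterating the inequality gives |F| <= M K^n s^n / n! for every n. *)
Lemma family_ode_eq0 i s : 0 <= s <= 1 -> F i s = 0.
Proof.
move=> s01; apply/eqP; rewrite -normr_le0 leNgt; apply/negP => Fs.
have := cvg_series_cvg_0 (is_cvg_series_exp_coeff (K * s)).
(* [M + 1] keeps the denominator positive when [M = 0]. *)
have e0 : 0 < `|F i s| / (M + 1) by rewrite divr_gt0// ltr_wpDl.
move=> /cvgrPdist_lt/(_ _ e0)[n _ /(_ n (leqnn n))].
rewrite sub0r normrN ltr_pdivlMr ?ltr_wpDl// => h.
have := bnd n i s01; rewrite leNgt => /negP; apply.
apply: le_lt_trans h; rewrite /exp_coeff /= exprMn -mulrA.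
set u := K ^+ n * _.
have u0 : 0 <= u by rewrite !mulr_ge0 ?exprn_ge0// ?invr_ge0//; case/andP: s01.
by rewrite ger0_norm// mulrDr mulr1 mulrC lerDl.
Qed.
End FamilyODE.

Section Bessel.
Context {R : realType} (a b T : R) (e : nat -> R -> R).
Hypothesis ab : a < b.
Hypothesis T0 : 0 < T.
Hypothesis ce : forall m, continuous (e m).
Hypothesis orth : forall m k, m != k -> itg a b (fun t => e m t * e k t) = 0.
Hypothesis e_le : forall m, itg a b (fun t => e m t * e m t) <= T.

(** A common upper bound [T] for the squared norms replaces normalisation: with coefficients
    [c m / T], each new term lowers the squared distance to [g] by at least [c m ^+ 2 / T].
    Frequency 0, where the cosine has a larger norm and the sine is 0, thus needs no separate
    treatment. *)
Lemma bessel (g : R -> R) N : continuous g ->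
  \sum_(m < N) itg a b (fun t => g t * e m t) ^+ 2 <= T * itg a b (fun t => g t ^+ 2).
Proof.
move=> cg; pose c m := itg a b (fun t => g t * e m t).
pose S N t := \sum_(m < N) c m / T * e m t.
have cS k : continuous (S k).
  by apply: cts_sum => m; apply: ctsM => //; exact: cts_cst.
have Se k : itg a b (fun t => S k t * e k t) = 0.
  rewrite (_ : (fun t => _) = (fun t => \sum_(m < k) c m / T * (e m t * e k t))); last first.
    by apply/funext => t; rewrite /S mulr_suml; apply: eq_bigr => m _; rewrite mulrA.
  rewrite itg_sum => [|m]; last first.
    by apply: ctsM; [exact: cts_cst|exact: ctsM].
  rewrite big1// => m _; rewrite itgZ; last exact: ctsM.
  by rewrite orth ?mulr0// neq_ltn ltn_ord.
have key k : itg a b (fun t => (g t - S k t) ^+ 2) <=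
    itg a b (fun t => g t ^+ 2) - T^-1 * \sum_(m < k) c m ^+ 2.
  elim: k => [|k IH].
    rewrite big_ord0 mulr0 subr0 le_eqVlt; apply/orP; left; apply/eqP; congr itg.
    by apply/funext => t; rewrite /S big_ord0 subr0.
  have cr : continuous (fun t => g t - S k t) by exact: ctsB.
  rewrite (_ : (fun t => _) = (fun t => (g t - S k t) ^+ 2 +
    ((- 2 * (c k / T)) * (g t * e k t - S k t * e k t) + (c k / T) ^+ 2 * (e k t * e k t)))); last first.
    by apply/funext => t; rewrite /S big_ord_recr/=; ring.
  have cge : continuous (fun t => g t * e k t) by exact: ctsM.
  have cse : continuous (fun t => S k t * e k t) by exact: ctsM.
  have cee : continuous (fun t => e k t * e k t) by exact: ctsM.
  rewrite itgD; last 2 first.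
  - exact: ctsX.
  - apply: ctsD; apply: ctsM; try exact: cts_cst; [exact: ctsB|exact: cee].
  rewrite itgD; last 2 first.
  - by apply: ctsM; [exact: cts_cst|exact: ctsB].
  - by apply: ctsM; [exact: cts_cst|exact: cee].
  rewrite !itgZ//; last exact: ctsB.
  rewrite itgB// Se subr0 -/(c k) big_ord_recr/=.
  have h := ler_wpM2l (sqr_ge0 (c k / T)) (e_le k).
  have e1 : (c k / T) ^+ 2 * T = T^-1 * c k ^+ 2 by field; rewrite gt_eqF.
  have e2 : - 2 * (c k / T) * c k = - 2 * (T^-1 * c k ^+ 2) by field; rewrite gt_eqF.
  rewrite e1 in h; rewrite e2 mulrDr.
  apply: le_trans (lerD IH (lerD (lexx _) h)) _.
  by rewrite le_eqVlt; apply/orP; left; apply/eqP; ring.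
have h0 : 0 <= itg a b (fun t => (g t - S N t) ^+ 2) by apply: itg_ge0 => t _; exact: sqr_ge0.
have := le_trans h0 (key N); rewrite subr_ge0 => h.
by rewrite mulrC -ler_pdivrMr// mulrC.
Qed.
End Bessel.

(** * Orthogonality of cosines and of sines over a period *)

Section Trigonometric.
Context {R : realType}.
Notation twopi := ((pi : R) *+ 2).

Lemma twopi_gt0 : 0 < twopi.
Proof. by rewrite mulrn_wgt0// pi_gt0. Qed.

Lemma sin_nat2pi m : sin (m%:R * twopi) = 0.
Proof. by rewrite mulr_natl -[X in sin X]add0r (periodicn (@sinD2pi R)) sin0. Qed.

Lemma cos_nat2pi m : cos (m%:R * twopi) = 1.
Proof. by rewrite mulr_natl -[X in cos X]add0r (periodicn (@cosD2pi R)) cos0. Qed.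

Lemma der_sin (f : R -> R) x a : der f x a -> der (fun t => sin (f t)) x (cos (f x) * a).
Proof. by move=> h; apply: der_comp h _; exact: is_derive_sin. Qed.

Lemma der_cos (f : R -> R) x a : der f x a -> der (fun t => cos (f t)) x (- sin (f x) * a).
Proof. by move=> h; apply: der_comp h _; exact: is_derive_cos. Qed.

Lemma der_expR (f : R -> R) x a : der f x a -> der (fun t => expR (f t)) x (expR (f x) * a).
Proof. by move=> h; apply: der_comp h _; exact: is_derive_expR. Qed.

Lemma cts_mul_l (k : R) : continuous (fun t : R => k * t).
Proof. by apply: ctsM; [exact: cts_cst|exact: cts_id]. Qed.

Lemma itg_cos_nat m : m != 0%N -> itg 0 twopi (fun t => cos (m%:R * t)) = 0.
Proof.
move=> m0; have mR : m%:R != 0 :> R by rewrite pnatr_eq0.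
rewrite (@itg_FTC _ _ _ _ (fun t => m%:R^-1 * sin (m%:R * t))) ?twopi_gt0//.
- by rewrite sin_nat2pi !mulr0 sin0 mulr0 subrr.
- by apply: cts_cos; exact: cts_mul_l.
- move=> t; apply: der_eq (derZ _ (der_sin (derZ _ (der_id t)))) _.
  by rewrite mulr1 mulrC mulfK.
Qed.

Lemma itg_sin_nat m : m != 0%N -> itg 0 twopi (fun t => sin (m%:R * t)) = 0.
Proof.
move=> m0; have mR : m%:R != 0 :> R by rewrite pnatr_eq0.
rewrite (@itg_FTC _ _ _ _ (fun t => - (m%:R^-1) * cos (m%:R * t))) ?twopi_gt0//.
- by rewrite cos_nat2pi mulr0 cos0 subrr.
- by apply: cts_sin; exact: cts_mul_l.
- move=> t; apply: der_eq (derZ _ (der_cos (derZ _ (der_id t)))) _.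
  by field.
Qed.

Lemma natrB_neq0 m k : m != k -> m%:R - k%:R != 0 :> R.
Proof. by move=> mk; rewrite subr_eq0 eqr_nat. Qed.

Lemma natrD_neq0 m k : m != k -> m%:R + k%:R != 0 :> R.
Proof. by move=> mk; rewrite -natrD pnatr_eq0 addn_eq0; apply: contra mk => /andP[/eqP-> /eqP->]. Qed.

Lemma itg_coscos m k : m != k -> itg 0 twopi (fun t => cos (m%:R * t) * cos (k%:R * t)) = 0.
Proof.
move=> mk; have h1 := natrB_neq0 mk; have h2 := natrD_neq0 mk.
rewrite (@itg_FTC _ _ _ _ (fun t => (2 * (m%:R - k%:R))^-1 * sin ((m%:R - k%:R) * t) +
   (2 * (m%:R + k%:R))^-1 * sin ((m%:R + k%:R) * t))) ?twopi_gt0//.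
- by rewrite !(mulr0, sin0) [(_ - _) * (pi *+ 2)]mulrBl sinB [(_ + _) * (pi *+ 2)]mulrDl sinD !sin_nat2pi !(mul0r, mulr0, subr0, addr0).
- by apply: ctsM; apply: cts_cos; exact: cts_mul_l.
- move=> t; apply: der_eq (derD (derZ _ (der_sin (derZ _ (der_id t))))
    (derZ _ (der_sin (derZ _ (der_id t))))) _.
  by rewrite [(_ - _) * t]mulrBl cosB [(_ + _) * t]mulrDl cosD; field; rewrite h1 h2.
Qed.

Lemma itg_sinsin m k : m != k -> itg 0 twopi (fun t => sin (m%:R * t) * sin (k%:R * t)) = 0.
Proof.
move=> mk; have h1 := natrB_neq0 mk; have h2 := natrD_neq0 mk.
rewrite (@itg_FTC _ _ _ _ (fun t => (2 * (m%:R - k%:R))^-1 * sin ((m%:R - k%:R) * t) -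
   (2 * (m%:R + k%:R))^-1 * sin ((m%:R + k%:R) * t))) ?twopi_gt0//.
- by rewrite !(mulr0, sin0) [(_ - _) * (pi *+ 2)]mulrBl sinB [(_ + _) * (pi *+ 2)]mulrDl sinD !sin_nat2pi !(mul0r, mulr0, subr0, addr0).
- by apply: ctsM; apply: cts_sin; exact: cts_mul_l.
- move=> t; apply: der_eq (derB (derZ _ (der_sin (derZ _ (der_id t))))
    (derZ _ (der_sin (derZ _ (der_id t))))) _.
  by rewrite [(_ - _) * t]mulrBl cosB [(_ + _) * t]mulrDl cosD; field; rewrite h1 h2.
Qed.

Lemma itg_sqr_le1 (e : R -> R) : continuous e -> (forall t, `|e t| <= 1) ->
  itg 0 twopi (fun t => e t * e t) <= twopi.
Proof.
move=> ce he; have p0 := twopi_gt0.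
rewrite -[leRHS]mul1r -[X in 1 * X]subr0 -(itg_cst _ (ltW p0)).
apply: le_itg => [||t _]; [exact: ctsM|exact: cts_cst|].
by rewrite -expr2 -real_normK ?num_real// exprn_ile1.
Qed.

Lemma bessel_cos (g : R -> R) N : continuous g ->
  \sum_(m < N) itg 0 twopi (fun t => g t * cos (m%:R * t)) ^+ 2 <=
  twopi * itg 0 twopi (fun t => g t ^+ 2).
Proof.
apply: (@bessel _ 0 twopi twopi (fun m t => cos (m%:R * t))); rewrite ?twopi_gt0//; last 2 first.
- exact: itg_coscos.
- move=> m; apply: itg_sqr_le1 => [|t]; last exact: cos_max.
  by apply: cts_cos; exact: cts_mul_l.
by move=> m; apply: cts_cos; exact: cts_mul_l.
Qed.

Lemma bessel_sin (g : R -> R) N : continuous g ->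
  \sum_(m < N) itg 0 twopi (fun t => g t * sin (m%:R * t)) ^+ 2 <=
  twopi * itg 0 twopi (fun t => g t ^+ 2).
Proof.
apply: (@bessel _ 0 twopi twopi (fun m t => sin (m%:R * t))); rewrite ?twopi_gt0//; last 2 first.
- exact: itg_sinsin.
- move=> m; apply: itg_sqr_le1 => [|t]; last exact: sin_max.
  by apply: cts_sin; exact: cts_mul_l.
by move=> m; apply: cts_sin; exact: cts_mul_l.
Qed.

End Trigonometric.

(** * Regularity of the transport solution *)

Section SkewSystem.
Context {R : realType} (n : nat).
Implicit Types (i j : 'I_n).

(* The weight exp (- s) absorbs the source term; the skew part preserves the norm. *)
Lemma skew_ode_le (y r : 'I_n -> R -> R) (a : 'I_n -> 'I_n -> R -> R) (l L eps : R) :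
  0 <= l <= L -> 0 <= eps ->
  (forall i j s, a i j s = - a j i s) ->
  (forall i s, der (y i) s (\sum_j a i j s * y j s + r i s)) ->
  (forall i, y i (- l) = 0) ->
  (forall i s, - l <= s <= 0 -> `|r i s| <= eps) ->
  forall i, `|y i 0| <= expR L * n%:R * eps.
Proof.
move=> /andP[l0 lL] e0 skew dy y0 rle i.
(* The added constant dominates the sum of the [r i s ^+ 2], so that 2 y r <= y^2 + r^2 makes the
   derivative of [N] at most [N]. *)
pose N s := \sum_i y i s ^+ 2 + n%:R * eps ^+ 2.
have dN s : der N s (2 * \sum_i y i s * r i s).
  have := derD (der_sum (index_enum _) (fun i => derXS 1 (dy i s))) (der_cst (n%:R * eps ^+ 2) s).
  move=> h; apply: der_eq h _; rewrite addr0.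
  have z : \sum_i \sum_j a i j s * y j s * y i s = 0.
    set S := \sum_i _; suff : S + S = 0 by lra.
    rewrite {2}/S exchange_big -big_split/= big1// => k _; rewrite -big_split big1// => j _.
    by rewrite /= (skew k j); ring.
  have -> : \sum_i y i s * r i s = \sum_i (y i s * r i s + \sum_j a i j s * y j s * y i s).
    by rewrite big_split/= z addr0.
  rewrite mulr_sumr; apply: eq_bigr => k _; rewrite expr1 -mulr_suml; ring.
have dphi s : der (fun s => expR (- s) * N s) s
    (expR (- s) * (2 * \sum_i y i s * r i s) - N s * expR (- s)).
  apply: der_eq (derM (der_expR (derN (der_id s))) (dN s)) _; ring.
have h : expR (- 0) * N 0 <= expR (- - l) * N (- l).
  apply: (der_le_nincr _ dphi); first by rewrite oppr_le0.
  move=> s hs; rewrite mulrC -mulrBl pmulr_lle0 ?expR_gt0// subr_le0 /N.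
  have -> : n%:R * eps ^+ 2 = \sum_(k < n) eps ^+ 2 by rewrite sumr_const card_ord mulr_natl.
  rewrite -big_split/= mulr_sumr; apply: ler_sum => k _.
  have h1 : r k s ^+ 2 <= eps ^+ 2.
    by rewrite -real_normK ?num_real// lerXn2r ?nnegrE// rle.
  have := sqr_ge0 (y k s - r k s); rewrite sqrrB; lra.
(* As [expR L * n] is at least 1, it may be replaced by its square, which avoids square roots in the
   final bound. *)
have n1 : 1 <= n%:R :> R by rewrite ler1n; case: (n) i => [[]|].
have eL : 1 <= expR L by rewrite -expR0 ler_expR (le_trans l0).
have N0 : y i 0 ^+ 2 <= N 0.
  rewrite /N (bigD1 i)//= -addrA lerDl addr_ge0 ?mulr_ge0 ?sqr_ge0//.
  by apply: sumr_ge0 => k _; exact: sqr_ge0.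
have Nl : N (- l) = n%:R * eps ^+ 2.
  by rewrite /N big1 ?add0r// => k _; rewrite y0 expr0n.
rewrite oppr0 expR0 mul1r opprK Nl in h.
rewrite -ler_sqr ?nnegrE ?normr_ge0 ?mulr_ge0 ?expR_ge0// real_normK ?num_real//.
apply: le_trans N0 (le_trans h _).
rewrite exprMn mulrA ler_wpM2r ?sqr_ge0//.
apply: (@le_trans _ _ (expR L * n%:R)); first by rewrite ler_wpM2r// ler_expR.
rewrite expr2 ler_peMr// ?mulr_ge0 ?expR_ge0//.
by rewrite mulr_ege1.
Qed.

End SkewSystem.

(** * Uniform limits of difference quotients *)

Section UniformLimit.
Context {R : realType} {X : Type}.

(** Increment 0 is excluded because the quotients it is used for take the value 0 there by
    convention. *)
Definition ulim0 (D : R -> X -> R) (W : X -> R) := forall eps, 0 < eps ->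
  exists2 d, 0 < d & forall h x, h != 0 -> `|h| < d -> `|D h x - W x| <= eps.

Lemma uniform_cauchy_limit (D : R -> X -> R) :
  (forall eps, 0 < eps -> exists2 d, 0 < d & forall h k x, h != 0 -> k != 0 ->
     `|h| < d -> `|k| < d -> `|D h x - D k x| <= eps) ->
  exists W, ulim0 D W.
Proof.
move=> cD.
have cv x : cvg (D h x @[h --> 0^']).
  apply/cauchy_cvgP/cauchy_exP => eps e0.
  have [d d0 hd] := cD _ (divr_gt0 e0 (ltr0n R 2)).
  exists (D (d / 2) x).
  suff : \forall h \near 0^', ball (D (d / 2) x) eps (D h x) by [].
  near=> h; rewrite -ball_normE /ball_/=.
  apply: (@le_lt_trans _ _ (eps / 2)); last by rewrite ltr_pdivrMr// ltr_pMr// ltr1n.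
  apply: hd.
  - by rewrite mulf_neq0// gt_eqF.
  - by near: h; exact: nbhs_dnbhs_neq.
  - by rewrite ger0_norm ?divr_ge0 ?ltW// ltr_pdivrMr// ltr_pMr// ltr1n.
  - by near: h; exact: dnbhs0_lt.
exists (fun x => lim (D h x @[h --> 0^'])) => eps e0.
have [d d0 hd] := cD _ e0.
exists d => // h x h0 hlt.
have := cv x => /(cvgB (cvg_cst (D h x)))/cvg_norm.
move=> c; apply: (cvgr_to_le c).
near=> k; apply: hd => //.
- by near: k; exact: nbhs_dnbhs_neq.
- by near: k; exact: dnbhs0_lt.
Unshelve. all: by end_near. Qed.
End UniformLimit.

(** * The line-by-line solution is jointly continuous and C^1 in the position *)

Section Regularity.
Context {R : realType} {V : normedModType R} (n : nat).
Implicit Types (i j : 'I_n) (p q : V) (th : R).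
Variables (A : 'I_n -> 'I_n -> V -> R) (f : 'I_n -> V -> R) (e : R -> V).
Variables (U : 'I_n -> V -> R -> R) (r0 L K : R).
Hypothesis K0 : 0 <= K.
Hypothesis A_skew : forall i j p, A i j p = - A j i p.
Hypothesis cA : forall i j, continuous (A i j).
Hypothesis cf : forall i, continuous (f i).
Hypothesis ce : continuous e.
Hypothesis f_le : forall i p, `|f i p| <= K.
(** Going back for a time at most [L] reaches the region where [U] is 0. The margin 1 keeps that
    true for points displaced by at most 1, so the same time serves neighbouring lines. *)
Hypothesis escape : forall p th, exists2 l, 0 <= l <= L & r0 + 1 <= `|p - l *: e th|.
Hypothesis U_vanish : forall i p th, r0 <= `|p| -> U i p th = 0.
Hypothesis U_ode : forall i p th s,
  der (fun s => U i (p + s *: e th) th) s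
    (\sum_j A i j (p + s *: e th) * U j (p + s *: e th) th + f i (p + s *: e th)).

Let CE := expR L * n%:R.
Let CE0 : 0 <= CE. Proof. by rewrite mulr_ge0 ?expR_ge0. Qed.

Let U_le i p th : `|U i p th| <= CE * K.
Proof.
have [l l0L hl] := escape p th.
have -> : p = p + 0 *: e th by rewrite scale0r addr0.
apply: (@skew_ode_le _ _ (fun i s => U i (p + s *: e th) th) (fun i s => f i (p + s *: e th))
  (fun i j s => A i j (p + s *: e th)) l L K l0L K0) => //.
by move=> j; rewrite scaleNr U_vanish// (le_trans _ hl)// lerDl.
Qed.

(** Along two neighbouring lines the difference of solutions satisfies the skew system of the first
    line, with the differences of [A] and [f] as its source; [skew_ode_le] applies. *)
Let U_diff_le d p q th th' : 0 <= d ->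
  (forall l, 0 <= l <= L -> `|(p - l *: e th) - (q - l *: e th')| <= 1) ->
  (forall i j s, - L <= s <= 0 -> `|A i j (p + s *: e th) - A i j (q + s *: e th')| <= d) ->
  (forall i s, - L <= s <= 0 -> `|f i (p + s *: e th) - f i (q + s *: e th')| <= d) ->
  forall i, `|U i p th - U i q th'| <= CE * ((n%:R * (CE * K) + 1) * d).
Proof.
move=> d0 pq Ad fd i.
have [l l0L hl] := escape p th.
pose y i s := U i (p + s *: e th) th - U i (q + s *: e th') th'.
have -> : U i p th - U i q th' = y i 0 by rewrite /y !scale0r !addr0.
apply: (@skew_ode_le _ _ y
  (fun i s => \sum_j (A i j (p + s *: e th) - A i j (q + s *: e th')) * U j (q + s *: e th') th' +
     (f i (p + s *: e th) - f i (q + s *: e th')))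
  (fun i j s => A i j (p + s *: e th)) l L _ l0L) => //.
- by rewrite mulr_ge0// addr_ge0// !mulr_ge0.
- move=> k s; apply: der_eq (derB (U_ode k p th s) (U_ode k q th' s)) _.
  rewrite opprD addrACA [RHS]addrA; congr (_ + _).
  by rewrite -sumrB -big_split; apply: eq_bigr => j _ /=; rewrite /y; ring.
- move=> k; rewrite /y !scaleNr !U_vanish ?subrr//; last by rewrite (le_trans _ hl)// lerDl.
  have := pq l l0L; rewrite distrC => h.
  rewrite -(lerD2r 1) (le_trans hl)//.
  by rewrite -(subrK (q - l *: e th') (p - l *: e th)) addrC (le_trans (ler_normD _ _))// lerD2l distrC.
- move=> k s /andP[ls s0].
  have hs : - L <= s <= 0.
    by rewrite s0 andbT (le_trans _ ls)// lerN2; case/andP: l0L.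
  rewrite mulrDl mul1r (le_trans (ler_normD _ _))// lerD ?fd//.
  rewrite (le_trans (ler_norm_sum _ _ _))//.
  rewrite -mulrA mulr_natl -[n in _ *+ n]card_ord -sumr_const; apply: ler_sum => j _.
  by rewrite normrM [leRHS]mulrC ler_pM// Ad.
Qed.

Let c3 (g : V -> R) : continuous g ->
  continuous (fun z : (V * R) * R => g (z.1.1 + z.2 *: e z.1.2)).
Proof.
move=> cg; apply: cts_comp => // z; apply: cvgD.
  by have : continuous (fun z : (V * R) * R => z.1.1);
    [apply: cts_fst; apply: cts_fst; exact: cts_id|exact].
apply: cvgZ.
  by have : continuous (fun z : (V * R) * R => z.2);
    [apply: cts_snd; exact: cts_id|exact].
by have : continuous (fun z : (V * R) * R => e z.1.2);
    [apply: cts_comp => //; apply: cts_snd; apply: cts_fst; exact: cts_id|exact].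
Qed.

Lemma transport_continuous i : continuous (fun z : V * R => U i z.1 z.2).
Proof.
move=> [p th]; apply/cvgrPdist_le => eps e0 /=.
pose c := CE * (n%:R * (CE * K) + 1) + 1.
have c0 : 0 < c by rewrite ltr_wpDl// mulr_ge0// addr_ge0// !mulr_ge0.
have d0 : 0 < eps / c by rewrite divr_gt0.
have hA : \forall z \near (p, th), forall i j s, - L <= s <= 0 ->
    `|A i j (z.1 + s *: e z.2) - A i j (p + s *: e th)| <= eps / c.
  have := fun i j => near_uniform_itv (phi := fun z s => A i j (z.1 + s *: e z.2)) (- L) 0
     (fun s => @c3 _ (@cA i j) ((p, th), s)) d0.
  move=> h; suff : \forall z \near (p, th), forall ij : 'I_n * 'I_n, forall s, - L <= s <= 0 ->
    `|A ij.1 ij.2 (z.1 + s *: e z.2) - A ij.1 ij.2 (p + s *: e th)| <= eps / c.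
    by apply: filterS => z hz i' j'; exact: (hz (i', j')).
  by apply: (@filter_forall _ _ _ (nbhs (p, th)) _) => -[i' j']; exact: h.
have hf : \forall z \near (p, th), forall i s, - L <= s <= 0 ->
    `|f i (z.1 + s *: e z.2) - f i (p + s *: e th)| <= eps / c.
  apply: (@filter_forall _ _ _ (nbhs (p, th)) _) => j.
  exact: (near_uniform_itv (phi := fun z s => f j (z.1 + s *: e z.2)) (- L) 0
     (fun s => @c3 _ (@cf j) ((p, th), s)) d0).
have hn : \forall z \near (p, th), forall s, - L <= s <= 0 ->
    `|(z.1 + s *: e z.2) - (p + s *: e th)| <= 1.
  pose phi (z : V * R) s := `|(z.1 + s *: e z.2) - (p + s *: e th)|.
  have cphi : continuous (fun w : (V * R) * R => phi w.1 w.2).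
    move=> w; apply: cvg_norm; apply: cvgB.
      apply: cvgD.
        by have : continuous (fun z : (V * R) * R => z.1.1);
          [apply: cts_fst; apply: cts_fst; exact: cts_id|exact].
      apply: cvgZ.
        by have : continuous (fun z : (V * R) * R => z.2);
          [apply: cts_snd; exact: cts_id|exact].
      by have : continuous (fun z : (V * R) * R => e z.1.2);
        [apply: cts_comp => //; apply: cts_snd; apply: cts_fst; exact: cts_id|exact].
    apply: cvgD; first exact: cvg_cst.
    apply: cvgZ; last exact: cvg_cst.
    by have : continuous (fun z : (V * R) * R => z.2);
          [apply: cts_snd; exact: cts_id|exact].
  have := near_uniform_itv (- L) 0 (fun s => @cphi ((p, th), s)) ltr01.
  apply: filterS => z h s hs; have := h s hs.
  by rewrite /phi subrr normr0 subr0 normr_id.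
near=> z; rewrite distrC.
apply: (@le_trans _ _ (CE * ((n%:R * (CE * K) + 1) * (eps / c)))).
  apply: U_diff_le; first exact: ltW.
  - move=> l /andP[l0 lL]; rewrite -!scaleNr.
    have : forall s, - L <= s <= 0 -> `|(z.1 + s *: e z.2) - (p + s *: e th)| <= 1.
      by near: z; exact: hn.
    by apply; rewrite lerN2 lL oppr_le0.
  - by near: z; exact: hA.
  - by near: z; exact: hf.
rewrite mulrA mulrCA ger_pMr//.
by rewrite ler_pdivrMr// mul1r /c lerDl.
Unshelve. all: by end_near. Qed.

Variables (u : V) (A' : 'I_n -> 'I_n -> V -> R) (f' : 'I_n -> V -> R).
Definition dquot (g : V -> R) h p := h^-1 * (g (p + h *: u) - g p).
Hypothesis A'_lim : forall i j, ulim0 (dquot (A i j)) (A' i j).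
Hypothesis f'_lim : forall i, ulim0 (dquot (f i)) (f' i).
Hypothesis A'_le : forall i j p, `|A' i j p| <= K.
Hypothesis f'_le : forall i p, `|f' i p| <= K.

Let nbhs_ball (P : R -> Prop) : (exists2 d : R, 0 < d & forall h, h != 0 -> `|h| < d -> P h) <->
  \forall h \near 0^', P h.
Proof.
split=> [[d d0 hd]|].
  near=> h; apply: hd.
  - by near: h; exact: nbhs_dnbhs_neq.
  - by near: h; exact: dnbhs0_lt.
move=> [d /= d0 hd]; exists d => // h h0 hlt; apply: hd => //=.
by rewrite /ball_/= sub0r normrN.
Unshelve. all: by end_near. Qed.

Let ulim_near (I : finType) (D : I -> R -> V -> R) (W : I -> V -> R) eps :
  (forall k, ulim0 (D k) (W k)) -> 0 < eps ->
  exists2 d : R, 0 < d & forall h, h != 0 -> `|h| < d -> forall k p, `|D k h p - W k p| <= eps.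
Proof.
move=> h e0; apply/nbhs_ball.
apply: (@filter_forall _ _ _ (dnbhs 0) _) => x; apply/nbhs_ball.
by have [d d0 hd] := h x _ e0; exists d => // k k0 kd p; exact: hd.
Qed.

Let dquot_ulim eps : 0 < eps -> exists2 d : R, 0 < d & forall h, h != 0 -> `|h| < d ->
  (forall i j p, `|dquot (A i j) h p - A' i j p| <= eps) /\
  (forall i p, `|dquot (f i) h p - f' i p| <= eps).
Proof.
move=> e0.
have [d1 d10 h1] := @ulim_near ('I_n * 'I_n)%type (fun ij => dquot (A ij.1 ij.2))
  (fun ij => A' ij.1 ij.2) _ (fun ij => A'_lim ij.1 ij.2) e0.
have [d2 d20 h2] := @ulim_near 'I_n (fun i => dquot (f i)) f' _ f'_lim e0.
exists (Num.min d1 d2); first by rewrite lt_min d10.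
move=> h h0; rewrite lt_min => /andP[hd1 hd2]; split=> [i j p|i p]; last exact: h2.
exact: (h1 h h0 hd1 (i, j)).
Qed.

Let dquot_le (g g' : V -> R) h p : h != 0 -> `|dquot g h p - g' p| <= 1 -> `|g' p| <= K ->
  `|g (p + h *: u) - g p| <= (K + 1) * `|h|.
Proof.
move=> h0 h1 h2.
have -> : g (p + h *: u) - g p = dquot g h p * h by rewrite /dquot mulrC mulVKf.
rewrite normrM ler_wpM2r//.
by rewrite -(subrK (g' p) (dquot g h p)) (le_trans (ler_normD _ _))// addrC lerD.
Qed.

Let CL := CE * ((n%:R * (CE * K) + 1) * (K + 1)).
Let CL0 : 0 <= CL.
Proof. by rewrite !mulr_ge0// addr_ge0// !mulr_ge0. Qed.

Let h_small h : `|h| < (`|u| + 1)^-1 -> `|h *: u| <= 1.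
Proof.
have u0 : 0 < `|u| + 1 by rewrite ltr_wpDl.
rewrite -[_^-1]mul1r ltr_pdivlMr// mulrDr mulr1 normrZ => h1.
by apply: le_trans (ltW h1); rewrite lerDl.
Qed.

(** Used in [U_cauchy], where the values of [U] at two displacements must be close before [U] is
    known to be differentiable. *)
Let U_lip : exists2 d : R, 0 < d & forall h i p th, h != 0 -> `|h| < d ->
  `|U i (p + h *: u) th - U i p th| <= CL * `|h|.
Proof.
have [d d0 hd] := dquot_ulim ltr01.
exists (Num.min d (`|u| + 1)^-1); first by rewrite lt_min d0 invr_gt0 ltr_wpDl.
move=> h i p th h0; rewrite lt_min => /andP[/(hd _ h0)[hA hf] hu].
rewrite (_ : CL * _ = CE * ((n%:R * (CE * K) + 1) * ((K + 1) * `|h|))); last by rewrite /CL; ring.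
apply: U_diff_le.
- by rewrite mulr_ge0// addr_ge0.
- move=> l _; rewrite opprB addrA subrK addrAC subrr add0r.
  exact: h_small.
- by move=> k j s _; rewrite addrAC; exact: dquot_le.
- by move=> k s _; rewrite addrAC; exact: dquot_le.
Qed.

Let D h (z : 'I_n * V * R) := h^-1 * (U z.1.1 (z.1.2 + h *: u) z.2 - U z.1.1 z.1.2 z.2).

(** The difference of two difference quotients again solves the skew system along the line. Its
    source is small because the quotients of [A] and [f] converge uniformly and [U] is Lipschitz, so
    the quotients converge without differentiating the equation. *)
Let U_cauchy eps : 0 < eps -> exists2 d, 0 < d & forall h k z, h != 0 -> k != 0 ->
  `|h| < d -> `|k| < d -> `|D h z - D k z| <= eps.
Proof.
move=> eps0.
(* The three terms bound, in units of [e'], the three parts of the source [r] below: the change of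
   the quotients of [A], the change of [U], and the change of the quotients of [f]. *)
pose c1 := n%:R * (2 * (CE * K)) + n%:R * ((K + 1) * (CL * 2)) + 2.
have c10 : 0 <= c1.
  have a1 : 0 <= 2 * (CE * K) by apply: mulr_ge0 => //; exact: mulr_ge0.
  have a2 : 0 <= (K + 1) * (CL * 2) by apply: mulr_ge0; [exact: addr_ge0|exact: mulr_ge0].
  by apply: addr_ge0 => //; apply: addr_ge0; exact: mulr_ge0.
pose c := CE * c1 + 1.
have c0 : 0 < c by apply: ltr_wpDl => //; exact: mulr_ge0.
pose e' := eps / c.
have e'0 : 0 < e' by rewrite divr_gt0.
have [d1 d10 hd1] := dquot_ulim ltr01.
have [d2 d20 hd2] := dquot_ulim e'0.
have [d3 d30 hd3] := U_lip.
exists (Num.min (Num.min d1 d2) (Num.min (Num.min d3 e') (`|u| + 1)^-1)).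
  by rewrite !lt_min d10 d20 d30 e'0 invr_gt0 ltr_wpDl.
move=> h k [[i p] th] h0 k0; rewrite !lt_min.
move=> /andP[/andP[h1 h2] /andP[/andP[h3 h4] h5]] /andP[/andP[k1 k2] /andP[/andP[k3 k4] k5]].
have [l l0L hl] := escape p th.
pose x s := p + s *: e th.
pose y i s := D h (i, x s, th) - D k (i, x s, th).
pose r i s := \sum_j ((dquot (A i j) h (x s) - dquot (A i j) k (x s)) * U j (x s + h *: u) th +
   dquot (A i j) k (x s) * (U j (x s + h *: u) th - U j (x s + k *: u) th)) +
   (dquot (f i) h (x s) - dquot (f i) k (x s)).
have -> : D h (i, p, th) - D k (i, p, th) = y i 0 by rewrite /y /x !scale0r !addr0.
apply: (@le_trans _ _ (CE * (c1 * e'))); last first.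
  by rewrite mulrA /e' mulrCA ger_pMr// ler_pdivrMr// mul1r /c lerDl.
apply: (@skew_ode_le _ _ y r (fun i j s => A i j (x s)) l L _ l0L) => //.
- by apply: mulr_ge0 => //; exact: ltW.
- move=> m s.
  have dU (g : R) w : der (fun s => U w (x s + g *: u) th) s
    (\sum_j A w j (x s + g *: u) * U j (x s + g *: u) th + f w (x s + g *: u)).
    have := U_ode w (p + g *: u) th s.
    by rewrite /x addrAC; under eq_fun do rewrite addrAC.
  apply: der_eq (derB (derZ h^-1 (derB (dU h m) (U_ode m p th s)))
                      (derZ k^-1 (derB (dU k m) (U_ode m p th s)))) _.
  rewrite -/(x s) /r [RHS]addrA -big_split/=.
  rewrite [X in X - _ = _](_ : _ = \sum_j h^-1 * (A m j (x s + h *: u) * U j (x s + h *: u) th - A m j (x s) * U j (x s) th) + dquot (f m) h (x s)); last first.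
    by rewrite -mulr_sumr sumrB /dquot; ring.
  rewrite [X in _ - X = _](_ : _ = \sum_j k^-1 * (A m j (x s + k *: u) * U j (x s + k *: u) th - A m j (x s) * U j (x s) th) + dquot (f m) k (x s)); last first.
    by rewrite -mulr_sumr sumrB /dquot; ring.
  rewrite opprD addrACA; congr (_ + _); rewrite -sumrB; apply: eq_bigr => j _.
  by rewrite /y /D /dquot /=; ring.
- have z0 m g : `|g *: u| <= 1 -> U m (p - l *: e th + g *: u) th = 0.
    move=> gu; apply: U_vanish; rewrite -(lerD2r 1) (le_trans hl)//.
    rewrite -{1}(addrK (g *: u) (p - l *: e th)) (le_trans (ler_normB _ _))//.
    by rewrite lerD2l.
  move=> m; rewrite /y /D /x /= scaleNr.
  have := z0 m 0; rewrite scale0r addr0 normr0 => ->//.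
  by rewrite !z0 ?subrr ?mulr0 ?mulr0 ?subrr//; exact: h_small.
- move=> m s _; rewrite /r.
  have [hA hf] := hd2 h h0 h2; have [kA kf] := hd2 k k0 k2; have [kA1 _] := hd1 k k0 k1.
  have tri (a b w : R) : `|a - w| <= e' -> `|b - w| <= e' -> `|a - b| <= 2 * e'.
    move=> ha hb; rewrite -(subrKA w) (le_trans (ler_normD _ _))// mulr_natl mulr2n lerD//.
    by rewrite distrC.
  rewrite /c1 mulrDl (le_trans (ler_normD _ _))// lerD//; last exact: tri (hf m (x s)) (kf m (x s)).
  rewrite -mulrDr -mulrA mulr_natl -[n in _ *+ n]card_ord -sumr_const.
  rewrite (le_trans (ler_norm_sum _ _ _))//; apply: ler_sum => j _.
  rewrite mulrDl (le_trans (ler_normD _ _))// !normrM lerD//.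
    by rewrite mulrAC ler_pM//; exact: tri (hA m j (x s)) (kA m j (x s)).
  have b1 : `|dquot (A m j) k (x s)| <= K + 1.
    rewrite -(subrK (A' m j (x s)) (dquot (A m j) k (x s))) addrC.
    by rewrite (le_trans (ler_normD _ _))// lerD.
  have b2 : `|U j (x s + h *: u) th - U j (x s + k *: u) th| <= CL * 2 * e'.
    rewrite -(subrKA (U j (x s) th)) (le_trans (ler_normD _ _))//.
    rewrite -mulrA mulr_natl mulr2n mulrDr lerD//.
      by rewrite (le_trans (hd3 _ _ _ _ h0 h3))// ler_wpM2l// ltW.
    by rewrite distrC (le_trans (hd3 _ _ _ _ k0 k3))// ler_wpM2l// ltW.
  by rewrite -[(K + 1) * _ * _]mulrA ler_pM// -normrM.
Qed.

Lemma transport_C1 : exists W : 'I_n -> V -> R -> R,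
  [/\ forall i, continuous (fun z : V * R => W i z.1 z.2),
      forall i p th, der (fun t => U i (p + t *: u) th) 0 (W i p th) &
      forall i p th, r0 < `|p| -> W i p th = 0].
Proof.
have [W hW] := uniform_cauchy_limit U_cauchy.
exists (fun i p th => W (i, p, th)); split.
- move=> i [p th]; apply/cvgrPdist_le => /= eps e0.
  have e3 : 0 < eps / 3 by rewrite divr_gt0.
  have [d d0 hd] := hW _ e3.
  pose h := d / 2.
  have h0 : h != 0 by rewrite mulf_neq0// gt_eqF.
  have hlt : `|h| < d by rewrite ger0_norm ?divr_ge0 ?ltW// ltr_pdivrMr// ltr_pMr// ltr1n.
  have cD : continuous (fun z : V * R => D h (i, z.1, z.2)).
    rewrite /D; apply: ctsM; first exact: cts_cst.
    apply: ctsB; last exact: transport_continuous.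
    apply: (cts_app2 (f := U i)); first exact: transport_continuous.
      move=> z; apply: cvgD; last exact: cvg_cst.
      by have : continuous (fun z : V * R => z.1); [apply: cts_fst; exact: cts_id|exact].
    by apply: cts_snd; exact: cts_id.
  have := cD (p, th) => /cvgrPdist_le/(_ _ e3)/=.
  apply: filterS => z hz.
  have -> : W (i, p, th) - W (i, z.1, z.2) = - (D h (i, p, th) - W (i, p, th)) +
    (D h (i, p, th) - D h (i, z.1, z.2)) + (D h (i, z.1, z.2) - W (i, z.1, z.2)) by ring.
  have -> : eps = eps / 3 + eps / 3 + eps / 3 by field.
  rewrite (le_trans (ler_normD _ _))// lerD//; last exact: hd.
  rewrite (le_trans (ler_normD _ _))// lerD//.
  by rewrite normrN; exact: hd.
- move=> i p th; apply/derP; apply/cvgrPdist_le => eps e0.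
  have [d d0 hd] := hW _ e0.
  near=> h; rewrite add0r scale0r addr0 distrC; apply: (hd h (i, p, th)).
  + by near: h; exact: nbhs_dnbhs_neq.
  + by near: h; exact: dnbhs0_lt.
- move=> i p th rp; apply/eqP; rewrite -normr_le0; apply/ler_addgt0Pr => eps e0.
  have [d d0 hd] := hW _ e0.
  have g0 : 0 < (`|p| - r0) / (`|u| + 1) by rewrite divr_gt0 ?subr_gt0// ltr_wpDl.
  (* For this [h] the displaced point still lies beyond [r0], so the quotient is exactly 0. *)
  pose h := Num.min (d / 2) ((`|p| - r0) / (`|u| + 1)).
  have hp : 0 < h by rewrite lt_min g0 divr_gt0.
  have hd2 : `|h| < d by rewrite ger0_norm ?ltW// gt_min ltr_pdivrMr// ltr_pMr// ltr1n.
  have DW : D h (i, p, th) = 0.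
    rewrite /D /= !U_vanish ?subrr ?mulr0//; first exact: ltW.
    have : h <= (`|p| - r0) / (`|u| + 1) by rewrite ge_min lexx orbT.
    rewrite ler_pdivlMr ?ltr_wpDl// mulrDr mulr1 => hh.
    have h1 : `|h *: u| <= `|p| - r0.
      by rewrite normrZ (ger0_norm (ltW hp)); apply: le_trans hh; rewrite lerDl ltW.
    have := ler_normB (p + h *: u) (h *: u); rewrite addrK; lra.
  have := hd h (i, p, th) _ hd2; rewrite DW sub0r normrN add0r; apply.
  by rewrite gt_eqF.
Unshelve. all: by end_near. Qed.

End Regularity.

(** * The holomorphic weight *)

Notation twopi := (pi *+ 2).

Section ThreeVariables.
Context {R : realType}.
Implicit Types (f g : R -> R -> R -> R).

Definition cts3 f := continuous (fun z : (R * R) * R => f z.1.1 z.1.2 z.2).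

Lemma cts3D f g : cts3 f -> cts3 g -> cts3 (fun x y t => f x y t + g x y t).
Proof. exact: ctsD. Qed.
Lemma cts3N f : cts3 f -> cts3 (fun x y t => - f x y t).
Proof. exact: ctsN. Qed.
Lemma cts3M f g : cts3 f -> cts3 g -> cts3 (fun x y t => f x y t * g x y t).
Proof. exact: ctsM. Qed.
Lemma cts3X f n : cts3 f -> cts3 (fun x y t => f x y t ^+ n).
Proof. exact: ctsX. Qed.
Lemma cts3_cst k : cts3 (fun _ _ _ => k).
Proof. exact: cts_cst. Qed.
Lemma cts3_x : cts3 (fun x _ _ => x).
Proof. by apply: cts_fst; apply: cts_fst; exact: cts_id. Qed.
Lemma cts3_y : cts3 (fun _ y _ => y).
Proof. by apply: cts_snd; apply: cts_fst; exact: cts_id. Qed.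
Lemma cts3_t : cts3 (fun _ _ t => t).
Proof. by apply: cts_snd; exact: cts_id. Qed.
Lemma cts3_cos f : cts3 f -> cts3 (fun x y t => cos (f x y t)).
Proof. exact: cts_cos. Qed.
Lemma cts3_sin f : cts3 f -> cts3 (fun x y t => sin (f x y t)).
Proof. exact: cts_sin. Qed.
Lemma cts3_expR f : cts3 f -> cts3 (fun x y t => expR (f x y t)).
Proof. exact: cts_expR. Qed.
Lemma cts3_sum (I : Type) (r : seq I) (F : I -> R -> R -> R -> R) :
  (forall i, cts3 (F i)) -> cts3 (fun x y t => \sum_(i <- r) F i x y t).
Proof. by move=> h; apply: (@cts_sum _ _ _ r (fun i z => F i z.1.1 z.1.2 z.2)). Qed.

Lemma cts3_t_slice f x y : cts3 f -> continuous (f x y).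
Proof.
move=> h; apply: (cts_app2 (f := fun (z : R * R) t => f z.1 z.2 t) (g := fun=> (x, y))).
- exact: h.
- exact: cts_cst.
- exact: cts_id.
Qed.

Lemma cts3_xt_slice f y : cts3 f -> continuous (fun z : R * R => f z.1 y z.2).
Proof.
move=> h; apply: (cts_app2 (f := fun (z : R * R) t => f z.1 z.2 t) (g := fun z => (z.1, y))).
- exact: h.
- by apply: cts_pair; [apply: cts_fst; exact: cts_id|exact: cts_cst].
- by apply: cts_snd; exact: cts_id.
Qed.

Lemma cts3_yt_slice f x : cts3 f -> continuous (fun z : R * R => f x z.1 z.2).
Proof.
move=> h; apply: (cts_app2 (f := fun (z : R * R) t => f z.1 z.2 t) (g := fun z => (x, z.1))).
- exact: h.
- by apply: cts_pair; [exact: cts_cst|apply: cts_fst; exact: cts_id].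
- by apply: cts_snd; exact: cts_id.
Qed.

Lemma cts2_itg f a b : a < b -> cts3 f -> cts2 (fun x y => itg a b (f x y)).
Proof.
move=> ab h.
exact: (@itg_param_continuous _ (R * R)%type (fun z t => f z.1 z.2 t) a b ab h).
Qed.

Definition C13 f f1 f2 := [/\ cts3 f, cts3 f1, cts3 f2,
  forall x y t, der (fun x => f x y t) x (f1 x y t) &
  forall x y t, der (fun y => f x y t) y (f2 x y t)].

Lemma C13M f f1 f2 g g1 g2 : C13 f f1 f2 -> C13 g g1 g2 ->
  C13 (fun x y t => f x y t * g x y t)
      (fun x y t => f x y t * g1 x y t + g x y t * f1 x y t)
      (fun x y t => f x y t * g2 x y t + g x y t * f2 x y t).
Proof.
move=> [cf cf1 cf2 d1 d2] [cg cg1 cg2 e1 e2]; split.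
- exact: cts3M.
- by apply: cts3D; exact: cts3M.
- by apply: cts3D; exact: cts3M.
- by move=> x y t; exact: derM.
- by move=> x y t; exact: derM.
Qed.

Lemma C13D f f1 f2 g g1 g2 : C13 f f1 f2 -> C13 g g1 g2 ->
  C13 (fun x y t => f x y t + g x y t) (fun x y t => f1 x y t + g1 x y t)
      (fun x y t => f2 x y t + g2 x y t).
Proof.
move=> [cf cf1 cf2 d1 d2] [cg cg1 cg2 e1 e2]; split; try exact: cts3D.
- by move=> x y t; exact: derD.
- by move=> x y t; exact: derD.
Qed.

Lemma C13N f f1 f2 : C13 f f1 f2 ->
  C13 (fun x y t => - f x y t) (fun x y t => - f1 x y t) (fun x y t => - f2 x y t).
Proof.
move=> [cf cf1 cf2 d1 d2]; split; try exact: cts3N.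
- by move=> x y t; exact: derN.
- by move=> x y t; exact: derN.
Qed.

Lemma C13_t (h : R -> R) : continuous h -> C13 (fun _ _ t => h t) (fun _ _ _ => 0) (fun _ _ _ => 0).
Proof.
move=> ch; split; try exact: cts3_cst; try by move=> *; exact: der_cst.
by apply: cts_comp ch _; apply: cts_snd; exact: cts_id.
Qed.

Lemma C1_itg f f1 f2 a b : a < b -> C13 f f1 f2 ->
  C1 (fun x y => itg a b (f x y)) (fun x y => itg a b (f1 x y)) (fun x y => itg a b (f2 x y)).
Proof.
move=> ab [cf cf1 cf2 d1 d2]; split; try exact: cts2_itg.
- move=> x y; apply: (der_itg (f := fun x => f x y) (df := fun x => f1 x y)) => //.
  + by move=> z; exact: cts3_t_slice.
  + exact: cts3_xt_slice.
- move=> x y; apply: (der_itg (f := f x) (df := f2 x)) => //.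
  + by move=> z; exact: cts3_t_slice.
  + exact: cts3_yt_slice.
Qed.

(** The increment is split: the change in [x] is taken at the moving height [y + h * b], where
    [slope_near0] gives its limit, and the change in [y] at fixed [x]. *)
Lemma der_line (f f1 f2 : R -> R -> R) a b x y : C1 f f1 f2 ->
  der (fun s => f (x + s * a) (y + s * b)) 0 (a * f1 x y + b * f2 x y).
Proof.
move=> [cf cf1 cf2 d1 d2].
pose S (h : R) := slope (f ^~ (y + h * b)) (f1 x (y + h * b)) x (h * a).
have cS : S h @[h --> 0] --> f1 x y.
  pose g (h : R) : R * R := (h * a, y + h * b).
  pose F (q : R * R) := slope (f ^~ q.2) (f1 x q.2) x q.1.
  have cg : continuous g.
    apply: cts_pair; first by apply: ctsM; [exact: cts_id|exact: cts_cst].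
    by apply: ctsD; [exact: cts_cst|apply: ctsM; [exact: cts_id|exact: cts_cst]].
  have g0 : g 0 = (0, y) by rewrite /g !mul0r addr0.
  have cF : {for g 0, continuous F} by rewrite g0; exact: slope_near0.
  have := continuous_comp (cg 0) cF.
  have -> : f1 x y = F (g 0) by rewrite g0 /F /slope eqxx.
  by [].
have := d2 x y => dy.
have dy' : der (fun s => f x (y + s * b)) 0 (f2 x y * b).
  apply: (der_comp (f := f x) (g := fun s => y + s * b)); last by rewrite mul0r addr0.
  apply: der_eq (derD (der_cst y 0) (derM (der_id 0) (der_cst b 0))) _.
  by rewrite mulr0 !add0r mulr1.
move/derP in dy'; apply/derP.
have cS' : S h @[h --> 0^'] --> f1 x y by exact: cvg_within_filter.
have ca : (fun _ : R => a) @ 0^' --> a by exact: cvg_cst.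
have lim : (a * S h + h^-1 * (f x (y + (0 + h) * b) - f x (y + 0 * b))) @[h --> 0^'] -->
    a * f1 x y + f2 x y * b by exact: (cvgD (cvgM ca cS') dy').
rewrite [b * _]mulrC; apply: cvg_trans lim; apply: near_eq_cvg.
near=> h.
have h0 : h != 0 by near: h; exact: nbhs_dnbhs_neq.
rewrite !add0r !mul0r !addr0.
have := slopeE (f ^~ (y + h * b)) (f1 x (y + h * b)) x (h * a); rewrite -/(S h) => hS.
have -> : a * S h = h^-1 * (h * a * S h) by rewrite -mulrA mulKf.
rewrite hS; case: eqP => [->|_]; last by rewrite -mulrDr; congr (_ * _); ring.
by rewrite addr0; ring.
Unshelve. all: by end_near. Qed.

End ThreeVariables.

Ltac cts3_tac :=
  lazymatch goal with
  | |- @cts3 ?R (fun x y t => @?f x y t + @?g x y t) => refine (@cts3D R f g _ _); cts3_tac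
  | |- @cts3 ?R (fun x y t => @?f x y t * @?g x y t) => refine (@cts3M R f g _ _); cts3_tac
  | |- @cts3 ?R (fun x y t => - @?f x y t) => refine (@cts3N R f _); cts3_tac
  | |- @cts3 ?R (fun x y t => @?f x y t ^+ ?n) => refine (@cts3X R f n _); cts3_tac
  | |- @cts3 ?R (fun x y t => cos (@?f x y t)) => refine (@cts3_cos R f _); cts3_tac
  | |- @cts3 ?R (fun x y t => sin (@?f x y t)) => refine (@cts3_sin R f _); cts3_tac
  | |- @cts3 ?R (fun x y t => expR (@?f x y t)) => refine (@cts3_expR R f _); cts3_tac
  | |- @cts3 ?R (fun x y t => \sum_(i <- ?r) @?F x y t i) =>
      refine (@cts3_sum R _ r (fun i x y t => F x y t i) _); let i := fresh in intro i; cbv beta; cts3_tac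
  | |- @cts3 ?R (fun x y t => x) => exact (@cts3_x R)
  | |- @cts3 ?R (fun x y t => y) => exact (@cts3_y R)
  | |- @cts3 ?R (fun x y t => t) => exact (@cts3_t R)
  | |- @cts3 ?R (fun _ _ _ => ?k) => exact (@cts3_cst R k)
  | _ => solve [eauto 2 with nocore]
  end.

(** * Dependence of the weighted modes on the strength of the weight *)

Section Kernel.
Context {R : realType}.
Implicit Types (x y t k : R).

Definition al x y t : R := x * cos t + y * sin t.
Definition be x y t : R := x * sin t - y * cos t.

Lemma cts3_al : cts3 al. Proof. by rewrite /al; cts3_tac. Qed.
Lemma cts3_be : cts3 be. Proof. by rewrite /be; cts3_tac. Qed.

(* With zeta = conj(z) e^(it) = al + i be one has be^2 - i al be = (|z|^2 - zeta^2) / 2, so that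
   exp (k (be^2 - i al be)) is, up to a constant factor, an entire function of e^(it). *)
Lemma kernel_re x y t p : be x y t ^+ 2 * cos p + al x y t * be x y t * sin p =
  ((x ^+ 2 + y ^+ 2) * cos p - (x ^+ 2 - y ^+ 2) * cos (p + t *+ 2) - 2 * x * y * sin (p + t *+ 2)) / 2.
Proof.
have h : cos t ^+ 2 + sin t ^+ 2 = 1 by exact: cos2Dsin2.
rewrite mulr2n !cosD !sinD !cosD /al /be.
have e : x ^+ 2 + y ^+ 2 = (x ^+ 2 + y ^+ 2) * (cos t ^+ 2 + sin t ^+ 2) by rewrite h mulr1.
by rewrite e; field.
Qed.

Lemma kernel_im x y t p : be x y t ^+ 2 * sin p - al x y t * be x y t * cos p =
  ((x ^+ 2 + y ^+ 2) * sin p - (x ^+ 2 - y ^+ 2) * sin (p + t *+ 2) + 2 * x * y * cos (p + t *+ 2)) / 2.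
Proof.
have h : cos t ^+ 2 + sin t ^+ 2 = 1 by exact: cos2Dsin2.
rewrite mulr2n !cosD !sinD !cosD /al /be.
have e : x ^+ 2 + y ^+ 2 = (x ^+ 2 + y ^+ 2) * (cos t ^+ 2 + sin t ^+ 2) by rewrite h mulr1.
by rewrite e; field.
Qed.

Variable G : R -> R.
Hypothesis cG : continuous G.
Variables x y : R.

(** [kre] and [kim] are the real and imaginary parts of G(t) exp (k (be^2 - i al be)) e^(imt): the
    weight with a variable strength [k]. *)
Definition kre (k : R) m t := G t * (expR (k * be x y t ^+ 2) * cos (m%:R * t - k * (al x y t * be x y t))).
Definition kim (k : R) m t := G t * (expR (k * be x y t ^+ 2) * sin (m%:R * t - k * (al x y t * be x y t))).

Lemma cts_al : continuous (al x y). Proof. exact: cts3_t_slice cts3_al. Qed.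
Lemma cts_be : continuous (be x y). Proof. exact: cts3_t_slice cts3_be. Qed.

Let c2 (h : R -> R) : continuous h -> continuous (fun z : R * R => h z.2).
Proof. by move=> ch; apply: cts_comp ch _; apply: cts_snd; exact: cts_id. Qed.
Let c1 : continuous (fun z : R * R => z.1).
Proof. by apply: cts_fst; exact: cts_id. Qed.

Let carg m : continuous (fun z : R * R => m%:R * z.2 - z.1 * (al x y z.2 * be x y z.2)).
Proof.
apply: ctsB; apply: ctsM; [exact: cts_cst|apply: cts_snd; exact: cts_id|exact: c1|].
by apply: (c2 (h := fun t => al x y t * be x y t)); apply: ctsM; [exact: cts_al|exact: cts_be].
Qed.

Let cexp : continuous (fun z : R * R => expR (z.1 * be x y z.2 ^+ 2)).
Proof.
apply: cts_expR; apply: ctsM; first exact: c1.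
by apply: (c2 (h := fun t => be x y t ^+ 2)); apply: ctsX; exact: cts_be.
Qed.

Lemma cts2_kre m : cts2 (fun k => kre k m).
Proof.
apply: ctsM; first exact: c2.
by apply: ctsM; [exact: cexp|apply: cts_cos; exact: carg].
Qed.

Lemma cts2_kim m : cts2 (fun k => kim k m).
Proof.
apply: ctsM; first exact: c2.
by apply: ctsM; [exact: cexp|apply: cts_sin; exact: carg].
Qed.

(** Differentiation in [k] brings down (|z|^2 - conj(z)^2 e^(2it)) / 2, and e^(2it) raises the index
    by 2. *)
Let dkre k m t := 2^-1 * ((x ^+ 2 + y ^+ 2) * kre k m t -
  ((x ^+ 2 - y ^+ 2) * kre k m.+2 t + 2 * x * y * kim k m.+2 t)).
Let dkim k m t := 2^-1 * ((x ^+ 2 + y ^+ 2) * kim k m t -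
  ((x ^+ 2 - y ^+ 2) * kim k m.+2 t - 2 * x * y * kre k m.+2 t)).

Let arg2 m t k : m.+2%:R * t - k * (al x y t * be x y t) =
  m%:R * t - k * (al x y t * be x y t) + t *+ 2.
Proof. by rewrite -[m.+2]addn2 natrD mulr2n; ring. Qed.

Lemma der_kre m t k : der (fun k => kre k m t) k (dkre k m t).
Proof.
have de := der_expR (derM (der_id k) (der_cst (be x y t ^+ 2) k)).
have dc := der_cos (derB (der_cst (m%:R * t) k) (derM (der_id k) (der_cst (al x y t * be x y t) k))).
apply: der_eq (derZ (G t) (derM de dc)) _.
rewrite /dkre /kre /kim !arg2.
have := kernel_re x y t (m%:R * t - k * (al x y t * be x y t)).
set p := m%:R * t - _; set E := expR _ => h.
transitivity (G t * (E * (be x y t ^+ 2 * cos p + al x y t * be x y t * sin p))); first by ring.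
by rewrite h; field.
Qed.

Lemma der_kim m t k : der (fun k => kim k m t) k (dkim k m t).
Proof.
have de := der_expR (derM (der_id k) (der_cst (be x y t ^+ 2) k)).
have dc := der_sin (derB (der_cst (m%:R * t) k) (derM (der_id k) (der_cst (al x y t * be x y t) k))).
apply: der_eq (derZ (G t) (derM de dc)) _.
rewrite /dkim /kre /kim !arg2.
have := kernel_im x y t (m%:R * t - k * (al x y t * be x y t)).
set p := m%:R * t - _; set E := expR _ => h.
transitivity (G t * (E * (be x y t ^+ 2 * sin p - al x y t * be x y t * cos p))); first by ring.
by rewrite h; field.
Qed.

Let T0 : (0 : R) < twopi := @twopi_gt0 R.

Let Fk (b : bool) (k : R) m := itg 0 twopi (if b then kre k m else kim k m).

Let ckre k m : continuous (kre k m). Proof. exact: cts2_r (@cts2_kre m). Qed.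
Let ckim k m : continuous (kim k m). Proof. exact: cts2_r (@cts2_kim m). Qed.

Let dFk b k m := 2^-1 * ((x ^+ 2 + y ^+ 2) * Fk b k m -
  ((x ^+ 2 - y ^+ 2) * Fk b k m.+2 + (if b then 1 else -1) * (2 * x * y) * Fk (~~ b) k m.+2)).

Let der_Fk b k m : der (fun k => Fk b k m) k (dFk b k m).
Proof.
have cc := cts2_kre; have ci := cts2_kim.
case: b.
  have -> : dFk true k m = itg 0 twopi (dkre k m).
    rewrite /dFk /Fk /dkre /= itgZ; last first.
      apply: ctsB; first by apply: ctsM; [exact: cts_cst|exact: ckre].
      apply: ctsD; apply: ctsM; try exact: cts_cst; [exact: ckre|exact: ckim].
    rewrite itgB; last 2 first.
      by apply: ctsM; [exact: cts_cst|exact: ckre].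
      apply: ctsD; apply: ctsM; try exact: cts_cst; [exact: ckre|exact: ckim].
    rewrite itgD; last 2 first.
      by apply: ctsM; [exact: cts_cst|exact: ckre].
      by apply: ctsM; [exact: cts_cst|exact: ckim].
    by rewrite !itgZ ?mul1r.
  apply: (der_itg (f := fun k => kre k m) (df := fun k => dkre k m)) => //.
  - by move=> k' t; exact: der_kre.
  - rewrite /dkre; apply: ctsM; first exact: cts_cst.
    apply: ctsB; first by apply: ctsM; [exact: cts_cst|exact: cc].
    by apply: ctsD; (apply: ctsM; first exact: cts_cst); [exact: cc|exact: ci].
have -> : dFk false k m = itg 0 twopi (dkim k m).
  rewrite /dFk /Fk /dkim /= itgZ; last first.
    apply: ctsB; first by apply: ctsM; [exact: cts_cst|exact: ckim].
    apply: ctsB; apply: ctsM; try exact: cts_cst; [exact: ckim|exact: ckre].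
  rewrite itgB; last 2 first.
    by apply: ctsM; [exact: cts_cst|exact: ckim].
    apply: ctsB; apply: ctsM; try exact: cts_cst; [exact: ckim|exact: ckre].
  rewrite itgB; last 2 first.
    by apply: ctsM; [exact: cts_cst|exact: ckim].
    by apply: ctsM; [exact: cts_cst|exact: ckre].
  by rewrite !itgZ ?mulN1r ?mulNr.
apply: (der_itg (f := fun k => kim k m) (df := fun k => dkim k m)) => //.
- by move=> k' t; exact: der_kim.
- rewrite /dkim; apply: ctsM; first exact: cts_cst.
  apply: ctsB; first by apply: ctsM; [exact: cts_cst|exact: ci].
  by apply: ctsB; (apply: ctsM; first exact: cts_cst); [exact: ci|exact: cc].
Qed.

(** The [k]-derivative of mode [m] involves only the modes [m] and [m + 2]. The modes from [m0] on
    therefore form a linear system that is closed but never finite, with coefficients bounded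
    uniformly in the index, and [family_ode_eq0] carries zero data from [k0] to [k1]. *)
Lemma kernel_modes_eq0 k0 k1 m0 :
  (forall m, (m0 <= m)%N -> itg 0 twopi (kre k0 m) = 0 /\ itg 0 twopi (kim k0 m) = 0) ->
  forall m, (m0 <= m)%N -> itg 0 twopi (kre k1 m) = 0 /\ itg 0 twopi (kim k1 m) = 0.
Proof.
move=> h0 m mm0.
pose ks s := k0 + s * (k1 - k0).
pose F (i : bool * nat) s := Fk i.1 (ks s) (m0 + i.2).
pose dF (i : bool * nat) s := dFk i.1 (ks s) (m0 + i.2) * (k1 - k0).
(* A bound for all modes at once, since sine and cosine are at most 1; its maximum over the segment
   is the constant required of the family. *)
pose N s := itg 0 twopi (fun t => `|G t| * expR (ks s * be x y t ^+ 2)).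
have cks : continuous ks by apply: ctsD; [exact: cts_cst|apply: ctsM; [exact: cts_id|exact: cts_cst]].
have cN1 : continuous (fun z : R * R => `|G z.2| * expR (ks z.1 * be x y z.2 ^+ 2)).
  apply: ctsM; first by apply: (c2 (h := fun t => `|G t|)); apply: cts_comp => // t; exact: norm_continuous.
  apply: cts_expR; apply: ctsM; first by apply: cts_comp => //; exact: c1.
  by apply: (c2 (h := fun t => be x y t ^+ 2)); apply: ctsX; exact: cts_be.
have cN : continuous N.
  exact: (@itg_param_continuous _ R (fun s t => `|G t| * expR (ks s * be x y t ^+ 2)) _ _ T0 cN1).
have [c _ hc] := EVT_max ler01 (continuous_subspaceT cN).
have dks s : der ks s (k1 - k0).
  apply: der_eq (derD (der_cst k0 s) (derM (der_id s) (der_cst (k1 - k0) s))) _; ring.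
have E := @family_ode_eq0 R (bool * nat)%type F dF
  (2^-1 * (`|x ^+ 2 + y ^+ 2| + (`|x ^+ 2 - y ^+ 2| + `|2 * x * y|)) * `|k1 - k0|) (N c).
have F1 : forall i, F i 1 = 0.
  move=> i; apply: E => //.
  - by apply: itg_ge0 => t _; rewrite mulr_ge0 ?expR_ge0.
  - by move=> j s; apply: (der_comp (f := fun k => Fk j.1 k (m0 + j.2))) => //; exact: der_Fk.
  - move=> [b j]; rewrite /F /ks mul0r addr0 /Fk /=.
    by have [h1 h2] := h0 (m0 + j)%N (leq_addr _ _); case: b.
  - move=> [b j] s s01; apply: le_trans (hc s _); last by rewrite in_itv.
    rewrite /F /Fk /= ; apply: le_trans (le_normr_Rintegral _ _) _ => //.
      by apply: itg_integrable; case: b; [exact: ckre|exact: ckim].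
    apply: le_itg.
    + apply: cts_comp; first by move=> t; exact: norm_continuous.
      by case: b; [exact: ckre|exact: ckim].
    + exact: (cts2_r (f := fun s t => `|G t| * expR (ks s * be x y t ^+ 2)) (t := s) cN1).
    + move=> t _; case: b; rewrite /kre /kim !normrM ler_wpM2l//.
        by rewrite ger0_norm ?expR_ge0// ler_piMr ?expR_ge0// cos_max.
      by rewrite ger0_norm ?expR_ge0// ler_piMr ?expR_ge0// sin_max.
  - move=> s e he [b j]; rewrite /dF normrM [leRHS]mulrAC ler_wpM2r// /dFk.
    have e0 : 0 <= e by apply: le_trans (he (true, 0%N)).
    rewrite normrM ger0_norm ?invr_ge0// -[2^-1 * _ * e]mulrA ler_wpM2l ?invr_ge0//.
    rewrite [leRHS]mulrDl (le_trans (ler_normB _ _))// lerD//; first by rewrite normrM ler_wpM2l//; exact: (he (b, j)).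
    rewrite [leRHS]mulrDl (le_trans (ler_normD _ _))// lerD//.
      by rewrite normrM ler_wpM2l//; have := he (b, j.+2); rewrite /F /= !addnS.
    rewrite normrM [X in X * _ <= _]normrM (_ : `|if b then 1 else -1| = 1 :> R); last by case: b; rewrite ?normrN normr1.
    rewrite mul1r ler_wpM2l//.
    by have := he (~~ b, j.+2); rewrite /F /= !addnS.
  - by rewrite ler01 lexx.
have E1 := F1 (true, (m - m0)%N); have E2 := F1 (false, (m - m0)%N).
have ks1 : ks 1 = k1 by rewrite /ks mul1r addrC subrK.
by move: E1 E2; rewrite /F /Fk /= ks1 subnKC.
Qed.

End Kernel.

(** * Fourier modes of complex functions of the angle *)

Section FourierModes.
Context {R : realType}.
Implicit Types (F G : R -> R).

Let T0 : (0 : R) < twopi := @twopi_gt0 R.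

(* The real part of the integral of (F + i G) e^(imt); the imaginary part is [mode G (- F) m]. *)
Definition mode F G m : R := itg 0 twopi (fun t => F t * cos (m%:R * t) - G t * sin (m%:R * t)).

Let ccos m : continuous (fun t : R => cos (m%:R * t)).
Proof. by apply: cts_cos; exact: cts_mul_l. Qed.
Let csin m : continuous (fun t : R => sin (m%:R * t)).
Proof. by apply: cts_sin; exact: cts_mul_l. Qed.

Let cint F G m : continuous F -> continuous G ->
  continuous (fun t => F t * cos (m%:R * t) - G t * sin (m%:R * t)).
Proof. by move=> cF cG; apply: ctsB; apply: ctsM. Qed.

Lemma modeD F G F' G' m : continuous F -> continuous G -> continuous F' -> continuous G' ->
  mode (fun t => F t + F' t) (fun t => G t + G' t) m = mode F G m + mode F' G' m.
Proof.
move=> cF cG cF' cG'; rewrite /mode -itgD; [|exact: cint|exact: cint].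
by congr itg; apply/funext => t; ring.
Qed.

Lemma modeZ k F G m : continuous F -> continuous G ->
  mode (fun t => k * F t) (fun t => k * G t) m = k * mode F G m.
Proof.
move=> cF cG; rewrite /mode -itgZ; last exact: cint.
by congr itg; apply/funext => t; ring.
Qed.

Lemma modeB F G F' G' m : continuous F -> continuous G -> continuous F' -> continuous G' ->
  mode (fun t => F t - F' t) (fun t => G t - G' t) m = mode F G m - mode F' G' m.
Proof.
move=> cF cG cF' cG'; rewrite /mode -itgB; [|exact: cint|exact: cint].
by congr itg; apply/funext => t; ring.
Qed.

Lemma mode0 m : mode (fun=> 0) (fun=> 0) m = 0.
Proof. by rewrite /mode -[RHS](itg0 0 twopi); congr itg; apply/funext => t; ring. Qed.

Lemma mode_sum (I : Type) (r : seq I) (F G : I -> R -> R) m :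
  (forall i, continuous (F i)) -> (forall i, continuous (G i)) ->
  mode (fun t => \sum_(i <- r) F i t) (fun t => \sum_(i <- r) G i t) m =
  \sum_(i <- r) mode (F i) (G i) m.
Proof.
move=> cF cG; elim: r => [|i r IH].
  by rewrite big_nil -[RHS](mode0 m); congr mode; apply/funext => t; rewrite big_nil.
rewrite big_cons -IH -modeD//; [|exact: cts_sum|exact: cts_sum].
by congr mode; apply/funext => t; rewrite big_cons.
Qed.

(* (F + i G) e^(it) - (F' + i G') e^(-it) = H + i H' *)
Lemma mode_shift F G F' G' H H' m : continuous F' -> continuous G' ->
  continuous H -> continuous H' ->
  (forall t, (F t - F' t) * cos t - (G t + G' t) * sin t = H t) ->
  (forall t, (F t + F' t) * sin t + (G t - G' t) * cos t = H' t) ->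
  mode F G m.+2 = mode F' G' m + mode H H' m.+1.
Proof.
move=> cF' cG' cH cH' e1 e2.
rewrite /mode -itgD; [|exact: cint|exact: cint].
congr itg; apply/funext => t; rewrite -e1 -e2.
have -> : m.+2%:R * t = m.+1%:R * t + t by rewrite -[m.+2]addn1 natrD; ring.
have -> : m%:R * t = m.+1%:R * t - t by rewrite -[m.+1]addn1 natrD; ring.
by rewrite cosD sinD cosB sinB; ring.
Qed.

Definition mode_bound F G : R :=
  2 * (twopi * itg 0 twopi (fun t => F t ^+ 2)) + 2 * (twopi * itg 0 twopi (fun t => G t ^+ 2)).

Lemma mode_bessel F G N : continuous F -> continuous G ->
  \sum_(m < N) mode F G m ^+ 2 <= mode_bound F G.
Proof.
move=> cF cG.
apply: (@le_trans _ _ (2 * (\sum_(m < N) itg 0 twopi (fun t => F t * cos (m%:R * t)) ^+ 2) +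
   2 * (\sum_(m < N) itg 0 twopi (fun t => G t * sin (m%:R * t)) ^+ 2))).
  rewrite !mulr_sumr -big_split/=; apply: ler_sum => m _.
  rewrite /mode itgB; [|exact: ctsM|exact: ctsM].
  set a := itg _ _ _; set b := itg _ _ _.
  by have := sqr_ge0 (a + b); rewrite sqrrD sqrrB; lra.
by apply: lerD; rewrite ler_wpM2l//; [exact: bessel_cos|exact: bessel_sin].
Qed.

Lemma C1_mode (F F1 F2 G G1 G2 : R -> R -> R -> R) m : C13 F F1 F2 -> C13 G G1 G2 ->
  C1 (fun x y => mode (F x y) (G x y) m) (fun x y => mode (F1 x y) (G1 x y) m)
     (fun x y => mode (F2 x y) (G2 x y) m).
Proof.
move=> hF hG.
have := C1_itg T0 (C13D (C13M hF (C13_t (@ccos m))) (C13N (C13M hG (C13_t (@csin m))))).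
have E1 (F' G' : R -> R -> R -> R) : (fun x y => itg 0 twopi (fun t =>
    F x y t * 0 + cos (m%:R * t) * F' x y t + - (G x y t * 0 + sin (m%:R * t) * G' x y t))) =
    (fun x y => mode (F' x y) (G' x y) m).
  apply/funext => x; apply/funext => y; congr itg; apply/funext => t; ring.
by rewrite !E1.
Qed.

Lemma cts2_mode_bound (F G : R -> R -> R -> R) : cts3 F -> cts3 G ->
  cts2 (fun x y => mode_bound (F x y) (G x y)).
Proof.
move=> cF cG; rewrite /mode_bound.
apply: cts2D; (apply: cts2M; first exact: cts2_cst); (apply: cts2M; first exact: cts2_cst);
  apply: cts2_itg => //; exact: cts3X.
Qed.

End FourierModes.

(** * The weight, its derivatives and its modes *)

Section ComplexWeight.
Context {R : realType} (tau : R).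
Implicit Types (x y t : R).

Lemma C13_comp (h h' : R -> R) (g g1 g2 : R -> R -> R -> R) : continuous h' ->
  (forall x, der h x (h' x)) -> C13 g g1 g2 ->
  C13 (fun x y t => h (g x y t)) (fun x y t => h' (g x y t) * g1 x y t)
      (fun x y t => h' (g x y t) * g2 x y t).
Proof.
move=> ch' dh [cg cg1 cg2 d1 d2].
have ch : continuous h by move=> x; apply: der_continuous (dh x).
split.
- exact: cts_comp ch cg.
- by apply: cts3M => //; exact: cts_comp ch' cg.
- by apply: cts3M => //; exact: cts_comp ch' cg.
- by move=> x y t; apply: (der_comp (f := h) (g := fun x => g x y t)).
- by move=> x y t; apply: (der_comp (f := h) (g := fun y => g x y t)).
Qed.

Lemma C13_eq (f f1 f2 g1 g2 : R -> R -> R -> R) : C13 f f1 f2 ->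
  (forall x y t, f1 x y t = g1 x y t) -> (forall x y t, f2 x y t = g2 x y t) -> C13 f g1 g2.
Proof.
move=> h e1 e2; have -> : g1 = f1 by apply/funext => x; apply/funext => y; apply/funext => t.
by have -> : g2 = f2 by apply/funext => x; apply/funext => y; apply/funext => t.
Qed.

Lemma C13_al : C13 (@al R) (fun _ _ t => cos t) (fun _ _ t => sin t).
Proof.
split; try exact: cts3_al; try by cts3_tac.
- move=> x y t; apply: der_eq (derD (derM (der_id x) (der_cst (cos t) x)) (der_cst (y * sin t) x)) _.
  by ring.
- move=> x y t; apply: der_eq (derD (der_cst (x * cos t) y) (derM (der_id y) (der_cst (sin t) y))) _.
  by ring.
Qed.

Lemma C13_be : C13 (@be R) (fun _ _ t => sin t) (fun _ _ t => - cos t).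
Proof.
split; try exact: cts3_be; try by cts3_tac.
- move=> x y t; apply: der_eq (derB (derM (der_id x) (der_cst (sin t) x)) (der_cst (y * cos t) x)) _.
  by ring.
- move=> x y t; apply: der_eq (derB (der_cst (x * sin t) y) (derM (der_id y) (der_cst (cos t) y))) _.
  by ring.
Qed.

(** [wre + i wim] is exp (tau (be^2 - i al be)), which is exp (- sigma h) for tau = 2 sigma. *)
Definition wexp x y t := expR (tau * be x y t ^+ 2).
Definition warg x y t := tau * (al x y t * be x y t).
Definition wre x y t := wexp x y t * cos (warg x y t).
Definition wim x y t := - (wexp x y t * sin (warg x y t)).

Definition dwre b a' b' x y t := wexp x y t * (2 * tau * b * b' * cos (warg x y t) -
  tau * (a' * b + al x y t * b') * sin (warg x y t)).
Definition dwim b a' b' x y t := - (wexp x y t * (2 * tau * b * b' * sin (warg x y t) +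
  tau * (a' * b + al x y t * b') * cos (warg x y t))).

Let C13_cst k : C13 (fun _ _ _ => k : R) (fun _ _ _ => 0) (fun _ _ _ => 0).
Proof. by apply: (C13_t (h := fun=> k)); exact: cts_cst. Qed.

Let C13_wexp := C13_comp (@continuous_expR R) (@is_derive_expR R)
  (C13M (C13_cst tau) (C13M C13_be C13_be)).
Let C13_warg := C13M (C13_cst tau) (C13M C13_al C13_be).

Lemma C13_wre : C13 wre (fun x y t => dwre (be x y t) (cos t) (sin t) x y t)
                        (fun x y t => dwre (be x y t) (sin t) (- cos t) x y t).
Proof.
have cms : continuous (fun t : R => - sin t) by apply: ctsN; apply: cts_sin; exact: cts_id.
have := C13M C13_wexp (C13_comp cms (@is_derive_cos R) C13_warg).
move=> h; apply: (C13_eq h) => x y t; rewrite /dwre /wexp /warg expr2; ring.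
Qed.

Lemma C13_wim : C13 wim (fun x y t => dwim (be x y t) (cos t) (sin t) x y t)
                        (fun x y t => dwim (be x y t) (sin t) (- cos t) x y t).
Proof.
have cc : continuous (fun t : R => cos t) by apply: cts_cos; exact: cts_id.
have := C13N (C13M C13_wexp (C13_comp cc (@is_derive_sin R) C13_warg)).
move=> h; apply: (C13_eq h) => x y t; rewrite /dwim /wexp /warg expr2; ring.
Qed.

(** In the direction [e t] the function [be] is constant and [al] has slope 1, so differentiating
    the weight multiplies it by - i tau be. *)
Lemma transport_wre x y t : cos t * dwre (be x y t) (cos t) (sin t) x y t +
  sin t * dwre (be x y t) (sin t) (- cos t) x y t = tau * be x y t * wim x y t.
Proof.
have h : cos t ^+ 2 + sin t ^+ 2 = 1 by exact: cos2Dsin2.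
rewrite -[RHS]mulr1 -h /dwre /wim; ring.
Qed.

Lemma transport_wim x y t : cos t * dwim (be x y t) (cos t) (sin t) x y t +
  sin t * dwim (be x y t) (sin t) (- cos t) x y t = - (tau * be x y t * wre x y t).
Proof.
have h : cos t ^+ 2 + sin t ^+ 2 = 1 by exact: cos2Dsin2.
rewrite -[RHS]mulr1 -h /dwim /wre; ring.
Qed.

Lemma mode_weight (G : R -> R) x y m :
  mode (fun t => G t * wre x y t) (fun t => G t * wim x y t) m = itg 0 twopi (kre G x y tau m).
Proof.
congr itg; apply/funext => t; rewrite /kre /wre /wim cosB /wexp /warg; ring.
Qed.

Lemma mode_weight_im (G : R -> R) x y m :
  mode (fun t => G t * wim x y t) (fun t => - (G t * wre x y t)) m = itg 0 twopi (kim G x y tau m).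
Proof.
congr itg; apply/funext => t; rewrite /kim /wre /wim sinB /wexp /warg; ring.
Qed.

(** At strength 0 the weight is 1, whose modes of positive index are 0; [kernel_modes_eq0] with
    [G = 1] carries this to strength [tau]. *)
Lemma weight_modes_eq0 x y m : (0 < m)%N ->
  mode (wre x y) (wim x y) m = 0 /\ mode (wim x y) (fun t => - wre x y t) m = 0.
Proof.
move=> m0.
have c1 : continuous (fun _ : R => 1 : R) by exact: cts_cst.
have h0 k : (1 <= k)%N -> itg 0 twopi (kre (fun=> 1) x y 0 k) = 0 /\
     itg 0 twopi (kim (fun=> 1) x y 0 k) = 0.
  rewrite lt0n => k0; split.
    rewrite -[RHS](itg_cos_nat k0); congr itg; apply/funext => t.
    by rewrite /kre !mul0r expR0 subr0 !mul1r.
  rewrite -[RHS](itg_sin_nat k0); congr itg; apply/funext => t.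
  by rewrite /kim !mul0r expR0 subr0 !mul1r.
have := kernel_modes_eq0 c1 tau h0 m0.
rewrite -mode_weight -mode_weight_im => -[h1 h2].
by split; [rewrite -[RHS]h1|rewrite -[RHS]h2]; congr mode; apply/funext => t; rewrite mul1r.
Qed.

(* The weight is an exponential that can be switched off: vanishing of the weighted modes of
   nonnegative degree propagates to the unweighted ones. *)
Lemma unweighted_modes_eq0 (G : R -> R) x y : continuous G ->
  (forall m, mode (fun t => G t * wre x y t) (fun t => G t * wim x y t) m = 0) ->
  (forall m, mode (fun t => G t * wim x y t) (fun t => - (G t * wre x y t)) m = 0) ->
  forall m, itg 0 twopi (fun t => G t * cos (m%:R * t)) = 0 /\
            itg 0 twopi (fun t => G t * sin (m%:R * t)) = 0.
Proof.
move=> cG h1 h2 m.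
have h k : (0 <= k)%N -> itg 0 twopi (kre G x y tau k) = 0 /\ itg 0 twopi (kim G x y tau k) = 0.
  by move=> _; rewrite -mode_weight -mode_weight_im h1 h2.
have [h3 h4] := kernel_modes_eq0 cG 0 h (leq0n m).
by split; [rewrite -[RHS]h3|rewrite -[RHS]h4]; congr itg; apply/funext => t; rewrite /kre /kim !mul0r expR0 subr0 mul1r.
Qed.

End ComplexWeight.

(** * The transport equation in the plane *)

Ltac cts1_tac :=
  lazymatch goal with
  | |- continuous (fun t => @?f t + @?g t) => refine (@ctsD _ _ f g _ _); cts1_tac
  | |- continuous (fun t => @?f t * @?g t) => refine (@ctsM _ _ f g _ _); cts1_tac
  | |- continuous (fun t => - @?f t) => refine (@ctsN _ _ f _); cts1_tac
  | |- continuous (fun t => \sum_(i <- ?r) @?F t i) =>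
      refine (@cts_sum _ _ _ r (fun i t => F t i) _); let i := fresh in intro i; cbv beta; cts1_tac
  | |- continuous (fun _ => ?k) => exact (@cts_cst _ _ k)
  | _ => solve [auto 2 with nocore]
  end.

Section PlaneTransport.
Context {R : realType} (n : nat) (L K : R).
Implicit Types (i j : 'I_n) (x y t : R) (m : nat).
Hypothesis L0 : 0 < L.
Variables (A A1 A2 : 'I_n -> 'I_n -> R -> R -> R).
Hypothesis A_C1 : forall i j, C1 (A i j) (A1 i j) (A2 i j).
Hypothesis A_skew : forall i j x y, A i j x y = - A j i x y.
Hypothesis A_le : forall i j x y, `|A i j x y| <= K.
Hypothesis A1_le : forall i j x y, `|A1 i j x y| <= K.
Hypothesis A2_le : forall i j x y, `|A2 i j x y| <= K.
Variable f : 'I_n -> R -> R -> R.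
Variables U U1 U2 : 'I_n -> R -> R -> R -> R.
Hypothesis U_C13 : forall i, C13 (U i) (U1 i) (U2 i).
Hypothesis U_vanish : forall i x y t, L <= `|x| \/ L <= `|y| -> U i x y t = 0.
Hypothesis transport : forall i x y t,
  cos t * U1 i x y t + sin t * U2 i x y t = \sum_j A i j x y * U j x y t + f i x y.

(** The operators [Dre] and [Dim] are doubled, so the chain contains 2 A and the bound doubles too.
    The value of [tau] below solves [4 * tau = 2 * C + 1]. *)
Let K2 : R := 2 * K.
Let C : R := chainC K2 n.
Let tau : R := (2 * C + 1) / 4.

Let K0 i : 0 <= K. Proof. by apply: le_trans (A_le i i 0 0). Qed.

Let C0 : 0 <= C.
Proof.
rewrite /C /chainC /K2; case: n K0 => [|p] K0'; first by rewrite expr0n !mulr0 addr0.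
by rewrite addr_ge0// !mulr_ge0 ?sqr_ge0 ?exprn_ge0// ?mulr_ge0// ?(K0' ord0).
Qed.

Let V i x y t := U i x y t * wre tau x y t.
Let W i x y t := U i x y t * wim tau x y t.
Let dwr1 x y t := dwre tau (be x y t) (cos t) (sin t) x y t.
Let dwr2 x y t := dwre tau (be x y t) (sin t) (- cos t) x y t.
Let dwi1 x y t := dwim tau (be x y t) (cos t) (sin t) x y t.
Let dwi2 x y t := dwim tau (be x y t) (sin t) (- cos t) x y t.
Let V1 i x y t := U i x y t * dwr1 x y t + wre tau x y t * U1 i x y t.
Let V2 i x y t := U i x y t * dwr2 x y t + wre tau x y t * U2 i x y t.
Let W1 i x y t := U i x y t * dwi1 x y t + wim tau x y t * U1 i x y t.
Let W2 i x y t := U i x y t * dwi2 x y t + wim tau x y t * U2 i x y t.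

Let V_C13 i : C13 (V i) (V1 i) (V2 i). Proof. exact: C13M (U_C13 i) (C13_wre tau). Qed.
Let W_C13 i : C13 (W i) (W1 i) (W2 i). Proof. exact: C13M (U_C13 i) (C13_wim tau). Qed.

Let NV i x y t := - V i x y t.
Let NV_C13 i : C13 (NV i) (fun x y t => - V1 i x y t) (fun x y t => - V2 i x y t).
Proof. exact: C13N (V_C13 i). Qed.

Let c3V i : cts3 (V i). Proof. by have [] := V_C13 i. Qed.
Let c3V1 i : cts3 (V1 i). Proof. by have [] := V_C13 i. Qed.
Let c3V2 i : cts3 (V2 i). Proof. by have [] := V_C13 i. Qed.
Let c3W i : cts3 (W i). Proof. by have [] := W_C13 i. Qed.
Let c3W1 i : cts3 (W1 i). Proof. by have [] := W_C13 i. Qed.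
Let c3W2 i : cts3 (W2 i). Proof. by have [] := W_C13 i. Qed.

Let cV i x y : continuous (V i x y). Proof. exact: cts3_t_slice. Qed.
Let cV1 i x y : continuous (V1 i x y). Proof. exact: cts3_t_slice. Qed.
Let cV2 i x y : continuous (V2 i x y). Proof. exact: cts3_t_slice. Qed.
Let cW i x y : continuous (W i x y). Proof. exact: cts3_t_slice. Qed.
Let cW1 i x y : continuous (W1 i x y). Proof. exact: cts3_t_slice. Qed.
Let cW2 i x y : continuous (W2 i x y). Proof. exact: cts3_t_slice. Qed.
Let cwr x y : continuous (wre tau x y).
Proof. by apply: cts3_t_slice; have [] := C13_wre tau. Qed.
Let cwi x y : continuous (wim tau x y).
Proof. by apply: cts3_t_slice; have [] := C13_wim tau. Qed.

(* V + i W is U multiplied by the integrating factor exp (- sigma h), where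
   h = zeta^2 - |z|^2 contains only nonnegative powers of e^(it). *)
Let transport_V i x y t : cos t * V1 i x y t + sin t * V2 i x y t =
  tau * be x y t * W i x y t + \sum_j A i j x y * V j x y t + f i x y * wre tau x y t.
Proof.
have -> : \sum_j A i j x y * V j x y t = (\sum_j A i j x y * U j x y t) * wre tau x y t.
  by rewrite mulr_suml; apply: eq_bigr => j _; rewrite /V mulrA.
have := transport i x y t; have := transport_wre tau x y t.
rewrite /V1 /V2 /W /dwr1 /dwr2.
move: (dwre _ _ _ _ x y t) (dwre _ _ _ _ x y t) (\sum_j _) => b a s h1 h2.
transitivity (U i x y t * (cos t * a + sin t * b) +
  (cos t * U1 i x y t + sin t * U2 i x y t) * wre tau x y t); first by ring.
by rewrite h1 h2; ring.
Qed.

Let transport_W i x y t : cos t * W1 i x y t + sin t * W2 i x y t =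
  - (tau * be x y t * V i x y t) + \sum_j A i j x y * W j x y t + f i x y * wim tau x y t.
Proof.
have -> : \sum_j A i j x y * W j x y t = (\sum_j A i j x y * U j x y t) * wim tau x y t.
  by rewrite mulr_suml; apply: eq_bigr => j _; rewrite /W mulrA.
have := transport i x y t; have := transport_wim tau x y t.
rewrite /W1 /W2 /V /dwi1 /dwi2.
move: (dwim _ _ _ _ x y t) (dwim _ _ _ _ x y t) (\sum_j _) => b a s h1 h2.
transitivity (U i x y t * (cos t * a + sin t * b) +
  (cos t * U1 i x y t + sin t * U2 i x y t) * wim tau x y t); first by ring.
by rewrite h1 h2; ring.
Qed.

(** F + i G is twice (d + sigma conj(z)) applied to V + i W, and Fs + i Gs is twice the formal
    adjoint applied to it, before any mode is taken. *)
Let F i x y t := V1 i x y t + tau * x * V i x y t + (W2 i x y t + tau * y * W i x y t).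
Let G i x y t := W1 i x y t + tau * x * W i x y t + - (V2 i x y t + tau * y * V i x y t).
Let Fs i x y t := tau * x * V i x y t + - V1 i x y t + (W2 i x y t + - (tau * y * W i x y t)).
Let Gs i x y t := tau * x * W i x y t + - W1 i x y t + - (V2 i x y t + - (tau * y * V i x y t)).

Let c3F i : cts3 (F i). Proof. by rewrite /F; cts3_tac. Qed.
Let c3G i : cts3 (G i). Proof. by rewrite /G; cts3_tac. Qed.
Let c3Fs i : cts3 (Fs i). Proof. by rewrite /Fs; cts3_tac. Qed.
Let c3Gs i : cts3 (Gs i). Proof. by rewrite /Gs; cts3_tac. Qed.
Let cF i x y : continuous (F i x y). Proof. exact: cts3_t_slice. Qed.
Let cG i x y : continuous (G i x y). Proof. exact: cts3_t_slice. Qed.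
Let cFs i x y : continuous (Fs i x y). Proof. exact: cts3_t_slice. Qed.
Let cGs i x y : continuous (Gs i x y). Proof. exact: cts3_t_slice. Qed.

Let P m i x y := mode (V i x y) (W i x y) m.
Let P1 m i x y := mode (V1 i x y) (W1 i x y) m.
Let P2 m i x y := mode (V2 i x y) (W2 i x y) m.
Let Q m i x y := mode (W i x y) (NV i x y) m.
Let Q1 m i x y := mode (W1 i x y) (fun t => - V1 i x y t) m.
Let Q2 m i x y := mode (W2 i x y) (fun t => - V2 i x y t) m.

Let P_C1 m i : C1 (P m i) (P1 m i) (P2 m i). Proof. exact: C1_mode. Qed.
Let Q_C1 m i : C1 (Q m i) (Q1 m i) (Q2 m i). Proof. exact: C1_mode (W_C13 i) (NV_C13 i). Qed.

Let V_vanish i x y t : L <= `|x| \/ L <= `|y| -> V i x y t = 0.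
Proof. by move=> h; rewrite /V U_vanish// mul0r. Qed.
Let W_vanish i x y t : L <= `|x| \/ L <= `|y| -> W i x y t = 0.
Proof. by move=> h; rewrite /W U_vanish// mul0r. Qed.

Let P_vanish m i : vanish L (P m i).
Proof.
move=> x y h; rewrite -[RHS](mode0 m); congr mode; apply/funext => t.
  exact: V_vanish.
exact: W_vanish.
Qed.
Let Q_vanish m i : vanish L (Q m i).
Proof.
move=> x y h; rewrite -[RHS](mode0 m); congr mode; apply/funext => t.
  exact: W_vanish.
by rewrite /NV V_vanish// oppr0.
Qed.

Let DreE m i x y : Dre tau P P1 Q Q2 m i x y = mode (F i x y) (G i x y) m.
Proof.
rewrite /Dre /P /P1 /Q /Q2 -!modeZ -?modeD; try by rewrite /NV; cts1_tac.
by congr mode; apply/funext => t; rewrite /F /G /NV; ring.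
Qed.

Let DimE m i x y : Dim tau P P2 Q Q1 m i x y = mode (G i x y) (fun t => - F i x y t) m.
Proof.
rewrite /Dim /P /P2 /Q /Q1 -!modeZ -?modeD -?modeB; try by rewrite /NV; cts1_tac.
by congr mode; apply/funext => t; rewrite /F /G /NV; ring.
Qed.

Let DsreE m i x y : Dsre tau P P1 Q Q2 m i x y = mode (Fs i x y) (Gs i x y) m.
Proof.
rewrite /Dsre /P /P1 /Q /Q2 -!modeZ -?modeB -?modeD; try by rewrite /NV; cts1_tac.
by congr mode; apply/funext => t; rewrite /Fs /Gs /NV; ring.
Qed.

Let DsimE m i x y : Dsim tau P P2 Q Q1 m i x y = mode (Gs i x y) (fun t => - Fs i x y t) m.
Proof.
rewrite /Dsim /P /P2 /Q /Q1 -!modeZ -?modeB; try by rewrite /NV; cts1_tac.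
by congr mode; apply/funext => t; rewrite /Fs /Gs /NV; ring.
Qed.

Let A' i j x y := 2 * A i j x y.
Let H i x y t := 2 * (\sum_j A i j x y * V j x y t + f i x y * wre tau x y t).
Let H' i x y t := 2 * (\sum_j A i j x y * W j x y t + f i x y * wim tau x y t).
Let cH i x y : continuous (H i x y). Proof. by rewrite /H; cts1_tac. Qed.
Let cH' i x y : continuous (H' i x y). Proof. by rewrite /H'; cts1_tac. Qed.

(** Real part of e^(it) (F + i G) - e^(-it) (Fs + i Gs), which is twice the weighted transport
    equation with its [be] term absorbed; [shift2] is the imaginary part. *)
Let shift1 i x y t : (F i x y t - Fs i x y t) * cos t - (G i x y t + Gs i x y t) * sin t = H i x y t.
Proof.
rewrite /H -[X in 2 * X](addKr (tau * be x y t * W i x y t)).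
rewrite [X in - _ + X]addrA -transport_V /F /Fs /G /Gs /be; ring.
Qed.

Let shift2 i x y t : (F i x y t + Fs i x y t) * sin t + (G i x y t - Gs i x y t) * cos t = H' i x y t.
Proof.
rewrite /H' -[X in 2 * X](addKr (- (tau * be x y t * V i x y t))).
rewrite [X in - _ + X]addrA -transport_W /F /Fs /G /Gs /be; ring.
Qed.

(** The source [f] does not depend on the angle, so it contributes [f] times a positive mode of the
    weight, which is 0. *)
Let modeH m i x y : mode (H i x y) (H' i x y) m.+1 = mulA A' (P m.+1) i x y.
Proof.
have [w1 _] := weight_modes_eq0 tau x y (ltn0Sn m).
rewrite /H /H' modeZ; try by cts1_tac.
rewrite modeD; try by cts1_tac.
rewrite modeZ// w1 mulr0 addr0 mode_sum; try by move=> j; cts1_tac.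
rewrite /mulA mulr_sumr; apply: eq_bigr => j _.
by rewrite modeZ// /A' mulrA.
Qed.

Let modeH_im m i x y : mode (H' i x y) (fun t => - H i x y t) m.+1 = mulA A' (Q m.+1) i x y.
Proof.
have [_ w1] := weight_modes_eq0 tau x y (ltn0Sn m).
have -> : (fun t => - H i x y t) =
   (fun t => 2 * (\sum_j A i j x y * NV j x y t + f i x y * - wre tau x y t)).
  apply/funext => t; rewrite /H /NV -mulrN opprD -mulrN; congr (_ * (_ + _)).
  by rewrite -sumrN; apply: eq_bigr => j _; rewrite mulrN.
have cNV j : continuous (NV j x y) by rewrite /NV; cts1_tac.
rewrite /H' modeZ; try by cts1_tac.
rewrite modeD; try by cts1_tac.
rewrite modeZ//; last by cts1_tac.
rewrite w1 mulr0 addr0 mode_sum; try by move=> j; cts1_tac.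
rewrite /mulA mulr_sumr; apply: eq_bigr => j _.
by rewrite modeZ// /A' mulrA.
Qed.

Let chain_re m i x y :
  Dre tau P P1 Q Q2 m.+2 i x y = Dsre tau P P1 Q Q2 m i x y + mulA A' (P m.+1) i x y.
Proof. by rewrite DreE DsreE -modeH; apply: mode_shift. Qed.

Let chain_im m i x y :
  Dim tau P P2 Q Q1 m.+2 i x y = Dsim tau P P2 Q Q1 m i x y + mulA A' (Q m.+1) i x y.
Proof.
rewrite DimE DsimE -modeH_im; apply: mode_shift => //; try by cts1_tac.
- by move=> t; rewrite -shift2; ring.
- by move=> t; rewrite -shift1; ring.
Qed.

(** Pointwise Bessel bound for all partial sums of the integrands of the energies; its integral is
    the bound independent of [N]. *)
Let B x y := \sum_i (mode_bound (F i x y) (G i x y) + mode_bound (G i x y) (fun t => - F i x y t) +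
  C * (mode_bound (V i x y) (W i x y) + mode_bound (W i x y) (NV i x y))).

Let c3NV i : cts3 (NV i). Proof. exact: cts3N. Qed.

Let cB : cts2 B.
Proof.
rewrite /B; apply: cts2_sum => i.
apply: cts2D; last apply: cts2M; first apply: cts2D; try exact: cts2_cst.
- exact: cts2_mode_bound.
- by apply: cts2_mode_bound => //; exact: cts3N.
- by apply: cts2D; exact: cts2_mode_bound.
Qed.

Let cP m i : cts2 (P m i). Proof. by have [] := P_C1 m i. Qed.
Let cQ m i : cts2 (Q m i). Proof. by have [] := Q_C1 m i. Qed.
Let cDre m i : cts2 (Dre tau P P1 Q Q2 m i).
Proof.
have [? ? ? _ _] := P_C1 m i; have [? ? ? _ _] := Q_C1 m i.
by rewrite /Dre; cts2_tac.
Qed.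
Let cDim m i : cts2 (Dim tau P P2 Q Q1 m i).
Proof.
have [? ? ? _ _] := P_C1 m i; have [? ? ? _ _] := Q_C1 m i.
by rewrite /Dim; cts2_tac.
Qed.

Let energies_bounded N :
  \sum_(m < N) (energyD L tau P P1 P2 Q Q1 Q2 m + C * energy L P Q m) <= J L B.
Proof.
pose S m x y := \sum_i (Dre tau P P1 Q Q2 m i x y ^+ 2 + Dim tau P P2 Q Q1 m i x y ^+ 2) +
  C * \sum_i (P m i x y ^+ 2 + Q m i x y ^+ 2).
have c1 m : cts2 (fun x y => \sum_i (Dre tau P P1 Q Q2 m i x y ^+ 2 + Dim tau P P2 Q Q1 m i x y ^+ 2)).
  by apply: cts2_sum => i; apply: cts2D; exact: cts2X.
have c2 m : cts2 (fun x y => \sum_i (P m i x y ^+ 2 + Q m i x y ^+ 2)).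
  by apply: cts2_sum => i; apply: cts2D; exact: cts2X.
have c3 m : cts2 (fun x y => C * \sum_i (P m i x y ^+ 2 + Q m i x y ^+ 2)).
  by apply: cts2M => //; exact: cts2_cst.
have cS m : cts2 (S m) by apply: cts2D.
have -> : \sum_(m < N) (energyD L tau P P1 P2 Q Q1 Q2 m + C * energy L P Q m) =
    J L (fun x y => \sum_(m < N) S m x y).
  rewrite Jsum//; apply: eq_bigr => m _.
  by rewrite /S JD// JZ.
apply: leJ => //; first by apply: cts2_sum.
move=> x y; rewrite /S big_split/= exchange_big/= -mulr_sumr [X in C * X]exchange_big/=.
rewrite mulr_sumr -big_split/=; apply: ler_sum => i _.
rewrite !big_split/= lerD//.
  apply: lerD.
    by under eq_bigr do rewrite DreE; exact: mode_bessel.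
  by under eq_bigr do rewrite DimE; apply: mode_bessel => //; cts1_tac.
by rewrite ler_wpM2l// lerD//; apply: mode_bessel => //; exact: cts3_t_slice.
Qed.

Let energies_eq0 m : energy L P Q m = 0.
Proof.
have tau4 : 4 * tau = 2 * C + 1 by rewrite /tau; field.
have A'_C1 i j : C1 (A' i j) (fun x y => 2 * A1 i j x y) (fun x y => 2 * A2 i j x y).
  have [? ? ? d1 d2] := A_C1 i j; split; try by rewrite /A'; cts2_tac.
    by move=> x y; exact: derZ (d1 x y).
  by move=> x y; exact: derZ (d2 x y).
have n2 (g : R) : `|g| <= K -> `|2 * g| <= K2.
  by move=> h; rewrite /K2 normrM ger0_norm// ler_wpM2l.
apply: (energy_eq0 L0 A'_C1 _ _ _ _ P_C1 Q_C1 P_vanish Q_vanish chain_re chain_im tau4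
  energies_bounded C0) => //.
- by move=> i j x y; rewrite /A' A_skew mulrN.
- by move=> i j x y; exact: n2.
- by move=> i j x y; exact: n2.
- by move=> i j x y; exact: n2.
Qed.

Let modes_eq0 m i x y : P m i x y = 0 /\ Q m i x y = 0.
Proof.
have cPQ (T : nat -> 'I_n -> R -> R -> R) (T' : nat -> 'I_n -> R -> R -> R) :
  (forall m i, cts2 (T m i)) -> (forall m i, cts2 (T' m i)) ->
  J L (fun x y => \sum_i (T m i x y ^+ 2 + T' m i x y ^+ 2)) = 0 ->
  J L (fun x y => T m i x y ^+ 2) = 0.
  move=> cT cT' h; apply/eqP; rewrite eq_le -{1}h.
  have c1 : cts2 (fun x y => T m i x y ^+ 2) by exact: cts2X.
  rewrite J_ge0 ?andbT; last by move=> *; exact: sqr_ge0.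
  apply: leJ => //; first by apply: cts2_sum => k; apply: cts2D; exact: cts2X.
  move=> u v; rewrite (bigD1 i)//= -addrA lerDl addr_ge0 ?sqr_ge0// sumr_ge0// => k _.
  by rewrite addr_ge0 ?sqr_ge0.
have inside (T : nat -> 'I_n -> R -> R -> R) : cts2 (T m i) -> vanish L (T m i) ->
    J L (fun x y => T m i x y ^+ 2) = 0 -> T m i x y = 0.
  move=> cT vT jT.
  have [hx|hx] := lerP L `|x|; first by apply: vT; left.
  have [hy|hy] := lerP L `|y|; first by apply: vT; right.
  move: hx hy; rewrite !ltr_norml => /andP[x1 x2] /andP[y1 y2].
  by apply: (J_sqr_eq0 L0 cT jT); rewrite ltW.
have e0 := energies_eq0 m.
have e1 : J L (fun x y => \sum_i (Q m i x y ^+ 2 + P m i x y ^+ 2)) = 0.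
  by rewrite -[RHS]e0; apply: eqJ => u v; apply: eq_bigr => k _; rewrite addrC.
split.
  exact: (inside P (@cP m i) (@P_vanish m i) (cPQ P Q cP cQ e0)).
exact: (inside Q (@cQ m i) (@Q_vanish m i) (cPQ Q P cQ cP e1)).
Qed.

(** Integrate the transport equation over the angle. The left side becomes derivatives of the first
    cosine and sine modes of [U], and the [A] term involves its mean; all of these are 0, which
    leaves 2 pi f = 0. *)
Theorem plane_transport_source_eq0 i x y : f i x y = 0.
Proof.
have cU j x' y' : continuous (U j x' y') by apply: cts3_t_slice; have [] := U_C13 j.
have um j x' y' m : itg 0 twopi (fun t => U j x' y' t * cos (m%:R * t)) = 0 /\
    itg 0 twopi (fun t => U j x' y' t * sin (m%:R * t)) = 0.
  apply: (@unweighted_modes_eq0 _ tau _ x' y' (@cU j x' y')) => k.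
    exact: (modes_eq0 k j x' y').1.
  exact: (modes_eq0 k j x' y').2.
have T0 := @twopi_gt0 R.
have ccos : continuous (fun t : R => cos t) by exact: continuous_cos.
have csin : continuous (fun t : R => sin t) by exact: continuous_sin.
have [cU3 cU13 cU23 _ _] := U_C13 i.
have mU j : itg 0 twopi (U j x y) = 0.
  rewrite -[RHS](um j x y 0%N).1; congr itg; apply/funext => t.
  by rewrite mul0r cos0 mulr1.
have [_ _ _ d1 _] := C1_itg T0 (C13M (U_C13 i) (C13_t ccos)).
have [_ _ _ _ d2] := C1_itg T0 (C13M (U_C13 i) (C13_t csin)).
have z1 : itg 0 twopi (fun t => U1 i x y t * cos t) = 0.
  have -> : itg 0 twopi (fun t => U1 i x y t * cos t) =
     itg 0 twopi (fun t => U i x y t * 0 + cos t * U1 i x y t).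
    by congr itg; apply/funext => t; ring.
  apply: der_unique (d1 x y) _.
  rewrite (_ : (fun x => _) = fun=> 0); first exact: der_cst.
  apply/funext => x'; rewrite -[RHS](um i x' y 1%N).1; congr itg; apply/funext => t.
  by rewrite mul1r.
have z2 : itg 0 twopi (fun t => U2 i x y t * sin t) = 0.
  have -> : itg 0 twopi (fun t => U2 i x y t * sin t) =
     itg 0 twopi (fun t => U i x y t * 0 + sin t * U2 i x y t).
    by congr itg; apply/funext => t; ring.
  apply: der_unique (d2 x y) _.
  rewrite (_ : (fun y => _) = fun=> 0); first exact: der_cst.
  apply/funext => y'; rewrite -[RHS](um i x y' 1%N).2; congr itg; apply/funext => t.
  by rewrite mul1r.
have cU1 : continuous (U1 i x y) by exact: cts3_t_slice.
have cU2 : continuous (U2 i x y) by exact: cts3_t_slice.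
have : itg 0 twopi (fun t => U1 i x y t * cos t + U2 i x y t * sin t) = 0.
  by rewrite itgD ?z1 ?z2 ?addr0//; exact: ctsM.
rewrite (_ : (fun t => _) = (fun t => \sum_j A i j x y * U j x y t + f i x y)); last first.
  by apply/funext => t; rewrite -transport; ring.
rewrite itgD; [|by cts1_tac|exact: cts_cst].
rewrite itg_sum => [|j]; last by cts1_tac.
rewrite big1 ?add0r => [|j _]; last by rewrite itgZ// mU mulr0.
rewrite itg_cst ?(ltW T0)// subr0 => /eqP.
by rewrite mulf_eq0 (gt_eqF T0) orbF => /eqP.
Qed.

End PlaneTransport.

(** * Bounds and difference quotients of compactly supported functions *)

Section CompactSupport.
Context {R : realType}.
Local Notation V := (R * R)%type.
Implicit Types (g : R -> R -> R) (p q u : V).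

Lemma le_prod_norm r p : (r <= `|p|) = (r <= `|p.1|) || (r <= `|p.2|).
Proof. by rewrite prod_normE le_max. Qed.

Definition box (r : R) : set V := `[- r, r] `*` `[- r, r].

Lemma compact_box r : compact (box r).
Proof. by apply: compact_setX; exact: segment_compact. Qed.

Lemma boxP r p : box r p \/ r < `|p|.
Proof.
have [h|h] := leP `|p| r; last by right.
left; move: h; rewrite prod_normE ge_max !ler_norml /box /= !in_itv /=.
by move=> /andP[-> ->].
Qed.

Lemma vanish_bounded r g : 0 <= r -> cts2 g -> vanish r g ->
  exists2 K, 0 <= K & forall x y, `|g x y| <= K.
Proof.
move=> r0 cg vg.
have cn : continuous (fun p => `|g p.1 p.2|) by apply: cts_comp => // t; exact: norm_continuous.
have b0 : box r !=set0 by exists (0, 0); rewrite /box /= !in_itv /= oppr_le0 r0.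
have [c _ hc] := compact_EVT_max b0 (@compact_box r) (continuous_subspaceT cn).
exists `|g c.1 c.2| => // x y.
have [h|h] := boxP r (x, y); first by apply: (hc (x, y)); rewrite inE.
rewrite vg ?normr0//.
by have := ltW h; rewrite le_prod_norm => /orP[]; auto.
Qed.

Lemma fin_bounded (I : finType) (T : Type) (g : I -> T -> R) :
  (forall i, exists2 K, 0 <= K & forall z, `|g i z| <= K) ->
  exists2 K, 0 <= K & forall i z, `|g i z| <= K.
Proof.
move=> h.
have h' i : exists K, 0 <= K /\ forall z, `|g i z| <= K.
  by have [K K0 hK] := h i; exists K.
have [k hk] := choice h'.
exists (\sum_i k i); first by apply: sumr_ge0 => i _; have [] := hk i.
move=> i z; have [_ hz] := hk i; apply: le_trans (hz z) _.
by rewrite (bigD1 i)//= lerDl sumr_ge0// => j _; have [] := hk j.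
Qed.

(** The mean value theorem reduces this to uniform continuity of [g'], given by compactness on the
    box of radius [r + 1]; from outside that box a step shorter than 1 stays where [g'] is 0. *)
Lemma ulim0_dquot (g g' : V -> R) u r : continuous g' ->
  (forall p, r <= `|p| -> g' p = 0) ->
  (forall p t, der (fun t => g (p + t *: u)) t (g' (p + t *: u))) ->
  ulim0 (dquot u g) g'.
Proof.
move=> cg' vg' dg eps e0.
have cphi : continuous (fun z : V * V => g' (z.2 + z.1)).
  apply: cts_comp => // z; apply: cvgD.
    by have : continuous (fun z : V * V => z.2); [apply: cts_snd; exact: cts_id|exact].
  by have : continuous (fun z : V * V => z.1); [apply: cts_fst; exact: cts_id|exact].
have := near_uniform_compact (phi := fun q p => g' (p + q)) (@compact_box (r + 1))
  (fun p => @cphi ((0 : V), p)) e0.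
move=> H; have [d1 /= d10 hd1] := (nbhs_ballP _ _).1 H.
pose d := Num.min d1 1.
have d0 : 0 < d by rewrite lt_min d10 ltr01.
have u0 : 0 < `|u| + 1 by rewrite ltr_wpDl.
exists (d / (`|u| + 1)); first by rewrite divr_gt0.
move=> h p h0; rewrite ltr_pdivlMr// => hlt.
have [c hc e] := MVT_der 0 h (dg p).
rewrite !subr0 ?scale0r ?addr0 in hc e.
rewrite /dquot e mulrCA mulVf// mulr1.
have hcu : `|c *: u| < d.
  rewrite normrZ; apply: le_lt_trans hlt; rewrite mulrDr mulr1 ler_wpDr//.
  by rewrite ler_wpM2r.
move: hcu; rewrite lt_min => /andP[hcu h2].
have h1 : forall s, box (r + 1) s -> `|g' (s + c *: u) - g' (s + 0)| <= eps.
  by apply: hd1; rewrite -ball_normE /ball_/= sub0r normrN.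
have [bp|bp] := boxP (r + 1) p; first by have := h1 _ bp; rewrite addr0.
have rp : r <= `|p| by apply: le_trans (ltW bp); rewrite lerDl.
rewrite (vg' p)// (vg' (p + c *: u)) ?subrr ?normr0 ?ltW//.
have := ler_normB (p + c *: u) (c *: u); rewrite addrK; move: bp h2 => /=; lra.
Qed.

Lemma der_vanish (h : R -> R) (a r x : R) : der h x a -> r < `|x| ->
  (forall z, r <= `|z| -> h z = 0) -> a = 0.
Proof.
move=> dh rx h0; apply: (der_unique dh); apply/derP.
apply: cvg_near_cst; near=> k.
rewrite !h0 ?subrr ?mulr0//; first exact: ltW.
have kd : `|k| < `|x| - r by near: k; apply: dnbhs0_lt; rewrite subr_gt0.
have := ler_normB (x + k) k; rewrite addrK; lra.
Unshelve. all: by end_near. Qed.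

(** The strict enlargement of the radius lets each derivative be computed where the function is
    locally 0 along the line concerned. *)
Lemma C1_vanish r r' g g1 g2 : r < r' -> C1 g g1 g2 -> vanish r g ->
  [/\ vanish r' g, vanish r' g1 & vanish r' g2].
Proof.
move=> rr [_ _ _ d1 d2] vg; split.
- by move=> x y [h|h]; apply: vg; [left|right]; exact: le_trans (ltW rr) h.
- move=> x y [h|h].
    apply: (der_vanish (d1 x y) (lt_le_trans rr h)) => z hz; apply: vg; by left.
  apply: (der_unique (d1 x y)); rewrite (_ : (fun x => _) = fun=> 0); first exact: der_cst.
  by apply/funext => z; apply: vg; right; exact: le_trans (ltW rr) h.
- move=> x y [h|h].
    apply: (der_unique (d2 x y)); rewrite (_ : g x = fun=> 0); first exact: der_cst.
    by apply/funext => z; apply: vg; left; exact: le_trans (ltW rr) h.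
  by apply: (der_vanish (d2 x y) (lt_le_trans rr h)) => z hz; apply: vg; right.
Qed.

Lemma der_translate (h : R -> R) x a : der (fun t => h (x + t)) 0 a -> der h x a.
Proof.
by move=> /derP dh; apply/derP; move: dh; under eq_fun do rewrite add0r addr0.
Qed.

End CompactSupport.

(** * Uniqueness of the source, from an ODE on each line *)

Section TransportUniqueness.
Context {R : realType} (n : nat).
Local Notation V := (R * R)%type.
Implicit Types (i j : 'I_n) (p : V) (x y t : R).
Variables (A A1 A2 : 'I_n -> 'I_n -> R -> R -> R) (f f1 f2 : 'I_n -> R -> R -> R) (r0 : R).
Hypothesis r00 : 0 < r0.
Hypothesis A_C1 : forall i j, C1 (A i j) (A1 i j) (A2 i j).
Hypothesis A_skew : forall i j x y, A i j x y = - A j i x y.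
Hypothesis A_vanish : forall i j, vanish r0 (A i j).
Hypothesis f_C1 : forall i, C1 (f i) (f1 i) (f2 i).
Hypothesis f_vanish : forall i, vanish r0 (f i).
Variable U : 'I_n -> V -> R -> R.
Definition dir2 t : V := (cos t, sin t).
Hypothesis U_vanish : forall i p t, r0 <= `|p| -> U i p t = 0.
Hypothesis U_ode : forall i p t s,
  der (fun s => U i (p + s *: dir2 t) t) s
    (\sum_j A i j (p + s *: dir2 t).1 (p + s *: dir2 t).2 * U j (p + s *: dir2 t) t +
     f i (p + s *: dir2 t).1 (p + s *: dir2 t).2).

(** In the sup norm [dir2 t] has length at least 1/2, so going back by [L] moves a point by at least
    [2 * (r0 + 1)], which takes any point of norm below [r0 + 1] out of that ball. *)
Let L := 4 * (r0 + 1).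

Let cdir2 : continuous dir2.
Proof. by apply: cts_pair; [exact: continuous_cos|exact: continuous_sin]. Qed.

Let dir2_norm t : 1 <= 2 * `|dir2 t|.
Proof.
rewrite leNgt; apply/negP => h.
have : `|dir2 t| < 2^-1 by rewrite -[_^-1]mul1r ltr_pdivlMr// mulrC.
rewrite prod_normE gt_max /= => /andP[h1 h2].
have := cos2Dsin2 t.
rewrite -(real_normK (num_real (cos t))) -(real_normK (num_real (sin t))).
have := normr_ge0 (cos t); have := normr_ge0 (sin t).
move: h1 h2; move: `|cos t| `|sin t| => a b; nra.
Qed.

Let escape p t : exists2 l, 0 <= l <= L & r0 + 1 <= `|p - l *: dir2 t|.
Proof.
have [h|h] := lerP (r0 + 1) `|p|.
  by exists 0; rewrite ?lexx ?scale0r ?subr0// /L mulr_ge0// addr_ge0 ?ltW.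
have L0 : 0 <= L by rewrite /L mulr_ge0// addr_ge0 ?ltW.
exists L; first by rewrite L0 lexx.
have := ler_normB p (p - L *: dir2 t); rewrite opprB addrCA subrr addr0 normrZ (ger0_norm L0).
have := dir2_norm t; rewrite /L; move: h; move: `|dir2 t| `|p| `|_ - _| => a b c.
have := r00; nra.
Qed.

Let K_exists : exists2 K, 0 <= K & [/\
  forall i j x y, `|A i j x y| <= K, forall i j x y, `|A1 i j x y| <= K,
  forall i j x y, `|A2 i j x y| <= K, forall i x y, `|f i x y| <= K &
  (forall i x y, `|f1 i x y| <= K) /\ (forall i x y, `|f2 i x y| <= K)].
Proof.
have r1 : r0 < r0 + 1 by rewrite ltrDl.
have r10 : 0 <= r0 + 1 by rewrite addr_ge0// ltW.
have bnd (I : finType) (g : I -> R -> R -> R) : (forall k, cts2 (g k)) ->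
    (forall k, vanish (r0 + 1) (g k)) -> exists2 K, 0 <= K & forall k (z : V), `|g k z.1 z.2| <= K.
  move=> cg vg; apply: fin_bounded => k.
  by have [K K0 hK] := vanish_bounded r10 (cg k) (vg k); exists K.
have VA i j := C1_vanish r1 (A_C1 i j) (A_vanish i j).
have Vf i := C1_vanish r1 (f_C1 i) (f_vanish i).
have [K1 K10 h1] := bnd ('I_n * 'I_n)%type (fun k => A k.1 k.2)
  (fun k => let: And5 c _ _ _ _ := A_C1 k.1 k.2 in c) (fun k => let: And3 c _ _ := VA k.1 k.2 in c).
have [K2 K20 h2] := bnd ('I_n * 'I_n)%type (fun k => A1 k.1 k.2)
  (fun k => let: And5 _ c _ _ _ := A_C1 k.1 k.2 in c) (fun k => let: And3 _ c _ := VA k.1 k.2 in c).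
have [K3 K30 h3] := bnd ('I_n * 'I_n)%type (fun k => A2 k.1 k.2)
  (fun k => let: And5 _ _ c _ _ := A_C1 k.1 k.2 in c) (fun k => let: And3 _ _ c := VA k.1 k.2 in c).
have [K4 K40 h4] := bnd 'I_n f (fun k => let: And5 c _ _ _ _ := f_C1 k in c)
  (fun k => let: And3 c _ _ := Vf k in c).
have [K5 K50 h5] := bnd 'I_n f1 (fun k => let: And5 _ c _ _ _ := f_C1 k in c)
  (fun k => let: And3 _ c _ := Vf k in c).
have [K6 K60 h6] := bnd 'I_n f2 (fun k => let: And5 _ _ c _ _ := f_C1 k in c)
  (fun k => let: And3 _ _ c := Vf k in c).
exists (K1 + K2 + K3 + K4 + K5 + K6); first by rewrite !addr_ge0.
split; last split.
- by move=> i j x y; have := h1 (i, j) (x, y) => /=; lra.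
- by move=> i j x y; have := h2 (i, j) (x, y) => /=; lra.
- by move=> i j x y; have := h3 (i, j) (x, y) => /=; lra.
- by move=> i x y; have := h4 i (x, y) => /=; lra.
- by move=> i x y; have := h5 i (x, y) => /=; lra.
- by move=> i x y; have := h6 i (x, y) => /=; lra.
Qed.

Let u1 : V := (1, 0).
Let u2 : V := (0, 1).

Let addu1 p t : p + t *: u1 = (p.1 + t, p.2).
Proof.
apply: injective_projections; rewrite /=.
- congr (_ + _); exact: mulr1.
- rewrite -[RHS]addr0; congr (_ + _); exact: mulr0.
Qed.

Let addu2 p t : p + t *: u2 = (p.1, p.2 + t).
Proof.
apply: injective_projections; rewrite /=.
- rewrite -[RHS]addr0; congr (_ + _); exact: mulr0.
- congr (_ + _); exact: mulr1.
Qed.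

Let ulim1 g g1 g2 : C1 g g1 g2 -> vanish r0 g ->
  ulim0 (dquot u1 (fun p => g p.1 p.2)) (fun p => g1 p.1 p.2).
Proof.
move=> hg vg; have r1 : r0 < r0 + 1 by rewrite ltrDl.
have [_ v1 _] := C1_vanish r1 hg vg.
have [_ c1 _ d1 _] := hg.
apply: (@ulim0_dquot _ _ _ _ (r0 + 1)) => //.
- by move=> p; rewrite le_prod_norm => /orP h; exact: v1.
- move=> p t; rewrite addu1; under eq_fun do rewrite addu1.
  apply: der_eq (der_comp (f := g ^~ p.2) (g := fun t => p.1 + t) _ (d1 _ _)) _.
    exact: derD (der_cst _ _) (der_id _).
  by rewrite add0r mulr1.
Qed.

Let ulim2 g g1 g2 : C1 g g1 g2 -> vanish r0 g ->
  ulim0 (dquot u2 (fun p => g p.1 p.2)) (fun p => g2 p.1 p.2).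
Proof.
move=> hg vg; have r1 : r0 < r0 + 1 by rewrite ltrDl.
have [_ _ v2] := C1_vanish r1 hg vg.
have [_ _ c2 _ d2] := hg.
apply: (@ulim0_dquot _ _ _ _ (r0 + 1)) => //.
- by move=> p; rewrite le_prod_norm => /orP h; exact: v2.
- move=> p t; rewrite addu2; under eq_fun do rewrite addu2.
  apply: der_eq (der_comp (f := g p.1) (g := fun t => p.2 + t) _ (d2 _ _)) _.
    exact: derD (der_cst _ _) (der_id _).
  by rewrite add0r mulr1.
Qed.

(** [transport_C1] along the two axes supplies the partial derivatives; [der_line] identifies their
    combination with the derivative along the line that the ODE prescribes. *)
Theorem transport_source_eq0 i x y : f i x y = 0.
Proof.
have [K K0 [bA bA1 bA2 bf [bf1 bf2]]] := K_exists.
have cA k j : continuous (fun p : V => A k j p.1 p.2) by have [] := A_C1 k j.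
have cf k : continuous (fun p : V => f k p.1 p.2) by have [] := f_C1 k.
have sk k j (p : V) : A k j p.1 p.2 = - A j k p.1 p.2 by exact: A_skew.
have cU k := transport_continuous K0 sk cA cf cdir2 (fun k p => bf k p.1 p.2) escape U_vanish U_ode k.
have [U1 [cU1 dU1 _]] := transport_C1 K0 sk cA cf cdir2 (fun k p => bf k p.1 p.2) escape U_vanish U_ode
  (fun k j => ulim1 (A_C1 k j) (A_vanish k j)) (fun k => ulim1 (f_C1 k) (f_vanish k))
  (fun k j p => bA1 k j p.1 p.2) (fun k p => bf1 k p.1 p.2).
have [U2 [cU2 dU2 _]] := transport_C1 K0 sk cA cf cdir2 (fun k p => bf k p.1 p.2) escape U_vanish U_ode
  (fun k j => ulim2 (A_C1 k j) (A_vanish k j)) (fun k => ulim2 (f_C1 k) (f_vanish k))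
  (fun k j p => bA2 k j p.1 p.2) (fun k p => bf2 k p.1 p.2).
have c3 (g : V -> R -> R) : continuous (fun z : V * R => g z.1 z.2) -> cts3 (fun x y t => g (x, y) t).
  move=> cg; rewrite /cts3 (_ : (fun z => _) = (fun z : V * R => g z.1 z.2))//.
  by apply/funext => -[[]].
have hU k : C13 (fun x y t => U k (x, y) t) (fun x y t => U1 k (x, y) t) (fun x y t => U2 k (x, y) t).
  split; [exact: (c3 _ (@cU k))|exact: (c3 _ (@cU1 k))|exact: (c3 _ (@cU2 k))| |].
  - move=> x' y' t; apply: (der_translate (h := fun x => U k (x, y') t)); have := dU1 k (x', y') t.
    by under eq_fun do rewrite addu1.
  - move=> x' y' t; apply: (der_translate (h := fun y => U k (x', y) t)); have := dU2 k (x', y') t.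
    by under eq_fun do rewrite addu2.
apply: (plane_transport_source_eq0 r00 A_C1 A_skew bA bA1 bA2 hU) => //.
- move=> k x' y' t h; apply: U_vanish; rewrite le_prod_norm.
  by apply/orP.
- move=> k x' y' t.
  have [c1 c2 c3' d1 d2] := hU k.
  have hC : C1 (fun x y => U k (x, y) t) (fun x y => U1 k (x, y) t) (fun x y => U2 k (x, y) t).
    have cs (g : V -> R -> R) : continuous (fun z : V * R => g z.1 z.2) -> cts2 (fun x y => g (x, y) t).
      move=> cg; rewrite /cts2 (_ : (fun z => _) = (fun z : V => g z t)); last by apply/funext => -[].
      exact: (cts2_l (f := g) (u := t) cg).
    split; [exact: (cs _ (@cU k))|exact: (cs _ (@cU1 k))|exact: (cs _ (@cU2 k))| |].
    - by move=> ? ?; exact: d1.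
    - by move=> ? ?; exact: d2.
  have e1 := der_line (cos t) (sin t) x' y' hC.
  have e2 := U_ode k (x', y') t 0; rewrite scale0r addr0 /= in e2.
  exact: der_unique e1 e2.
Qed.

End TransportUniqueness.

(** * Reduction to the transport equation *)

Section LineIntegrals.
Context {R : realType}.
Implicit Types (w : R -> R) (a b s : R).

Lemma der_itg_upper w a x : continuous w -> a < x -> der (fun x => itg a x w) x (w x).
Proof.
move=> cw ax.
have := @continuous_FTC1 R w (BLeft a) x (x + 1).
move=> /(_ _ _ _ _)[|||/=|dF eF].
- by rewrite ltrDl.
- exact: itg_integrable.
- by rewrite lte_fin.
- exact: cw.
- by rewrite /der /itg; split; [exact: dF|rewrite -derive1E; exact: eF].
Qed.

Lemma itg_supp w a b : (forall s, s < a \/ b < s -> w s = 0) ->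
  itg a b w = \int[lebesgue_measure]_(s in [set: R]) w s.
Proof.
move=> w0; rewrite /itg Rintegral_mkcond; congr Rintegral; apply/funext => s.
rewrite /patch; case: ifPn => // /negP h; rewrite w0//.
have [sa|sa] := ltP s a; first by left.
have [sb|sb] := ltP b s; first by right.
by exfalso; apply: h; rewrite inE /= in_itv /= sa sb.
Qed.

(** For [w] supported in [-r, r], starting one unit earlier puts a neighbourhood of the support
    within reach of the fundamental theorem; further left the segment is empty and the value is
    0. *)
Definition primitive (r : R) w s := itg (- r - 1) s w.

Lemma der_primitive r w s : continuous w -> (forall t, r <= `|t| -> w t = 0) ->
  der (primitive r w) s (w s).
Proof.
move=> cw w0.
have [h|h] := ltP (- r - 1) s; first exact: der_itg_upper.
have z t : t <= - r -> primitive r w t = 0.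
  move=> tr; rewrite /primitive -[RHS](itg0 (- r - 1) t); apply: eq_itg => u /andP[_ ut].
  by apply: w0; rewrite -normrN ler_normr; move: tr ut; lra.
have -> : w s = 0 by apply: w0; rewrite -normrN ler_normr; move: h; lra.
apply/derP; apply: cvg_near_cst; near=> k.
have k1 : `|k| < 1 by near: k; exact: dnbhs0_lt.
move: k1; rewrite ltr_norml => /andP[_ k1].
by rewrite !z ?subrr ?mulr0//; move: h k1; lra.
Unshelve. all: by end_near. Qed.

(** To the left of the support nothing has accumulated; to the right the whole integral has, and it
    is 0. *)
Lemma primitive_eq0 r w s : (forall t, r <= `|t| -> w t = 0) ->
  \int[lebesgue_measure]_(s in [set: R]) w s = 0 -> r <= `|s| -> primitive r w s = 0.
Proof.
move=> w0 i0; rewrite ler_normr => /orP[rs|rs].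
  rewrite /primitive itg_supp// => t [h|h]; apply: w0.
    by rewrite -normrN ler_normr; move: h; lra.
  by rewrite ler_normr; move: h rs; lra.
rewrite /primitive -[RHS](itg0 (- r - 1) s); apply: eq_itg => u /andP[_ ut].
by apply: w0; rewrite -normrN ler_normr; move: rs ut; lra.
Qed.

End LineIntegrals.

Section OrthogonalSystem.
Context {R : realType} (n : nat).
Implicit Types (i j k : 'I_n).
Variables (S : R -> 'M[R]_n) (a : 'I_n -> 'I_n -> R -> R).
Hypothesis a_skew : forall i j s, a i j s = - a j i s.
Hypothesis S_ode : forall i j s, der (fun s => S s i j) s (\sum_k a i k s * S s k j).
Hypothesis S_lim : forall i j, S s i j @[s --> -oo] --> ((i == j)%:R : R).

(** Skewness makes the derivative of the Gram matrix 0, and its limit at [-oo] is the identity. *)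
Lemma skew_system_orthogonal s : (S s)^T *m S s = 1%:M.
Proof.
apply/matrixP => i j; rewrite !mxE.
under eq_bigr do rewrite mxE.
pose g s := \sum_k S s k i * S s k j.
have dg t : der g t 0.
  apply: der_eq (der_sum _ (fun k => derM (S_ode k i t) (S_ode k j t))) _.
  under eq_bigr do rewrite !mulr_sumr.
  rewrite big_split/= [X in _ + X]exchange_big -big_split/= big1// => k _.
  rewrite -big_split big1// => l _ /=.
  by rewrite (a_skew l k); ring.
have gl : g s @[s --> -oo] --> (\sum_(k < n) (k == i)%:R * (k == j)%:R : R).
  rewrite /g; elim: (index_enum _) => [|k r IH].
    by rewrite big_nil; under eq_fun do rewrite big_nil; exact: cvg_cst.
  rewrite big_cons; under eq_fun do rewrite big_cons.
  by apply: cvgD IH; apply: cvgM; exact: S_lim.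
have gc : g t @[t --> -oo] --> g s.
  rewrite (_ : g = fun=> g s); first exact: cvg_cst.
  by apply/funext => t; exact: (der0_cst dg).
rewrite -/(g s) (cvg_unique _ gc gl)//.
rewrite (bigD1 i)//= eqxx mul1r big1 ?addr0// => k /negbTE ->.
by rewrite mul0r.
Qed.

Lemma skew_system_orthogonalr s : S s *m (S s)^T = 1%:M.
Proof. by apply: mulmx1C; exact: skew_system_orthogonal. Qed.

End OrthogonalSystem.

Section MatrixEntries.
Context {R : realType}.

Lemma is_derive_entry m n (M : R -> 'M[R]_(m, n)) (s : R) (D : 'M[R]_(m, n)) i j :
  is_derive s (1 : R) M D -> der (fun s => M s i j) s (D i j).
Proof.
move=> [dM <-]; split; first exact: (derivable_mxP _ _ _).1.
by rewrite derive_mx// mxE.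
Qed.

Lemma cvg_entry (T : Type) (F : set_system T) m n (M : T -> 'M[R]_(m, n)) (L : 'M[R]_(m, n)) i j :
  M @ F --> L -> (fun t => M t i j) @ F --> L i j.
Proof.
move=> h; have c := @coord_continuous R m n i j L.
exact: (cvg_comp _ _ h c).
Qed.

Lemma norm_entry_le m n (M : 'M[R]_(m, n)) i j : `|M i j| <= `|M|.
Proof.
rewrite [leRHS]/Num.Def.normr/= mx_normrE.
exact: (le_bigmax _ (fun ij => `|M ij.1 ij.2|) (i, j)).
Qed.

End MatrixEntries.

(** * The matrix [H] and the dot product in coordinates *)

Section SkewMatrix.
Context {R : realType}.
Local Notation E := 'cV[R]_3.

Lemma I3P (i : 'I_3) : [\/ i = 0, i = 1 | i = 2%:R].
Proof.
case: i => [[|[|[|//]]]] h; [constructor 1|constructor 2|constructor 3]; exact: val_inj.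
Qed.

Lemma H_skew (b : E) i j : H b i j = - H b j i.
Proof.
by case: (I3P i) => ->; case: (I3P j) => ->; rewrite /H !mxE /= ?oppr0 ?opprK.
Qed.

Lemma H_linear (b : E) i j : H b i j = \sum_k H (delta_mx k 0) i j * b k 0.
Proof.
rewrite !big_ord_recl big_ord0.
have -> : lift ord0 (ord0 : 'I_2) = 1 :> 'I_3 by exact: val_inj.
have -> : lift ord0 (lift ord0 (ord0 : 'I_1)) = 2%:R :> 'I_3 by exact: val_inj.
by case: (I3P i) => ->; case: (I3P j) => ->; rewrite /H !mxE /=; ring.
Qed.

Lemma H0 i j : H (0 : E) i j = 0.
Proof.
rewrite H_linear big1// => k _.
have -> : (0 : E) k 0 = 0 by rewrite mxE.
by rewrite mulr0.
Qed.

Lemma H_inj (b b' : E) : H b = H b' -> b = b'.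
Proof.
move=> e; apply/matrixP => i j; rewrite (ord1 j).
have h01 : H b 0 1 = H b' 0 1 by rewrite e.
have h20 : H b 2%:R 0 = H b' 2%:R 0 by rewrite e.
have h12 : H b 1 2%:R = H b' 1 2%:R by rewrite e.
move: h01 h20 h12; rewrite /H !mxE /= => h01 h20 h12.
by case: (I3P i) => ->.
Qed.

Lemma dotE (u w : E) : dot u w = u 0 0 * w 0 0 + u 1 0 * w 1 0 + u 2%:R 0 * w 2%:R 0.
Proof.
rewrite /dot !big_ord_recl big_ord0 addr0 addrA.
have -> : lift ord0 (ord0 : 'I_2) = 1 :> 'I_3 by exact: val_inj.
by have -> : lift ord0 (lift ord0 (ord0 : 'I_1)) = 2%:R :> 'I_3 by exact: val_inj.
Qed.

Lemma dotD (u v w : E) : dot (u + v) w = dot u w + dot v w.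
Proof. by rewrite !dotE !mxE; ring. Qed.
Lemma dotZ k (u w : E) : dot (k *: u) w = k * dot u w.
Proof. by rewrite !dotE !mxE; ring. Qed.
Lemma dotC (u w : E) : dot u w = dot w u.
Proof. by rewrite !dotE; ring. Qed.

End SkewMatrix.

(** * Orthonormal coordinates on the plane *)

Section PlaneCoordinates.
Context {R : realType}.
Local Notation E := 'cV[R]_3.
Local Notation V := (R * R)%type.

(** For the matrix [M] with rows [u], [v], [w], orthonormality is M M^T = 1; a square matrix then
    also satisfies M^T M = 1, and x = M^T (M x) is the expansion. *)
Lemma orthonormal_decomposition (u v w : E) : dot u u = 1 -> dot v v = 1 -> dot w w = 1 ->
  dot u v = 0 -> dot u w = 0 -> dot v w = 0 ->
  forall x, x = dot x u *: u + dot x v *: v + dot x w *: w.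
Proof.
move=> uu vv ww uv uw vw x.
pose M : 'M[R]_3 := \matrix_(i, j) (if i == 0 then u j 0 else if i == 1 then v j 0 else w j 0).
have MMT : M *m M^T = 1%:M.
  apply/matrixP => i j; rewrite !mxE.
  have -> : \sum_k M i k * M^T k j = dot (\col_k M i k) (\col_k M j k).
    by rewrite /dot; apply: eq_bigr => k _; rewrite !mxE.
  have M0 : \col_k M 0 k = u by apply/matrixP => k l; rewrite !mxE /= (ord1 l).
  have M1 : \col_k M 1 k = v by apply/matrixP => k l; rewrite !mxE /= (ord1 l).
  have M2 : \col_k M 2%:R k = w by apply/matrixP => k l; rewrite !mxE /= (ord1 l).
  by case: (I3P i) => ->; case: (I3P j) => ->; rewrite ?M0 ?M1 ?M2 //= dotC.
have {MMT} MTM := mulmx1C MMT.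
have xE : x = M^T *m (M *m x) by rewrite mulmxA MTM mul1mx.
rewrite {1}xE; apply/matrixP => i j; rewrite (ord1 j) !mxE.
rewrite !big_ord_recl big_ord0.
have -> : lift ord0 (ord0 : 'I_2) = 1 :> 'I_3 by exact: val_inj.
have -> : lift ord0 (lift ord0 (ord0 : 'I_1)) = 2%:R :> 'I_3 by exact: val_inj.
have Mx k : (M *m x) k 0 = dot x (\col_l M k l).
  by rewrite mxE /dot; apply: eq_bigr => l _; rewrite mxE mulrC.
rewrite !Mx !mxE /= addr0 addrA.
have M0 : \col_k M 0 k = u by apply/matrixP => k l; rewrite !mxE /= (ord1 l).
have M1 : \col_k M 1 k = v by apply/matrixP => k l; rewrite !mxE /= (ord1 l).
have M2 : \col_k M 2%:R k = w by apply/matrixP => k l; rewrite !mxE /= (ord1 l).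
by rewrite M0 M1 M2; congr (_ + _ + _); rewrite mulrC.
Qed.

Definition cross (u w : E) : E := \col_i (nth 0
  [:: u 1 0 * w 2%:R 0 - u 2%:R 0 * w 1 0; u 2%:R 0 * w 0 0 - u 0 0 * w 2%:R 0;
      u 0 0 * w 1 0 - u 1 0 * w 0 0] i).

Lemma plane_basis (eta : E) : dot eta eta = 1 -> exists e1 e2 : E,
  [/\ dot e1 e1 = 1, dot e2 e2 = 1, dot e1 e2 = 0, dot e1 eta = 0 & dot e2 eta = 0].
Proof.
move=> eta1.
have [e1 e11 e1eta] : exists2 e1 : E, dot e1 e1 = 1 & dot e1 eta = 0.
  (* If [eta] lies on the third axis, the first axis vector works; otherwise the horizontal part of
     [eta] is turned by a right angle and normalised. *)
  have [h|h] := eqVneq (eta 0 0 ^+ 2 + eta 1 0 ^+ 2) 0.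
    exists (delta_mx 0 0); rewrite dotE !mxE /= ?mulr1 ?mul1r !(mul0r, addr0)//.
    by move/eqP: h; rewrite paddr_eq0 ?sqr_ge0// sqrf_eq0 => /andP[/eqP].
  have p : 0 < eta 0 0 ^+ 2 + eta 1 0 ^+ 2 by rewrite lt0r h addr_ge0 ?sqr_ge0.
  pose N := Num.sqrt (eta 0 0 ^+ 2 + eta 1 0 ^+ 2).
  have N0 : N != 0 by rewrite gt_eqF// sqrtr_gt0.
  have N2 : N ^+ 2 = eta 0 0 ^+ 2 + eta 1 0 ^+ 2 by rewrite sqr_sqrtr// ltW.
  pose w : E := \col_i (nth 0 [:: - eta 1 0; eta 0 0; 0] i).
  exists (N^-1 *: w); last by rewrite dotZ dotE !mxE /=; ring.
  rewrite dotZ dotC dotZ dotE !mxE /=.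
  rewrite (_ : _ + _ + _ = N ^+ 2); last by rewrite N2; ring.
  by field.
exists e1, (cross eta e1); split => //.
- have -> : dot (cross eta e1) (cross eta e1) = dot eta eta * dot e1 e1 - dot e1 eta ^+ 2.
    by rewrite !dotE !mxE /=; ring.
  by rewrite eta1 e11 e1eta expr0n subr0 mulr1.
- by rewrite dotE !mxE /=; ring.
- by rewrite dotE !mxE /=; ring.
Qed.

End PlaneCoordinates.

(** * Fields on the plane as functions of two real variables *)

Section PlaneFields.
Context {R : realType}.
Local Notation E := 'cV[R]_3.
Local Notation V := (R * R)%type.
Variables (eta : E) (z : R) (e1 e2 : E).
Hypothesis eta1 : dot eta eta = 1.
Hypothesis e11 : dot e1 e1 = 1.
Hypothesis e22 : dot e2 e2 = 1.
Hypothesis e12 : dot e1 e2 = 0.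
Hypothesis e1eta : dot e1 eta = 0.
Hypothesis e2eta : dot e2 eta = 0.

Definition pt (p : V) : E := z *: eta + p.1 *: e1 + p.2 *: e2.
Definition xi (t : R) : E := cos t *: e1 + sin t *: e2.

Lemma dot_pt p : (dot (pt p) eta = z) * (dot (pt p) e1 = p.1) * (dot (pt p) e2 = p.2).
Proof.
rewrite /pt !(dotD, dotZ) eta1 e1eta e2eta e11 e22 e12 (dotC eta e1) (dotC eta e2) e1eta e2eta.
by rewrite (dotC e2 e1) e12; split; [split|]; ring.
Qed.

Lemma pt_plane p : plane eta z (pt p).
Proof. by rewrite /plane /= !dot_pt. Qed.

Lemma pt_surj x : plane eta z x -> x = pt (dot x e1, dot x e2).
Proof.
move=> hx; rewrite {1}(orthonormal_decomposition eta1 e11 e22 _ _ e12 x) ?hx//.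
  by rewrite dotC.
by rewrite dotC.
Qed.

Lemma xi_direction t : direction eta (xi t).
Proof.
rewrite /direction /unit_vector /xi /=; split.
  rewrite dotD !dotZ (dotC e1 (_ + _)) (dotC e2 (_ + _)) !dotD !dotZ e11 e22 (dotC e2 e1) e12.
  by rewrite -[RHS](cos2Dsin2 t); ring.
by rewrite dotD !dotZ e1eta e2eta !mulr0 addr0.
Qed.

Lemma ptD p s t : pt p + s *: xi t = pt (p + s *: dir2 t).
Proof. by apply/matrixP => i j; rewrite /pt /xi !mxE /= /GRing.scale/=; ring. Qed.

Lemma pt_continuous : continuous pt.
Proof.
move=> p; apply: cvgD; last apply: cvgZr_tmp; last exact: cvg_snd.
by apply: cvgD; [exact: cvg_cst|apply: cvgZr_tmp; exact: cvg_fst].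
Qed.

Definition fld (B : E -> E) i (x y : R) : R := B (pt (x, y)) i 0.

(** Since [pt] takes values in the plane, continuity relative to the plane becomes ordinary
    continuity in the coordinates. *)
Lemma cts2_fld (g : E -> E) i : {within plane eta z, continuous g} -> cts2 (fld g i).
Proof.
move=> /subspace_continuousP cg p.
have cgp := cg (pt p) (pt_plane p).
have c : (fun q => g (pt q)) @ p --> g (pt p).
  move=> D /cgp hD; have {hD} : nbhs (pt p) [set y | plane eta z y -> D (g y)] by exact: hD.
  move=> /(@pt_continuous p) hD.
  have {}hD : nbhs p [set q | plane eta z (pt q) -> D (g (pt q))] by exact: hD.
  suff : nbhs p [set q | D (g (pt q))] by [].
  by apply: filterS hD => q /=; apply; exact: pt_plane.
have := cvg_entry (i := i) (j := 0) c; rewrite /fld.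
by rewrite (_ : (fun t => g (pt t) i 0) = (fun q : V => g (pt (q.1, q.2)) i 0)).
Qed.

Lemma C1_fld (g : E -> E) i : smooth_on_plane eta z g ->
  C1 (fld g i) (fld (fun x => 'D_e1 g x) i) (fld (fun x => 'D_e2 g x) i).
Proof.
move=> sg.
have d1 (e : E) p : dot e eta = 0 ->
  (fun k : R => k^-1 * (g (k *: e + pt p) i 0 - g (pt p) i 0)) @ 0^' --> ('D_e g (pt p)) i 0.
  move=> he; have [_ /(_ _ _ (pt_plane p) he) dg] := sg [::] (fun _ => fun h => False_ind _ (notF h)).
  have := cvg_entry (i := i) (j := 0) dg.
  by under eq_fun do rewrite !mxE.
have hu (e : E) : dot e eta = 0 -> forall u, u \in [:: e] -> dot u eta = 0.
  by move=> he u; rewrite inE => /eqP ->.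
split.
- by apply: cts2_fld; have [] := sg [::] (fun _ => fun h => False_ind _ (notF h)).
- by apply: cts2_fld; have [] := sg [:: e1] (hu _ e1eta).
- by apply: cts2_fld; have [] := sg [:: e2] (hu _ e2eta).
- move=> x y; apply/derP; have := d1 e1 (x, y) e1eta.
  have hk k : k *: e1 + pt (x, y) = pt (x + k, y).
    by apply/matrixP => a b; rewrite /pt !mxE /=; ring.
  by under eq_fun do rewrite hk.
- move=> x y; apply/derP; have := d1 e2 (x, y) e2eta.
  have hk k : k *: e2 + pt (x, y) = pt (x, y + k).
    by apply/matrixP => a b; rewrite /pt !mxE /=; ring.
  by under eq_fun do rewrite hk.
Qed.

Lemma compact_support_vanish (g : E -> E) : compact_support_on_plane eta z g ->
  exists2 r, 0 < r & forall p : V, r <= `|p| -> g (pt p) = 0.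
Proof.
move=> /compact_bounded[M [_ hM]].
have M1 : M < `|M| + 1 by rewrite (le_lt_trans (ler_norm M))// ltrDl.
have {}hM := hM _ M1.
have e_le (e : E) k : dot e e = 1 -> `|e k 0| <= 1.
  move=> ee; rewrite -(ler_pXn2r (n := 2)) ?nnegrE// expr1n real_normK ?num_real// -ee.
  by rewrite /dot (bigD1 k)//= -expr2 lerDl sumr_ge0// => j _; rewrite -expr2 sqr_ge0.
have dot_le (x e : E) : dot e e = 1 -> `|dot x e| <= 3 * `|x|.
  move=> ee; rewrite /dot (le_trans (ler_norm_sum _ _ _))//.
  have -> : 3 * `|x| = \sum_(k < 3) `|x| by rewrite sumr_const card_ord mulr_natl.
  apply: ler_sum => k _.
  by rewrite normrM -[leRHS]mulr1 ler_pM// ?norm_entry_le// e_le.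
(* The factor 3 compares coordinates with the sup norm on three entries; the last 1 makes the
   contradiction strict. *)
exists (3 * (`|M| + 1) + 1); first by rewrite ltr_wpDl// mulr_ge0// addr_ge0.
move=> p hp; apply: contrapT => gp.
have : `|pt p| <= `|M| + 1.
  by apply: hM; apply: subset_closure; split => //; exact: pt_plane.
have h1 := dot_le (pt p) e1 e11; have h2 := dot_le (pt p) e2 e22.
rewrite !dot_pt in h1 h2.
by move: hp; rewrite le_prod_norm => /orP[hp|hp]; move: h1 h2 hp; lra.
Qed.

End PlaneFields.

(** * Variation of constants along lines *)

Section Main.
Context {R : realType}.
Local Notation E := 'cV[R]_3.
Local Notation V := (R * R)%type.
Implicit Types (i j k : 'I_3) (p q : V) (s t : R).
Variables (gammaN v : R) (eta : E) (z : R) (B : E -> E) (Sigma : E -> E -> 'M[R]_3).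
Hypothesis gammaN0 : gammaN != 0.
Hypothesis v0 : 0 < v.
Hypothesis eta1 : unit_vector eta.
Hypothesis B_smooth : smooth_on_plane eta z B.
Hypothesis Sigma_sol : is_Sigma gammaN v eta z B Sigma.
Variables dB1 dB2 : E -> E.
Hypothesis dB1_smooth : smooth_on_plane eta z dB1.
Hypothesis dB2_smooth : smooth_on_plane eta z dB2.
Hypothesis DS_eq : forall x w, plane eta z x -> direction eta w ->
  D_forward_map gammaN v Sigma dB1 x w = D_forward_map gammaN v Sigma dB2 x w.

Let g := gammaN / v.
Let g0 : g != 0. Proof. by rewrite mulf_neq0// invr_neq0// gt_eqF. Qed.

Variables e1 e2 : E.
Hypothesis e11 : dot e1 e1 = 1.
Hypothesis e22 : dot e2 e2 = 1.
Hypothesis e12 : dot e1 e2 = 0.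
Hypothesis e1eta : dot e1 eta = 0.
Hypothesis e2eta : dot e2 eta = 0.
Let pnt := pt eta z e1 e2.
Let drc := xi e1 e2.

Variable r : R.
Hypothesis r0 : 0 < r.
Hypothesis B0 : forall p, r <= `|p| -> B (pnt p) = 0.
Hypothesis dB10 : forall p, r <= `|p| -> dB1 (pnt p) = 0.
Hypothesis dB20 : forall p, r <= `|p| -> dB2 (pnt p) = 0.

Let S q t s := Sigma (pnt q + s *: drc t) (drc t).
Let a q t i k s := g * H (B (pnt (q + s *: dir2 t))) i k.

Let pntP q : plane eta z (pnt q). Proof. exact: pt_plane. Qed.
Let drcP t : direction eta (drc t). Proof. exact: xi_direction. Qed.

Let S_ode q t i j s : der (fun s => S q t s i j) s (\sum_k a q t i k s * S q t s k j).
Proof.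
have [h _] := Sigma_sol (pntP q) (drcP t).
have := is_derive_entry i j (h s).
move=> d; apply: der_eq d _; rewrite mxE mxE mulr_sumr; apply: eq_bigr => k _.
by rewrite /a /S /pnt /drc ptD mulrA.
Qed.

Let a_skew q t i k s : a q t i k s = - a q t k i s.
Proof. by rewrite /a H_skew mulrN. Qed.

Let S_lim q t i j : S q t s i j @[s --> -oo] --> ((i == j)%:R : R).
Proof.
have [_ h] := Sigma_sol (pntP q) (drcP t).
have := cvg_entry (i := i) (j := j) h.
by rewrite mxE.
Qed.

Let STS q t s : (S q t s)^T *m S q t s = 1%:M.
Proof. exact: (skew_system_orthogonal (@a_skew q t) (@S_ode q t) (@S_lim q t)). Qed.

Let SST q t s : S q t s *m (S q t s)^T = 1%:M.
Proof. exact: (skew_system_orthogonalr (@a_skew q t) (@S_ode q t) (@S_lim q t)). Qed.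

Let f i x y := fld eta z e1 e2 dB1 i x y + - 1 * fld eta z e1 e2 dB2 i x y.

Let fE i p : f i p.1 p.2 = dB1 (pnt p) i 0 - dB2 (pnt p) i 0.
Proof. by rewrite /f mulN1r /fld. Qed.

(** All points of a line share one foot, so taking it as base point makes a quantity built along the
    line a well-defined function of the position. *)
Let foot p t : V := p - (p.1 * cos t + p.2 * sin t) *: dir2 t.
Let perp q t := q.1 * cos t + q.2 * sin t = 0.

Let foot_perp p t : perp (foot p t) t.
Proof.
rewrite /perp /foot /= /GRing.scale /=.
have h := cos2Dsin2 t.
transitivity ((p.1 * cos t + p.2 * sin t) * (1 - (cos t ^+ 2 + sin t ^+ 2))); first by ring.
by rewrite h subrr mulr0.
Qed.

(** By Pythagoras the Euclidean norm of the point is at least [2 * r]; the factor 2 covers the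
    passage to the sup norm. *)
Let far q t s : perp q t -> (2 * r) ^+ 2 <= q.1 ^+ 2 + q.2 ^+ 2 + s ^+ 2 -> r <= `|q + s *: dir2 t|.
Proof.
move=> hp h; rewrite leNgt; apply/negP; rewrite prod_normE gt_max /= /GRing.scale /=.
have e : (q.1 + s * cos t) ^+ 2 + (q.2 + s * sin t) ^+ 2 = q.1 ^+ 2 + q.2 ^+ 2 + s ^+ 2.
  transitivity (q.1 ^+ 2 + q.2 ^+ 2 + s ^+ 2 * (cos t ^+ 2 + sin t ^+ 2) +
    2 * s * (q.1 * cos t + q.2 * sin t)); first by ring.
  by rewrite hp cos2Dsin2 mulr1 mulr0 addr0.
have sq (b : R) : `|b| < r -> b ^+ 2 < r ^+ 2.
  by move=> hb; rewrite -real_normK ?num_real// ltrXn2r//; exact: ltW.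
move=> /andP[/sq h1 /sq h2]; move: h; rewrite -e exprMn.
have := sqr_ge0 r; move: h1 h2; lra.
Qed.

Let far_s q t s : perp q t -> 2 * r <= `|s| -> r <= `|q + s *: dir2 t|.
Proof.
move=> hp hs; apply: far => //.
have : (2 * r) ^+ 2 <= s ^+ 2.
  by rewrite -[s ^+ 2]real_normK ?num_real// ler_pXn2r ?nnegrE// mulr_ge0// ltW.
have := sqr_ge0 q.1; have := sqr_ge0 q.2; lra.
Qed.

Let w q t j s := \sum_k S q t s k j * f k (q + s *: dir2 t).1 (q + s *: dir2 t).2.

Let f0 k p : r <= `|p| -> f k p.1 p.2 = 0.
Proof. by move=> h; rewrite fE dB10// dB20// subrr. Qed.

Let w0 q t j s : r <= `|q + s *: dir2 t| -> w q t j s = 0.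
Proof. by move=> h; rewrite /w big1// => k _; rewrite f0// mulr0. Qed.

Let f_C1 k := C1D (C1_fld eta1 e11 e22 e12 e1eta e2eta k dB1_smooth)
  (C1M (C1_cst (- 1)) (C1_fld eta1 e11 e22 e12 e1eta e2eta k dB2_smooth)).

Let line_cts (h : R -> R -> R) q t : cts2 h ->
  continuous (fun s => h (q + s *: dir2 t).1 (q + s *: dir2 t).2).
Proof.
move=> ch; apply: (cts_app2 (f := h)) => //=; rewrite /GRing.scale/=.
  by apply: ctsD; [exact: cts_cst|apply: ctsM; [exact: cts_id|exact: cts_cst]].
by apply: ctsD; [exact: cts_cst|apply: ctsM; [exact: cts_id|exact: cts_cst]].
Qed.

Let cS q t k j : continuous (fun s => S q t s k j).
Proof. by move=> s; apply: der_continuous (S_ode q t k j s). Qed.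

Let cw q t j : continuous (w q t j).
Proof.
apply: cts_sum => k; apply: ctsM; first exact: cS.
by apply: line_cts; have [] := f_C1 k.
Qed.

Let Bfar_const q t s : perp q t -> 2 * r <= s -> S q t s = S q t (2 * r).
Proof.
move=> hp hs; apply/matrixP => i j.
have da u : 2 * r <= u <= s -> \sum_k a q t i k u * S q t u k j = 0.
  move=> /andP[hu _]; rewrite big1// => k _; rewrite /a B0 ?H0 ?mulr0 ?mul0r//.
  by apply: far_s => //; rewrite ler_normr hu.
apply/eqP; rewrite eq_le; apply/andP; split.
  by apply: (der_le_nincr hs (S_ode q t i j)) => u /da ->.
rewrite -lerN2.
by apply: (der_le_nincr hs (fun u => derN (S_ode q t i j u))) => u /da ->; rewrite oppr0.
Qed.

Let forward q t : perp q t -> forward_map Sigma (pnt q) (drc t) = S q t (2 * r).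
Proof.
move=> hp; rewrite /forward_map; apply: cvg_lim; first exact: norm_hausdorff.
apply: cvg_near_cst; near=> s; apply: Bfar_const => //.
Unshelve. all: by end_near. Qed.

(** The limit of [Sigma] is reached at [s = 2 * r], so the forward map is orthogonal and can be
    cancelled; injectivity of [H] does the rest. *)
Let line_eq q t : perp q t ->
  line_integral Sigma dB1 (pnt q) (drc t) = line_integral Sigma dB2 (pnt q) (drc t).
Proof.
move=> hp; have := DS_eq (pntP q) (drcP t).
rewrite /D_forward_map -/g => /(scalerI g0); rewrite forward// => h.
apply: H_inj.
by rewrite -[LHS]mul1mx -[RHS]mul1mx -(STS q t (2 * r)) -!mulmxA h.
Qed.

Let int_w0 q t j : perp q t -> \int[lebesgue_measure]_(s in [set: R]) w q t j s = 0.
Proof.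
move=> hp.
pose wk (dB : E -> E) s := ((S q t s)^T *m dB (pnt q + s *: drc t)) j 0.
have wE s : w q t j s = wk dB1 s - wk dB2 s.
  rewrite /w /wk !mxE -sumrB; apply: eq_bigr => k _.
  by rewrite fE /pnt /drc ptD !mxE mulrBr.
have wk0 (dB : E -> E) : (forall p, r <= `|p| -> dB (pnt p) = 0) ->
    forall s, s < - (2 * r) \/ 2 * r < s -> wk dB s = 0.
  move=> dB0 s hs; rewrite /wk /pnt /drc ptD dB0 ?mulmx0 ?mxE//.
  apply: far_s => //; rewrite ler_normr; apply/orP.
  by case: hs => h; [right|left]; move: h; lra.
have cwk (dB : E -> E) : smooth_on_plane eta z dB -> continuous (wk dB).
  move=> sm; rewrite /wk; under eq_fun do rewrite mxE.
  apply: cts_sum => k; under eq_fun do rewrite mxE.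
  apply: ctsM; first exact: cS.
  have [c _ _ _ _] := C1_fld eta1 e11 e22 e12 e1eta e2eta k sm.
  have -> : (fun s => dB (pnt q + s *: drc t) k 0) =
      (fun s => fld eta z e1 e2 dB k (q + s *: dir2 t).1 (q + s *: dir2 t).2).
    by apply/funext => s; rewrite /pnt /drc ptD /fld.
  exact: line_cts c.
rewrite -(itg_supp (a := - (2 * r)) (b := 2 * r)); last first.
  by move=> s hs; rewrite wE !wk0 ?subrr.
under eq_itg do rewrite wE.
rewrite itgB; [|exact: cwk|exact: cwk].
rewrite !itg_supp; [|exact: wk0|exact: wk0].
have := line_eq hp => /matrixP/(_ j 0); rewrite !mxE => ->.
by rewrite subrr.
Qed.

Let rho := 2 * r.
(** Variation of constants: S times the primitive of S^T f. Its initial condition holds before the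
    support, and vanishing line integrals make it 0 after the support too. *)
Let Y q t i s := \sum_j S q t s i j * primitive rho (w q t j) s.

Let dY q t i s : perp q t -> der (Y q t i) s
  (\sum_k a q t i k s * Y q t k s + f i (q + s *: dir2 t).1 (q + s *: dir2 t).2).
Proof.
move=> hp.
have dG j : der (primitive rho (w q t j)) s (w q t j s).
  by apply: der_primitive => // u hu; apply: w0; exact: far_s.
apply: der_eq (der_sum _ (fun j => derM (S_ode q t i j s) (dG j))) _.
rewrite big_split/= addrC; congr (_ + _).
  rewrite /Y; under [RHS]eq_bigr do rewrite mulr_sumr.
  rewrite [RHS]exchange_big; apply: eq_bigr => j _ /=.
  by rewrite mulr_sumr; apply: eq_bigr => k _; ring.
rewrite /w; under eq_bigr do rewrite mulr_sumr.
rewrite exchange_big/=.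
(* Orthogonality in the form S S^T = 1 reduces the source S (S^T f) to [f]. *)
have o k : \sum_j S q t s i j * S q t s k j = (i == k)%:R.
  have /matrixP/(_ i k) := SST q t s; rewrite !mxE => <-.
  by apply: eq_bigr => j _; rewrite mxE.
under eq_bigr => k _ do (under eq_bigr do rewrite mulrA; rewrite -mulr_suml o).
rewrite (bigD1 i)//= eqxx mul1r big1 ?addr0// => k; rewrite eq_sym => /negbTE ->.
by rewrite mul0r.
Qed.

Let U i p t := Y (foot p t) t i (p.1 * cos t + p.2 * sin t).

Let foot_line p t s : foot (p + s *: dir2 t) t = foot p t.
Proof.
rewrite /foot; have h := cos2Dsin2 t.
have -> : (p + s *: dir2 t).1 * cos t + (p + s *: dir2 t).2 * sin t =
  p.1 * cos t + p.2 * sin t + s.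
  rewrite /= /GRing.scale/=; transitivity (p.1 * cos t + p.2 * sin t + s * (cos t ^+ 2 + sin t ^+ 2)).
    by ring.
  by rewrite h mulr1.
by rewrite scalerDl opprD addrACA subrr addr0.
Qed.

Let coord_line p t s : (p + s *: dir2 t).1 * cos t + (p + s *: dir2 t).2 * sin t =
  s + (p.1 * cos t + p.2 * sin t).
Proof.
have h := cos2Dsin2 t.
rewrite /= /GRing.scale/=; transitivity (p.1 * cos t + p.2 * sin t + s * (cos t ^+ 2 + sin t ^+ 2)).
  by ring.
by rewrite h mulr1 addrC.
Qed.

Let foot_add p t s : foot p t + (s + (p.1 * cos t + p.2 * sin t)) *: dir2 t = p + s *: dir2 t.
Proof. by rewrite /foot [(s + _) *: _]scalerDl addrCA subrK addrC. Qed.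

Let A i j x y := g * \sum_k H (delta_mx k 0) i j * fld eta z e1 e2 B k x y.

Let A_E i j p : A i j p.1 p.2 = g * H (B (pnt p)) i j.
Proof. by rewrite /A H_linear /fld. Qed.

Let U_ode i p t s : der (fun s => U i (p + s *: dir2 t) t) s
  (\sum_j A i j (p + s *: dir2 t).1 (p + s *: dir2 t).2 * U j (p + s *: dir2 t) t +
   f i (p + s *: dir2 t).1 (p + s *: dir2 t).2).
Proof.
pose c := p.1 * cos t + p.2 * sin t.
have UE j u : U j (p + u *: dir2 t) t = Y (foot p t) t j (u + c).
  by rewrite /U foot_line coord_line.
move: (foot p t) (foot_perp p t) (foot_add p t s : foot p t + (s + c) *: dir2 t = _) UE => q hq fa UE.
have -> : \sum_j A i j (p + s *: dir2 t).1 (p + s *: dir2 t).2 * U j (p + s *: dir2 t) t =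
    \sum_k a q t i k (s + c) * Y q t k (s + c).
  by apply: eq_bigr => j _; rewrite UE A_E /a fa.
under eq_fun do rewrite UE.
rewrite -fa.
exact: (@der_shift R (Y q t i) s c _ (@dY q t i (s + c) hq)).
Qed.

(** Let [s] be the position of [p] along its line. If [|s| >= 2 * r], the primitive is outside the
    support and is 0. Otherwise the squared distance of the line from the origin is at least 16 r^2
    - 4 r^2, and the line misses the support. *)
Let U_vanish i p t : 4 * r <= `|p| -> U i p t = 0.
Proof.
move=> hp; rewrite /U /Y big1// => j _; have hq := foot_perp p t.
set s := _ + _.
suff -> : primitive rho (w (foot p t) t j) s = 0 by rewrite mulr0.
have ws u : 2 * r <= `|u| -> w (foot p t) t j u = 0 by move=> hu; apply: w0; exact: far_s.
have [hs|hs] := lerP rho `|s|; first by apply: primitive_eq0 => //; exact: int_w0.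
rewrite /primitive -[RHS](itg0 (- rho - 1) s); apply: eq_itg => u _.
apply: w0; apply: far => //.
have p2 : (4 * r) ^+ 2 <= p.1 ^+ 2 + p.2 ^+ 2.
  have sq (b : R) : 4 * r <= `|b| -> (4 * r) ^+ 2 <= b ^+ 2.
    by move=> hb; rewrite -[b ^+ 2]real_normK ?num_real// ler_pXn2r ?nnegrE// mulr_ge0// ltW.
  move: hp; rewrite le_prod_norm => /orP[/sq h|/sq h].
    by rewrite (le_trans h)// lerDl sqr_ge0.
  by rewrite (le_trans h)// lerDr sqr_ge0.
have s2 : s ^+ 2 <= (2 * r) ^+ 2.
  by rewrite -[s ^+ 2]real_normK ?num_real// lerXn2r ?nnegrE ?(ltW hs)// mulr_ge0// ltW.
have e : (foot p t).1 ^+ 2 + (foot p t).2 ^+ 2 = p.1 ^+ 2 + p.2 ^+ 2 - s ^+ 2.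
  rewrite /foot -/s /= /GRing.scale/=.
  transitivity (p.1 ^+ 2 + p.2 ^+ 2 + s ^+ 2 * (cos t ^+ 2 + sin t ^+ 2) -
    2 * s * (p.1 * cos t + p.2 * sin t)); first by ring.
  by rewrite cos2Dsin2 mulr1 -/s; ring.
rewrite e; move: p2 s2; rewrite !exprMn; have := sqr_ge0 u; have := sqr_ge0 r; lra.
Qed.

Lemma fields_agree x : plane eta z x -> dB1 x = dB2 x.
Proof.
move=> /(pt_surj eta1 e11 e22 e12 e1eta e2eta) ->.
set p := (_, _); apply/matrixP => i j; rewrite (ord1 j); apply/eqP; rewrite -subr_eq0.
have B_C1 k := C1_fld eta1 e11 e22 e12 e1eta e2eta k B_smooth.
have A_C1 i' j' := C1M (C1_cst g) (C1_sum (index_enum 'I_3)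
  (fun k => C1M (C1_cst (H (delta_mx k 0) i' j')) (B_C1 k))).
have rr : r <= 4 * r by move: r0; lra.
have vf k : vanish (4 * r) (f k).
  move=> x' y' h; apply: (@f0 k (x', y')); apply: le_trans rr _.
  by rewrite le_prod_norm; apply/orP.
have vA i' j' : vanish (4 * r) (A i' j').
  move=> x' y' h; rewrite (A_E i' j' (x', y')) B0 ?H0 ?mulr0//.
  by apply: le_trans rr _; rewrite le_prod_norm; apply/orP.
have r4 : 0 < 4 * r by rewrite mulr_gt0.
have sk i' j' x' y' : A i' j' x' y' = - A j' i' x' y'.
  by rewrite (A_E i' j' (x', y')) (A_E j' i' (x', y')) H_skew mulrN.
apply/eqP; rewrite -[LHS](fE i p).
exact: (transport_source_eq0 r4 A_C1 sk vA f_C1 vf U_vanish U_ode i p.1 p.2).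
Qed.

End Main.

Theorem mainTheorem3 (R : realType) (gammaN v : R)
    (hgammaN : gammaN != 0) (hv : 0 < v)
    (eta : 'cV[R]_3) (heta : unit_vector eta) (z : R)
    (B : 'cV[R]_3 -> 'cV[R]_3)
    (hB_smooth : smooth_on_plane eta z B)
    (hB_supp : compact_support_on_plane eta z B)
    (Sigma : 'cV[R]_3 -> 'cV[R]_3 -> 'M[R]_3)
    (hSigma : is_Sigma gammaN v eta z B Sigma) :
  (forall dB1 dB2 : 'cV[R]_3 -> 'cV[R]_3,
     smooth_on_plane eta z dB1 -> compact_support_on_plane eta z dB1 ->
     smooth_on_plane eta z dB2 -> compact_support_on_plane eta z dB2 ->
     (forall x xi, plane eta z x -> direction eta xi ->
        D_forward_map gammaN v Sigma dB1 x xi =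
        D_forward_map gammaN v Sigma dB2 x xi) ->
     forall x, plane eta z x -> dB1 x = dB2 x) /\
  (forall dB : 'cV[R]_3 -> 'cV[R]_3,
     smooth_on_plane eta z dB -> compact_support_on_plane eta z dB ->
     (forall x xi, plane eta z x -> direction eta xi ->
        D_forward_map gammaN v Sigma dB x xi = 0) ->
     forall x, plane eta z x -> dB x = 0).
Proof.
have [e1 [e2 [e11 e22 e12 e1eta e2eta]]] := plane_basis heta.
have supp (g : 'cV[R]_3 -> 'cV[R]_3) : compact_support_on_plane eta z g ->
    exists2 r, 0 < r & forall p : R * R, r <= `|p| -> g (pt eta z e1 e2 p) = 0.
  exact: compact_support_vanish.
have inj (dB1 dB2 : 'cV[R]_3 -> 'cV[R]_3) :
     smooth_on_plane eta z dB1 -> compact_support_on_plane eta z dB1 ->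
     smooth_on_plane eta z dB2 -> compact_support_on_plane eta z dB2 ->
     (forall x xi, plane eta z x -> direction eta xi ->
        D_forward_map gammaN v Sigma dB1 x xi =
        D_forward_map gammaN v Sigma dB2 x xi) ->
     forall x, plane eta z x -> dB1 x = dB2 x.
  move=> s1 c1 s2 c2 h x px.
  have [r r0 hr] := supp _ hB_supp.
  have [r1 r10 hr1] := supp _ c1; have [r2 r20 hr2] := supp _ c2.
  apply: (fields_agree hgammaN hv heta hB_smooth hSigma s1 s2 h e11 e22 e12 e1eta e2eta
    (r := r + r1 + r2)) px.
  - by rewrite !addr_gt0.
  - by move=> p hp; apply: hr; move: hp r10 r20; lra.
  - by move=> p hp; apply: hr1; move: hp r0 r20; lra.
  - by move=> p hp; apply: hr2; move: hp r0 r10; lra.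
split; first exact: inj.
(* The second form is the first one applied to [dB] and the zero field, which has empty support and
   derivative 0. *)
move=> dB s c h x px.
have iter0 (us : seq 'cV[R]_3) : iter_derive us (fun=> 0 : 'cV[R]_3) = fun=> 0.
  by elim: us => //= u us ->; apply/funext => y; rewrite derive_cst.
have s0 : smooth_on_plane eta z (fun=> 0 : 'cV[R]_3).
  move=> us _; rewrite iter0; split.
    by apply: continuous_subspaceT; exact: cst_continuous.
  by move=> y u _ _; exact: derivable_cst.
have c0 : compact_support_on_plane eta z (fun=> 0 : 'cV[R]_3).
  rewrite /compact_support_on_plane.
  have -> : [set y : 'cV[R]_3 | plane eta z y /\ (0 : 'cV[R]_3) <> 0] = set0.
    by apply/seteqP; split => y; [case=> _ /(_ erefl)|case].
  by rewrite closure0; exact: compact0.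
have h0 y u : plane eta z y -> direction eta u ->
    D_forward_map gammaN v Sigma dB y u = D_forward_map gammaN v Sigma (fun=> 0) y u.
  move=> py du; rewrite (h y u py du) /D_forward_map.
  have -> : line_integral Sigma (fun=> 0) y u = 0.
    apply/matrixP => i j; rewrite !mxE; under eq_Rintegral do rewrite mulmx0 mxE.
    by rewrite /Rintegral integral0.
  have -> : H (0 : 'cV[R]_3) = 0 by apply/matrixP => i j; rewrite H0 mxE.
  by rewrite mulmx0 scaler0.
exact: (inj dB (fun=> 0) s c s0 c0 h0 x px).
Qed.
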